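(* Fix $h\in(0,1]$ and $\Delta t>0$ and consider the Galerkin Milstein scheme with rational approximation $R(z)=(1-z)^{-1}$, i.e. $$X_h^{j+1}=(I-\Delta tA_h)^{-1}\Bigl(X_h^j+\Delta t\,P_hFX_h^j+P_hG(X_h^j)\Delta L^j+\sum_{k,\ell=1}^\infty\sqrt{\mu_k\mu_\ell}\,P_hG(G(X_h^j)f_k)f_\ell\int_{t_j}^{t_{j+1}}\!\int_{t_j}^s\mathrm{d}L_k(r)\,\mathrm{d}L_\ell(s)\Bigr),\quad j\in\mathbb{N}_0,$$ with $X_h^0=P_hX_0$. Assume that the bilinear mapping $C'(u_1,u_2)=(I-\Delta tA_h)^{-1}P_hG(G(\cdot)u_1)u_2$, $u_1,u_2\in U$, can be uniquely extended to a mapping $C'\in L(U^{(2)};L(V_h))$. Then the zero solution of the scheme is asymptotically mean-square stable if $$(1+\Delta t\|F\|_{L(H)})^2+\Delta t\,\mathrm{Tr}(Q)\,\|G\|_{L(H;L(U;H))}^2+\frac{\Delta t^2}{2}\mathrm{Tr}(Q)^2\,\|G\|_{L(H;L(U;H))}^4<(1+\Delta t\lambda_{h,1})^2.$$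
   Context: $(\Omega,\mathcal{A},(\mathcal{F}_t)_{t\ge0},P)$ is a complete filtered probability space satisfying the usual conditions; $H$ and $U$ are real separable Hilbert spaces; $U^{(2)}=U\otimes U$ is the Hilbert tensor product, and the bilinear map $C'$ is extended via $C'(u_1\otimes u_2)=C'(u_1,u_2)$, where $C'(u_1,u_2)v=(I-\Delta tA_h)^{-1}P_hG(G(v)u_1)u_2$ for $v\in V_h$. $-A:\mathcal{D}(-A)\subset H\to H$ is densely defined, self-adjoint and positive definite with compact inverse; $F\in L(H)$; $G\in L(H;L(U;H))$, i.e. $G$ is bounded and linear from $H$ to the bounded linear operators $U\to H$. $X_0\in L^2(\Omega;H)$ is $\mathcal{F}_0$-measurable. $L$ is a $U$-valued square-integrable $Q$-L\'evy process with respect to $(\mathcal{F}_t)$ (adapted, $L(t)-L(s)$ independent of $\mathcal{F}_s$ for $s<t$) that is a martingale; its covariance operator $Q\in L(U)$ is self-adjoint, positive semidefinite and of trace class, with orthonormal eigenbasis $(f_k,k\in\mathbb{N})$ of $U$ and eigenvalues $\mu_1\ge\mu_2\ge\dots\ge0$, $Qf_k=\mu_kf_k$. $L$ has the expansion $L(t)=\sum_{k=1}^\infty\sqrt{\mu_k}L_k(t)f_k$ with real-valued, square-integrable, uncorrelated, mean-zero L\'evy processes $L_k$ with $\mathbb{E}[L_k(t)^2]=t$ (for $\mu_k>0$, $L_k(t)=\mu_k^{-1/2}\langle L(t),f_k\rangle_U$). $t_j=j\Delta t$, $\Delta L^j=L(t_{j+1})-L(t_j)$, and $\int_a^b\int_a^s\mathrm{d}L_k(r)\,\mathrm{d}L_\ell(s)=\int_a^b(L_k(s-)-L_k(a))\,\mathrm{d}L_\ell(s)$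 is the iterated stochastic integral. $\dot H^1=\mathcal{D}((-A)^{1/2})$ with inner product $\langle\cdot,\cdot\rangle_1=\langle(-A)^{1/2}\cdot,(-A)^{1/2}\cdot\rangle_H$. $V_h\subset\dot H^1\subset H$ is a finite-dimensional subspace with the norm of $H$; $P_h$ is the $H$-orthogonal projection onto $V_h$; $-A_h:V_h\to V_h$ is defined by $\langle-A_hv,w\rangle_H=\langle v,w\rangle_1$ for all $v,w\in V_h$; it is self-adjoint and positive definite with smallest eigenvalue $\lambda_{h,1}>0$. The zero solution of the scheme is $X_{h,\mathrm e}^j=0$ for all $j$. It is mean-square stable if for every $\varepsilon>0$ there is $\delta>0$ such that $\mathbb{E}[\|X_h^j\|_H^2]<\varepsilon$ for all $j\in\mathbb{N}_0$ whenever ($X_h^0\in L^2(\Omega;V_h)$ is $\mathcal{F}_0$-measurable and) $\mathbb{E}[\|X_h^0\|_H^2]<\delta$. It is asymptotically mean-square stable if it is mean-square stable and there is $\delta>0$ such that $\mathbb{E}[\|X_h^0\|_H^2]<\delta$ implies $\lim_{j\to\infty}\mathbb{E}[\|X_h^j\|_H^2]=0$. *)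

(* Defs.v *)
(* MathComp-Analysis throughout; [R : realType] is the field of real numbers. *)
From HB Require Import structures.
From mathcomp Require Import all_boot all_order all_algebra.
From mathcomp Require Import all_classical all_reals all_analysis.

Set Implicit Arguments.
Unset Strict Implicit.
Unset Printing Implicit Defensive.

Import Order.TTheory GRing.Theory Num.Theory.
Import numFieldNormedType.Exports.

Local Open Scope classical_set_scope.
Local Open Scope ring_scope.

(** * Real Hilbert spaces *)

HB.mixin Record CompleteNormedModule_isHilbert (R : realType) H
    of CompleteNormedModule R H := {
  inner : H -> H -> R ;
  innerC : forall x y, inner x y = inner y x ;
  inner_linearl : forall a x y z,
    inner (a *: x + y) z = a * inner x z + inner y z ;
  inner_normE : forall x, inner x x = `|x| ^+ 2
}.

#[short(type="hilbertType")]
HB.structure Definition Hilbert (R : realType) :=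
  {H of CompleteNormedModule R H & CompleteNormedModule_isHilbert R H}.

Definition separable (T : topologicalType) : Prop :=
  exists D : set T, countable D /\ dense D.

Definition orthonormal_basis (R : realType) (H : hilbertType R)
    (e : nat -> H) : Prop :=
  (forall i j, inner (e i) (e j) = (i == j)%:R) /\
  (forall x, series (fun k => inner x (e k) *: e k) @ \oo --> x).

(* [U2] with [tens] is the Hilbert tensor product of [U] with itself: these
   properties determine it up to a unique isometric isomorphism.  Scalars are
   absorbed in the factors of the elementary tensors. *)
Record hilbert_tensor_product (R : realType) (U U2 : hilbertType R)
    (tens : {bilinear U -> U -> U2}) : Prop := {
  tens_inner : forall u1 u2 v1 v2,
    inner (tens u1 u2) (tens v1 v2) = inner u1 v1 * inner u2 v2 ;
  tens_total : dense [set x : U2 | exists n (a b : 'I_n -> U),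
    x = \sum_(i < n) tens (a i) (b i)]
}.

(** * Bounded operators *)

Definition opnorm (R : realType) (E E' : normedModType R) (T : E -> E') : R :=
  sup [set `|T x| | x in [set x : E | `|x| <= 1]].

(* Elements of L(H; L(U; H)) are curried. *)
Record bounded_operator_valued (R : realType) (H U : hilbertType R)
    (G : {bilinear H -> U -> H}) : Prop := {
  bov_bounded : forall v, continuous (G v) ;
  bov_bound : exists M : R, forall v, opnorm (G v) <= M * `|v|
}.

Definition opnorm2 (R : realType) (H U : hilbertType R) (G : H -> U -> H) : R :=
  sup [set opnorm (G v) | v in [set v : H | `|v| <= 1]].

(** * Operators defined on a subspace *)

Section operators.
Context {R : realType} {H : hilbertType R}.
Implicit Types (D V : set H) (T S : H -> H).

Definition linear_on D T : Prop :=
  [/\ D 0, (forall (a : R) x y, D x -> D y -> D (a *: x + y)) &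
     (forall (a : R) x y, D x -> D y -> T (a *: x + y) = a *: T x + T y)].

(* The third condition says that the graph of T is the graph of its adjoint. *)
Definition self_adjoint D T : Prop :=
  [/\ linear_on D T, dense D &
     forall y z, (D y /\ T y = z) <->
                 (forall x, D x -> inner (T x) y = inner x z)].

Definition positive_definite D T : Prop :=
  forall x, D x -> x != 0 -> 0 < inner (T x) x.

Definition has_compact_inverse D T : Prop :=
  exists S : {linear H -> H},
    [/\ (forall y, D (S y) /\ T (S y) = y), (forall x, D x -> S (T x) = x) &
       precompact (S @` [set x : H | `|x| <= 1])].

(* (DS, S) is the nonnegative self-adjoint square root of (D, T). *)
Definition operator_sqrt D T DS S : Prop :=
  [/\ self_adjoint DS S, (forall x, DS x -> 0 <= inner (S x) x) &
     forall x y, (D x /\ T x = y) <-> [/\ DS x, DS (S x) & S (S x) = y]].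

Definition finite_dim_subspace V : Prop :=
  exists n (b : 'I_n -> H),
    V = [set \sum_(i < n) c i *: b i | c in [set: 'I_n -> R]].

Definition orthogonal_projection V T : Prop :=
  forall x, V (T x) /\ (forall w, V w -> inner (x - T x) w = 0).

(* The Galerkin operator A_h on V of the form <B v, B w>. *)
Definition galerkin_operator V (B Ah : H -> H) : Prop :=
  (forall v, V v -> V (Ah v)) /\
  (forall v w, V v -> V w -> inner (- Ah v) w = inner (B v) (B w)).

(* (I - dt A_h)^-1, as the inverse of a map V -> V. *)
Definition resolvent V (Ah : H -> H) (dt : R) : H -> H :=
  'pinv_(fun=> 0) V (fun v => v - dt *: Ah v).

Definition eigenvalue_on V T (l : R) : Prop :=
  exists v, [/\ V v, v != 0 & T v = l *: v].

Definition smallest_eigenvalue V T (l : R) : Prop :=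
  eigenvalue_on V T l /\ (forall l', eigenvalue_on V T l' -> l <= l').

End operators.

(* [Ce : U2 -> L(V)] is a bounded linear extension to the tensor product of the
   bilinear map [C] with values in L(V); only the values on V matter. *)
Record tensor_extension (R : realType) (H U U2 : hilbertType R) (V : set H)
    (tens : U -> U -> U2) (C : U -> U -> H -> H) (Ce : U2 -> H -> H) : Prop := {
  tensor_ext_stable : forall w v, V v -> V (Ce w v) ;
  tensor_ext_linear : forall w, linear_on V (Ce w) ;
  tensor_ext_linearl : forall (a : R) w w' v, V v ->
    Ce (a *: w + w') v = a *: Ce w v + Ce w' v ;
  tensor_ext_bounded : exists M : R, forall w v, V v ->
    `|Ce w v| <= M * `|w| * `|v| ;
  tensor_ext_eq : forall u1 u2 v, V v -> Ce (tens u1 u2) v = C u1 u2 v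
}.

Definition uniquely_extends_to_tensor (R : realType) (H U U2 : hilbertType R)
    (V : set H) (tens : U -> U -> U2) (C : U -> U -> H -> H) : Prop :=
  exists Ce, tensor_extension V tens C Ce /\
    (forall Ce', tensor_extension V tens C Ce' ->
       forall w v, V v -> Ce' w v = Ce w v).

(** * Trace class operators *)

(* For a nonnegative operator neither notion depends on the basis [e]. *)
Definition trace_class (R : realType) (U : hilbertType R) (e : nat -> U)
    (Q : U -> U) : Prop := cvgn (series (fun k => inner (Q (e k)) (e k))).

Definition trace (R : realType) (U : hilbertType R) (e : nat -> U)
    (Q : U -> U) : R := limn (series (fun k => inner (Q (e k)) (e k))).

(** * Stochastic processes in continuous time *)

Section processes.
Context {d : measure_display} {Omega : measurableType d} {R : realType}.
Variables (P : probability Omega R) (Ft : R -> set (set Omega)).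

(* Only the times t >= 0 matter. *)
Record usual_filtration : Prop := {
  filt_complete : measure_is_complete P ;
  filt_sigma : forall t, 0 <= t -> sigma_algebra setT (Ft t) ;
  filt_measurable : forall t, 0 <= t -> Ft t `<=` measurable ;
  filt_mono : forall s t, 0 <= s -> s <= t -> Ft s `<=` Ft t ;
  filt_null : P.-negligible `<=` Ft 0 ;
  filt_right_continuous : forall t, 0 <= t ->
    \bigcap_(s in [set s | t < s]) Ft s `<=` Ft t
}.

Definition borel (E : topologicalType) : set (set E) := <<s @open E >>.

Definition measurable_wrt (E : topologicalType) (F : set (set Omega))
    (X : Omega -> E) : Prop := forall B, borel B -> F (X @^-1` B).

Definition mean_square (E : normedModType R) (X : Omega -> E) : \bar R :=
  'E_P[fun w => (`|X w| ^+ 2)%R]%E.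

Definition square_integrable (E : normedModType R) (X : Omega -> E) : Prop :=
  measurable_wrt measurable X /\ (mean_square X < +oo)%E.

Definition adapted (E : topologicalType) (X : R -> Omega -> E) : Prop :=
  forall t, 0 <= t -> measurable_wrt (Ft t) (X t).

(* Conditional expectations of vector-valued variables are tested against
   the events of F_s and the vectors of U. *)
Record martingale (U : hilbertType R) (M : R -> Omega -> U) : Prop := {
  mart_adapted : adapted M ;
  mart_integrable : forall t, 0 <= t -> ('E_P[fun w => `|M t w|%R] < +oo)%E ;
  mart_cond : forall s t A u, 0 <= s -> s <= t -> Ft s A ->
    (\int[P]_(w in A) (inner (M t w) u)%:E =
     \int[P]_(w in A) (inner (M s w) u)%:E)%E
}.

Definition cadlag (E : normedModType R) (x : R -> E) : Prop :=
  (forall t, 0 <= t -> x s @[s --> t^'+] --> x t) /\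
  (forall t, 0 < t -> cvg (x s @[s --> t^'-])).

Definition increment (U : hilbertType R) (L : R -> Omega -> U) (s t : R)
    (w : Omega) : U := L t w - L s w.

Record levy_process (U : hilbertType R) (L : R -> Omega -> U) : Prop := {
  levy_adapted : adapted L ;
  levy_0 : {ae P, forall w, L 0 w = 0} ;
  levy_independent : forall s t A B, 0 <= s -> s <= t -> Ft s A -> borel B ->
    P (A `&` increment L s t @^-1` B) = (P A * P (increment L s t @^-1` B))%E ;
  levy_stationary : forall s t B, 0 <= s -> s <= t -> borel B ->
    P (increment L s t @^-1` B) = P (increment L 0 (t - s) @^-1` B) ;
  levy_stochastically_continuous : forall (eps t : R), 0 < eps -> 0 <= t ->
    P [set w | eps < `|L s w - L t w|] @[s --> within [set s | 0 <= s] (nbhs t)]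
      --> 0%E ;
  levy_cadlag : {ae P, forall w, cadlag (L ^~ w)}
}.

(* [Q] is the covariance operator of the centred process [L]. *)
Definition covariance_operator (U : hilbertType R) (L : R -> Omega -> U)
    (Q : U -> U) : Prop :=
  forall t u v, 0 <= t ->
    'E_P[fun w => (inner (L t w) u * inner (L t w) v)%R]%E =
    (t * inner (Q u) v)%:E.

(** Ito integral on ]a, b] against a real square-integrable martingale. *)

(* The elementary process
   \sum_(i < sp_size) sp_coef i * \1_(]sp_time i, sp_time i.+1]). *)
Record simple_process := SimpleProcess {
  sp_size : nat ;
  sp_time : nat -> R ;
  sp_coef : nat -> Omega -> R
}.

Definition predictable_on (a b : R) (phi : simple_process) : Prop :=
  [/\ sp_time phi 0%N = a, sp_time phi (sp_size phi) = b &
     forall i, (i < sp_size phi)%N ->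
       [/\ sp_time phi i <= sp_time phi i.+1,
           measurable_wrt (Ft (sp_time phi i)) (sp_coef phi i) &
           exists C : R, forall w, `|sp_coef phi i w| <= C]].

Definition simple_eval (phi : simple_process) (s : R) (w : Omega) : R :=
  \sum_(i < sp_size phi)
    sp_coef phi i w * \1_(`]sp_time phi i, sp_time phi i.+1]%classic) s.

Definition simple_integral (phi : simple_process) (M : R -> Omega -> R)
    (w : Omega) : R :=
  \sum_(i < sp_size phi)
    sp_coef phi i w * (M (sp_time phi i.+1) w - M (sp_time phi i) w).

(* [J] is a version of the stochastic integral of [Phi] against [M] on ]a, b],
   for [M] with predictable quadratic variation t (whence the Lebesgue measure):
   the limit in L^2 of the integrals of simple predictable processes that
   converge to [Phi] in L^2(dP ds). *)
Definition stochastic_integral (M Phi : R -> Omega -> R) (a b : R)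
    (J : Omega -> R) : Prop :=
  measurable_wrt measurable J /\
  exists phi : nat -> simple_process,
    [/\ (forall n, predictable_on a b (phi n)),
       ((\int[P]_w \int[lebesgue_measure]_(s in `]a, b]%classic)
           ((simple_eval (phi n) s w - Phi s w) ^+ 2)%R%:E)%E
         @[n --> \oo] --> 0%E) &
       (mean_square (fun w => simple_integral (phi n) M w - J w)
         @[n --> \oo] --> 0%E)].

(* L_k = mu_k^(-1/2) <L, f_k>.  As 0^-1 = 0, this is 0 if mu_k = 0, when L_k
   only occurs with the coefficient sqrt(mu_k) = 0. *)
Definition levy_coord (U : hilbertType R) (L : R -> Omega -> U)
    (mu : nat -> R) (f : nat -> U) (k : nat) (t : R) (w : Omega) : R :=
  (Num.sqrt (mu k))^-1 * inner (L t w) (f k).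

(* \int_a^b (M(s-) - M(a)) dN(s) *)
Definition iterated_integral (M N : R -> Omega -> R) (a b : R)
    (J : Omega -> R) : Prop :=
  stochastic_integral N (fun s w => lim (M r w @[r --> s^'-]) - M a w) a b J.

(** * The Galerkin Milstein scheme with R(z) = (1 - z)^-1 *)

(* [Rh] stands for (I - dt A_h)^-1.  The double series over k and l converges
   in L^2(Omega; H), to [S]; its terms are pairwise orthogonal, so that the
   order of summation is immaterial. *)
Definition milstein_step (H U : hilbertType R) (Rh Ph F : H -> H)
    (G : H -> U -> H) (L : R -> Omega -> U) (mu : nat -> R) (f : nat -> U)
    (dt : R) (X : nat -> Omega -> H) (j : nat) : Prop :=
  let t i := i%:R * dt in
  exists (J : nat -> nat -> Omega -> R) (S : Omega -> H),
    [/\ (forall k l, iterated_integral (levy_coord L mu f k)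
           (levy_coord L mu f l) (t j) (t j.+1) (J k l)),
       measurable_wrt measurable S,
       (mean_square (fun w => (\sum_(k < N) \sum_(l < N)
            (Num.sqrt (mu k * mu l) * J k l w) *:
               Ph (G (G (X j w) (f k)) (f l))) - S w)
         @[N --> \oo] --> 0%E) &
       {ae P, forall w, X j.+1 w =
          Rh (X j w + dt *: Ph (F (X j w))
              + Ph (G (X j w) (increment L (t j) (t j.+1) w)) + S w)}].

Definition milstein_scheme (H U : hilbertType R) (Rh Ph F : H -> H)
    (G : H -> U -> H) (L : R -> Omega -> U) (mu : nat -> R) (f : nat -> U)
    (dt : R) (X0 : Omega -> H) (X : nat -> Omega -> H) : Prop :=
  (forall w, X 0%N w = Ph (X0 w)) /\
  (forall j, milstein_step Rh Ph F G L mu f dt X j).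

(** * Mean-square stability of the zero solution *)

(* [scheme] is the set of all sequences generated by the scheme. *)

Definition initial_value (H : hilbertType R) (V : set H) (x : Omega -> H) :
    Prop :=
  [/\ square_integrable x, measurable_wrt (Ft 0) x & forall w, V (x w)].

Definition mean_square_stable (H : hilbertType R) (V : set H)
    (scheme : set (nat -> Omega -> H)) : Prop :=
  forall eps : R, 0 < eps -> exists2 delta : R, 0 < delta &
    forall X, scheme X -> initial_value V (X 0%N) ->
      (mean_square (X 0%N) < delta%:E)%E ->
      forall j, (mean_square (X j) < eps%:E)%E.

Definition asymptotically_mean_square_stable (H : hilbertType R) (V : set H)
    (scheme : set (nat -> Omega -> H)) : Prop :=
  mean_square_stable V scheme /\
  exists2 delta : R, 0 < delta &
    forall X, scheme X -> initial_value V (X 0%N) ->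
      (mean_square (X 0%N) < delta%:E)%E ->
      mean_square (X j) @[j --> \oo] --> 0%E.

End processes.

(* Main.v *)
(* One step of the scheme is Y -> (I - dt A_h)^-1 Y, where Y collects the drift,
   the noise and the iterated integrals.  As the smallest eigenvalue of -A_h is
   the minimum of its Rayleigh quotient, the resolvent divides the norm by at
   least 1 + dt lambda.  It remains to bound E|Y|^2 by c E|X|^2, with c the left
   hand side of the stability condition: E|X^j|^2 then decays geometrically.

   To bound E|Y|^2, let pi_N be the projection on the first N eigenvectors of Q
   and, on an equidistant grid r_0 < ... < r_m of [t_j, t_(j+1)], put
     Xi_(i+1) = Xi_i + G(X, pi_N (L(r_(i+1)) - L(r_i))),        Xi_0 = X,
     Z_(i+1)  = Z_i + P_h G(Xi_i, pi_N (L(r_(i+1)) - L(r_i))),  Z_0 = X + dt P_h F X.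
   The increments of L are centred and independent of the past, so each step
   adds exactly the second moment of its increment; this gives the bound c for
   Z_m.  On the other hand Z_m is Y with the series truncated at N and the
   iterated integrals replaced by their left-point Riemann sums, which converge
   to them by the Ito isometry for elementary integrands.  All approximation
   errors are multiplied by X, which is therefore first cut off at norm M. *)
Require Import Defs.
From HB Require Import structures.
From mathcomp Require Import all_boot all_order all_algebra.
From mathcomp Require Import all_classical all_reals all_analysis.
From mathcomp Require Import measurable_realfun ring lra.

Set Implicit Arguments.
Unset Strict Implicit.
Unset Printing Implicit Defensive.

Import Order.TTheory GRing.Theory Num.Theory.
Import numFieldNormedType.Exports.

Local Open Scope classical_set_scope.
Local Open Scope ring_scope.

(** * Hilbert spaces and the Galerkin operator *)

(** The stability condition contains the exact constant [c], so no factor may be lost in the limits: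
    they use Young's inequality with a small parameter, and Fatou's lemma. The factor 1/2 in [c]
    comes from treating the single and the double integral together. With [C = |G|^2 Tr(Q)], a grid
    step of length [r] adds at most [C r E|Xi_i|^2 <= C r (1 + C i r) E|X|^2], and these sum to at
    most [(C dt + (C dt)^2 / 2) E|X|^2]. Since [|pi_N dL|^2 = sum_k mu_k dL_k^2], only the variances
    of the coordinates enter.

    An iterated integral is known only through some sequence of simple processes, on partitions of
    its own. Comparing it with a left-point Riemann sum requires the L2 distance of the integrands
    on [Omega x ]a, b]], hence Tonelli's theorem and a product-measurable version of the left
    limits.

    Integrals and states are determined up to null sets only. As [F_0] contains these, the next
    state is again measurable at its own time, which the independence of later increments requires.
    Vector-valued variables are written as finite combinations of fixed vectors, so that integration
    stays real-valued. *)

Section inner_product.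
Context {R : realType} {H : hilbertType R}.
Implicit Types x y z : H.

Lemma innerDl x y z : inner (x + y) z = inner x z + inner y z.
Proof. by rewrite -[x]scale1r inner_linearl mul1r scale1r. Qed.

Lemma inner0l x : inner 0 x = 0.
Proof. by have := innerDl 0 0 x; rewrite addr0; lra. Qed.

Lemma innerZl a x y : inner (a *: x) y = a * inner x y.
Proof. by rewrite -[a *: x]addr0 inner_linearl inner0l addr0. Qed.

Lemma innerNl x y : inner (- x) y = - inner x y.
Proof. by rewrite -scaleN1r innerZl mulN1r. Qed.

Lemma innerBl x y z : inner (x - y) z = inner x z - inner y z.
Proof. by rewrite innerDl innerNl. Qed.

Lemma innerDr x y z : inner z (x + y) = inner z x + inner z y.
Proof. by rewrite !(innerC z) innerDl. Qed.

Lemma inner0r x : inner x 0 = 0.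
Proof. by rewrite innerC inner0l. Qed.

Lemma innerZr a x y : inner y (a *: x) = a * inner y x.
Proof. by rewrite !(innerC y) innerZl. Qed.

Lemma innerNr x y : inner y (- x) = - inner y x.
Proof. by rewrite !(innerC y) innerNl. Qed.

Lemma innerBr x y z : inner z (x - y) = inner z x - inner z y.
Proof. by rewrite innerDr innerNr. Qed.

Lemma inner_suml (I : Type) (r : seq I) (P : pred I) (v : I -> H) z :
  inner (\sum_(i <- r | P i) v i) z = \sum_(i <- r | P i) inner (v i) z.
Proof.
by apply: (big_morph (inner^~ z)) => [x y|]; rewrite ?innerDl ?inner0l.
Qed.

Lemma inner_sumr (I : Type) (r : seq I) (P : pred I) (v : I -> H) z :
  inner z (\sum_(i <- r | P i) v i) = \sum_(i <- r | P i) inner z (v i).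
Proof. by rewrite innerC inner_suml; apply: eq_bigr => i _; rewrite innerC. Qed.

Lemma norm_sqrD x y : `|x + y| ^+ 2 = `|x| ^+ 2 + 2 * inner x y + `|y| ^+ 2.
Proof.
by rewrite -!inner_normE !innerDl !innerDr (innerC y x); ring.
Qed.

Lemma cauchy_schwarz x y : `|inner x y| <= `|x| * `|y|.
Proof.
have [->|y0] := eqVneq y 0; first by rewrite inner0r !normr0 mulr0.
have ny : 0 < `|y| by rewrite normr_gt0.
(* The right-hand side is the squared norm of [|y|^2 x - <x, y> y], so nothing has to be divided. *)
have : 0 <= `|y| ^+ 2 * (`|x| ^+ 2 * `|y| ^+ 2 - inner x y ^+ 2).
  have := sqr_ge0 `|(`|y| ^+ 2 *: x - inner x y *: y)|.
  rewrite -inner_normE !innerBl !innerBr !innerZl !innerZr (innerC y x).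
  by rewrite !inner_normE; lra.
rewrite pmulr_rge0 ?exprn_gt0// subr_ge0 -exprMn -[leLHS]real_normK ?num_real//.
by rewrite ler_pXn2r ?nnegrE ?mulr_ge0.
Qed.

Lemma continuous_inner x : continuous (inner ^~ x).
Proof.
move=> y; apply/cvgrPdist_le => e e0.
have M0 : 0 < `|x| + 1 by rewrite ltr_wpDl.
near=> z; rewrite -innerBl (le_trans (cauchy_schwarz _ _))//.
have : `|y - z| <= e / (`|x| + 1).
  near: z; apply: cvgr_dist_le; last by rewrite divr_gt0.
  exact: cvg_id.
rewrite ler_pdivlMr// => h; apply: le_trans h.
by rewrite ler_wpM2l// lerDl.
Unshelve. all: end_near. Qed.

End inner_product.

Lemma widen_ord_lift n (i : 'I_n) :
  widen_ord (leqnSn n) i = lift ord_max i.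
Proof. by apply: val_inj; rewrite /= /bump leqNgt ltn_ord. Qed.

Section orthonormal.
Context {R : realType} {H : hilbertType R}.
Implicit Types (x : H) (V : set H).

Definition orthonormal_family n (e : 'I_n -> H) :=
  forall i j, inner (e i) (e j) = (i == j)%:R.

Definition lin_span n (b : 'I_n -> H) : set H :=
  [set \sum_(i < n) c i *: b i | c in [set: 'I_n -> R]].

Lemma inner_orthonormal_sum n (e : 'I_n -> H) (c : 'I_n -> R) j :
  orthonormal_family e -> inner (\sum_i c i *: e i) (e j) = c j.
Proof.
move=> oe; rewrite inner_suml (bigD1 j)//= big1 => [|i ij].
  by rewrite innerZl oe eqxx mulr1 addr0.
by rewrite innerZl oe (negbTE ij) mulr0.
Qed.

Lemma norm_orthonormal_sum n (e : 'I_n -> H) (c : 'I_n -> R) :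
  orthonormal_family e -> `|\sum_i c i *: e i| ^+ 2 = \sum_i c i ^+ 2.
Proof.
move=> oe; rewrite -inner_normE inner_sumr; apply: eq_bigr => i _.
by rewrite innerZr inner_orthonormal_sum.
Qed.

Lemma orthonormal_expansion n (e : 'I_n -> H) x : orthonormal_family e ->
  lin_span e x -> x = \sum_i inner x (e i) *: e i.
Proof.
move=> oe [c _ <-].
by apply: eq_bigr => i _; rewrite inner_orthonormal_sum.
Qed.

Lemma mem_lin_span n (b : 'I_n -> H) i : lin_span b (b i).
Proof.
exists (fun j => (j == i)%:R) => //; rewrite (bigD1 i)//= eqxx scale1r.
by rewrite big1 ?addr0// => j /negbTE ->; rewrite scale0r.
Qed.

Lemma lin_spanD n (b : 'I_n -> H) x y :
  lin_span b x -> lin_span b y -> lin_span b (x + y).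
Proof.
move=> [c _ <-] [c' _ <-]; exists (fun i => c i + c' i) => //.
by rewrite -big_split; apply: eq_bigr => i _; rewrite scalerDl.
Qed.

Lemma lin_spanZ n (b : 'I_n -> H) a x : lin_span b x -> lin_span b (a *: x).
Proof.
move=> [c _ <-]; exists (fun i => a * c i) => //.
by rewrite scaler_sumr; apply: eq_bigr => i _; rewrite scalerA.
Qed.

(** The family [b] may be dependent: a last vector with zero residual [r] is dropped, so [m] can be
    smaller than [n]. *)
Lemma gram_schmidt n (b : 'I_n -> H) :
  exists m (e : 'I_m -> H), orthonormal_family e /\ lin_span b = lin_span e.
Proof.
elim: n b => [|n IH] b; first by exists 0%N, b; split => // -[].
have [m [e [oe be]]] := IH (fun i => b (widen_ord (leqnSn n) i)).
have spanE : lin_span b = [set x + a *: b ord_max | x in lin_span e & a in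
  setT].
  rewrite -be; apply/seteqP; split=> [_ [c _ <-]|_ [_ [c _ <-] [a _ <-]]].
    rewrite big_ord_recr; eexists; first by eexists.
    by eexists.
  exists (fun i => if unlift ord_max i is Some j then c j else a) => //.
  rewrite big_ord_recr/= unlift_none; congr (_ + _); apply: eq_bigr => i _.
  by rewrite widen_ord_lift liftK.
pose p := \sum_i inner (b ord_max) (e i) *: e i.
have ep : lin_span e p by exists (fun i => inner (b ord_max) (e i)).
pose r := b ord_max - p.
have re i : inner r (e i) = 0.
  by rewrite innerBl inner_orthonormal_sum// subrr.
have [r0|r0] := eqVneq r 0.
  exists m, e; split => //; rewrite spanE; apply/seteqP; split.
    move=> _ [x ex [a _ <-]]; apply: lin_spanD => //; apply: lin_spanZ.
    by rewrite -[b _](subrK p) -/r r0 add0r.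
  by move=> x ex; exists x => //; exists 0 => //; rewrite scale0r addr0.
have nr : 0 < `|r| by rewrite normr_gt0.
pose u := `|r|^-1 *: r.
have ru : r = `|r| *: u by rewrite scalerA divff ?scale1r// gt_eqF.
have bE : b ord_max = p + `|r| *: u by rewrite -ru addrC subrK.
pose e' i := if unlift ord_max i is Some j then e j else u.
have e'w i : e' (widen_ord (leqnSn m) i) = e i.
  by rewrite /e' widen_ord_lift liftK.
have e'm : e' ord_max = u by rewrite /e' unlift_none.
exists m.+1, e'; split=> [i j|].
  rewrite /e'; case: unliftP => [i' ->|->]; case: unliftP => [j' ->|->].
  - by rewrite oe (inj_eq (@lift_inj _ _)).
  - by rewrite innerC innerZl re mulr0 eq_sym eq_liftF.
  - by rewrite innerZl re mulr0 eq_liftF.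
  - by rewrite eqxx innerZl innerZr inner_normE /= mulr1n; field;
    rewrite gt_eqF.
rewrite spanE; apply/seteqP; split.
  move=> _ [_ [c _ <-] [a _ <-]].
  rewrite bE scalerDr scalerA addrA.
  rewrite /p scaler_sumr -big_split/=.
  exists (fun i => if unlift ord_max i is Some j then
     c j + a * inner (b ord_max) (e j) else a * `|r|) => //.
  rewrite big_ord_recr/= unlift_none e'm; congr (_ + _).
  apply: eq_bigr => i _; rewrite e'w.
  by rewrite widen_ord_lift liftK scalerDl scalerA.
move=> _ [c _ <-]; rewrite big_ord_recr/= e'm.
under eq_bigr do rewrite e'w.
exists (\sum_(i < m) c (widen_ord (leqnSn m) i) *: e i +
   (- (c ord_max / `|r|)) *: p).
  by apply: lin_spanD; [eexists|apply: lin_spanZ].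
exists (c ord_max / `|r|) => //.
rewrite -addrA scaleNr [- _ + _]addrC -scalerBr -/r /u.
by rewrite [c _ *: (_ *: _)]scalerA.
Qed.

End orthonormal.

(** * Operator norms as Lipschitz constants *)

Section operator_norms.
Context {R : realType}.

Lemma opnorm_bound (E E' : normedModType R) (T : {linear E -> E'}) (M : R) x :
  (forall y, `|T y| <= M * `|y|) -> `|T x| <= opnorm T * `|x|.
Proof.
move=> TM; have [->|x0] := eqVneq x 0; first by rewrite linear0 !normr0 mulr0.
have nx : 0 < `|x| by rewrite normr_gt0.
have M0 : 0 <= M by have := le_trans (normr_ge0 _) (TM x); rewrite pmulr_lge0.
rewrite -ler_pdivrMr//; apply: ub_le_sup.
  by exists M => _ [y /= y1 <-]; rewrite (le_trans (TM _))// ler_piMr.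
exists (`|x|^-1 *: x) => /=.
  by rewrite normrZ gtr0_norm ?invr_gt0// mulVf// gt_eqF.
by rewrite linearZ/= normrZ gtr0_norm ?invr_gt0// mulrC.
Qed.

Lemma opnorm_le (E E' : normedModType R) (T : {linear E -> E'}) x :
  continuous T -> `|T x| <= opnorm T * `|x|.
Proof.
move=> /linear_bounded_continuous/linear_boundedP/pinfty_ex_gt0[M _ TM].
exact: opnorm_bound TM.
Qed.

(** This includes unbounded [T], since [sup] is 0 on a set without supremum. *)
Lemma opnorm_ge0 (E E' : normedModType R) (T : {linear E -> E'}) :
  0 <= opnorm T.
Proof.
rewrite /opnorm; set A := image _ _; have [supA|supA] := pselect (has_sup A).
  apply: (@le_trans _ _ `|T 0|) => //; apply: ub_le_sup; first by case: supA.
  by exists 0 => //=; rewrite normr0.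
by rewrite sup_out.
Qed.

Variables H U : hilbertType R.
Variable G : {bilinear H -> U -> H}.
Hypothesis bG : bounded_operator_valued G.

Let bounded_opnorms : has_sup [set opnorm (G v) | v in [set v : H | `|v| <= 1]].
Proof.
split; first by exists (opnorm (G 0)), 0 => //=; rewrite normr0.
have [M GM] := bov_bound bG; exists `|M| => _ [v /= v1 <-].
apply: (le_trans (GM v)); apply: (le_trans (ler_norm _)).
by rewrite normrM normr_id ler_piMr.
Qed.

Lemma opnorm2_ge0 : 0 <= opnorm2 G.
Proof.
apply: (@le_trans _ _ (opnorm (G 0))); first exact: opnorm_ge0.
apply: ub_le_sup; first by case: bounded_opnorms.
by exists 0 => //=; rewrite normr0.
Qed.

Lemma opnorm2_le v u : `|G v u| <= opnorm2 G * `|v| * `|u|.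
Proof.
have [->|v0] := eqVneq v 0; first by rewrite linear0l !normr0 !(mulr0,mul0r).
have nv : 0 < `|v| by rewrite normr_gt0.
have -> : G v u = `|v| *: G (`|v|^-1 *: v) u.
  by rewrite linearZl_LR/= scalerA mulfV ?gt_eqF// scale1r.
rewrite normrZ normr_id (mulrC (opnorm2 G)) -mulrA ler_pM2l//.
set w := _ *: v; have := @opnorm_le _ _ (G w) u (bov_bounded bG (v:=w)).
move=> /le_trans; apply.
rewrite ler_wpM2r//; apply: ub_le_sup; first by case: bounded_opnorms.
exists w => //=.
by rewrite normrZ gtr0_norm ?invr_gt0// mulVf// gt_eqF.
Qed.

End operator_norms.

Section orthogonal_projection.
Context {R : realType} {H : hilbertType R}.
Variables (m : nat) (e : 'I_m -> H) (Ph : H -> H).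
Hypotheses (oe : orthonormal_family e)
  (hPh : orthogonal_projection (lin_span e) Ph).

(** [Ph] is specified as a bare function; its linearity is read off from this formula. *)
Lemma orthogonal_projectionE x : Ph x = \sum_i inner x (e i) *: e i.
Proof.
have [VP oP] := hPh x.
rewrite {1}(orthonormal_expansion oe VP); apply: eq_bigr => i _.
have Vi : lin_span e (e i) by exact: mem_lin_span.
by congr (_ *: _); apply/esym/eqP; rewrite -subr_eq0 -innerBl oP.
Qed.

Lemma orthogonal_projection_id x : lin_span e x -> Ph x = x.
Proof.
by move=> Vx; rewrite orthogonal_projectionE -orthonormal_expansion.
Qed.

Lemma orthogonal_projectionD x y : Ph (x + y) = Ph x + Ph y.
Proof.
rewrite !orthogonal_projectionE -big_split; apply: eq_bigr => i _.
by rewrite innerDl scalerDl.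
Qed.

Lemma orthogonal_projectionZ a x : Ph (a *: x) = a *: Ph x.
Proof.
rewrite !orthogonal_projectionE scaler_sumr; apply: eq_bigr => i _.
by rewrite innerZl scalerA.
Qed.

Lemma orthogonal_projection_best x y : lin_span e y -> `|x - Ph x| <= `|x - y|.
Proof.
move=> Vy; have [VP oP] := hPh x.
rewrite -(@ler_pXn2r _ 2) ?nnegrE//.
have -> : x - y = (x - Ph x) + (Ph x - y) by rewrite addrA subrK.
by rewrite [leRHS]norm_sqrD innerBr !oP// subrr mulr0 addr0 lerDl sqr_ge0.
Qed.

Lemma orthogonal_projection_norm x : `|Ph x| <= `|x|.
Proof.
have [VP oP] := hPh x.
rewrite -(@ler_pXn2r _ 2) ?nnegrE// -[in leRHS](subrK (Ph x) x) norm_sqrD oP//.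
by rewrite mulr0 addr0 lerDr sqr_ge0.
Qed.

End orthogonal_projection.

(** * Rayleigh quotient of [- Ah] and inversion of [I - dt Ah] on [V] *)

Section resolvent_bound.
Context {R : realType} {H : hilbertType R}.
Variables (m : nat) (e : 'I_m -> H) (DB : set H) (B Ah : H -> H).
Hypotheses (oe : orthonormal_family e) (linB : linear_on DB B)
  (VDB : lin_span e `<=` DB) (hAh : galerkin_operator (lin_span e) B Ah).
Local Notation V := (lin_span e).
Local Notation "'sume' c" := (\sum_i c i *: e i) (at level 10).

Let Vsum (c : 'I_m -> R) : V (sume c). Proof. by exists c. Qed.

Let BD x y : V x -> V y -> B (x + y) = B x + B y.
Proof.
case: linB => _ _ linB' /VDB Vx /VDB Vy.
by rewrite -{1}[x]scale1r linB'// scale1r.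
Qed.

Let BZ a x : V x -> B (a *: x) = a *: B x.
Proof.
case: linB => D0 _ linB' /VDB Vx.
have B0 : B 0 = 0.
  have := linB' 1 0 0 D0 D0; rewrite !scale1r addr0 => /eqP.
  by rewrite -subr_eq subrr => /eqP.
by rewrite -[a *: x]addr0 linB'// B0 addr0.
Qed.

Let inner_span_eq0 x : V x -> (forall w, V w -> inner x w = 0) -> x = 0.
Proof.
move=> Vx /(_ _ Vx); rewrite inner_normE => /eqP.
by rewrite sqrf_eq0 normr_eq0 => /eqP.
Qed.

Let VAh v : V v -> V (Ah v). Proof. by case: hAh => h _; exact: h. Qed.

Let AhE v w : V v -> V w -> inner (Ah v) w = - inner (B v) (B w).
Proof. by case: hAh => _ h Vv Vw; rewrite -h// innerNl opprK. Qed.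

(** [Ah] is known only through its form on [V], so the defect, itself a vector of [V], is tested
    against all of [V]. *)
Lemma galerkin_linear a x y : V x -> V y ->
  Ah (a *: x + y) = a *: Ah x + Ah y.
Proof.
move=> Vx Vy; have Vax := lin_spanZ a Vx; have Vaxy := lin_spanD Vax Vy.
apply/eqP; rewrite -subr_eq0; apply/eqP/inner_span_eq0 => [|w Vw].
  rewrite -scaleN1r; apply: lin_spanD; first exact: VAh.
  by apply/lin_spanZ/lin_spanD; [apply/lin_spanZ|]; exact: VAh.
rewrite innerBl innerDl innerZl !AhE// BD// BZ// innerDl innerZl; ring.
Qed.

Let q v := inner (- Ah v) v.

Let qD v w t : V v -> V w ->
  q (v + t *: w) = q v + 2 * t * inner (- Ah v) w + t ^+ 2 * q w.
Proof.
move=> Vv Vw; have Vtw := lin_spanZ t Vw; have Vvtw := lin_spanD Vv Vtw.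
rewrite /q !innerNl !AhE// BD// BZ// !innerDl !innerDr !innerZl !innerZr.
by rewrite (innerC (B w)); ring.
Qed.

(** First-order optimality: moving [v] in the direction of the residual [z = - Ah v - mu v] must not
    make [q - mu |.|^2] negative, which forces [z = 0]. *)
Let minimizer_eigenvector v (mu : R) : V v -> q v = mu * `|v| ^+ 2 ->
  (forall w, V w -> mu * `|w| ^+ 2 <= q w) -> - Ah v = mu *: v.
Proof.
move=> Vv qv qmin; apply/eqP; rewrite -subr_eq0; set z := - Ah v - mu *: v.
have Vz : V z.
  by rewrite /z -scaleN1r -scaleNr; apply: lin_spanD; apply: lin_spanZ;
    [exact: VAh|].
have zE : inner (- Ah v) z - mu * inner v z = `|z| ^+ 2.
  by rewrite -innerZl -innerBl inner_normE.
have ineq t : 0 <= 2 * t * `|z| ^+ 2 + t ^+ 2 * (q z - mu * `|z| ^+ 2).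
  have := qmin _ (lin_spanD Vv (lin_spanZ t Vz)).
  rewrite qD// norm_sqrD normrZ exprMn real_normK ?num_real// innerZr qv -zE.
  lra.
set K := q z - _ in ineq; have K0 : 0 <= K by rewrite subr_ge0 qmin.
have K1 : 0 < K + 1 by lra.
rewrite -normr_eq0 -sqrf_eq0 eq_le sqr_ge0 andbT.
(* Nearly the minimizer [- |z|^2 / K] of the quadratic in [t]; the added 1 covers [K = 0]. *)
have := ineq (- `|z| ^+ 2 / (K + 1)).
have -> : 2 * (- `|z| ^+ 2 / (K + 1)) * `|z| ^+ 2 +
    (- `|z| ^+ 2 / (K + 1)) ^+ 2 * K =
    - ((`|z| ^+ 2) ^+ 2 * ((K + 2) / (K + 1) ^+ 2)).
  by field; rewrite gt_eqF.
rewrite oppr_ge0 pmulr_lle0 ?divr_gt0 ?exprn_gt0//; last by lra.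
by rewrite exprn_even_le0//= => /eqP ->.
Qed.

(** The form attains its minimum on the unit sphere of [V], which is compact in coordinates. A
    minimizer is an eigenvector, so the minimum is an eigenvalue and therefore at least [lambda]. *)
Lemma eigenvalue_rayleigh (lambda : R) v :
  smallest_eigenvalue V (fun v => - Ah v) lambda -> V v ->
  lambda * `|v| ^+ 2 <= inner (- Ah v) v.
Proof.
move=> [[v1 [Vv1 v1_neq0 _]] lmin] Vv.
pose S : set 'rV[R]_m := [set c | \sum_i (c ord0 i) ^+ 2 = 1].
pose ve (c : 'rV[R]_m) := sume (fun i => c ord0 i).
have nve c : `|ve c| ^+ 2 = \sum_i (c ord0 i) ^+ 2.
  exact: norm_orthonormal_sum.
have veE w : V w -> ve (\row_i inner w (e i)) = w.
  move=> Vw; rewrite [RHS](orthonormal_expansion oe)//.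
  by apply: eq_bigr => i _; rewrite mxE.
(* [B] is not assumed continuous; the form is continuous on the sphere because it is a polynomial in
   the coordinates. *)
have qve c : q (ve c) =
    \sum_i \sum_j c ord0 i * (c ord0 j * inner (B (e i)) (B (e j))).
  have Ve i : V (e i) by exact: mem_lin_span.
  have V0 : V 0 by rewrite -(scale0r v); exact: lin_spanZ.
  have Bve : B (ve c) = \sum_i c ord0 i *: B (e i).
    have B0 : B 0 = 0 by rewrite -{1}(scale0r v) BZ// scale0r.
    suff [] : V (ve c) /\ B (ve c) = \sum_i c ord0 i *: B (e i) by [].
    rewrite /ve; elim/big_ind2 : _ => [|x x' y y' [Vx Bx] [Vy By]|i _].
    - by rewrite B0.
    - by rewrite BD// Bx By; split => //; exact: lin_spanD.
    - by rewrite BZ//; split => //; exact: lin_spanZ.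
  rewrite /q innerNl (AhE (Vsum _) (Vsum _)) opprK -/(ve c) Bve inner_suml;
    apply: eq_bigr => i _.
  by rewrite innerZl inner_sumr mulr_sumr; apply: eq_bigr => j _;
    rewrite innerZr.
have cc i : continuous (fun c : 'rV[R]_m => c ord0 i) by exact:
  coord_continuous.
have csum (g : 'I_m -> 'rV[R]_m -> R) : (forall i, continuous (g i)) ->
    continuous (fun c => \sum_i g i c).
  move=> gc.
  suff sumc (r : seq 'I_m) (x : 'rV[R]_m) :
      \sum_(i <- r) g i c @[c --> x] --> \sum_(i <- r) g i x.
    by move=> x; exact: sumc.
  elim: r => [|i r IH].
    rewrite big_nil (_ : (fun c => _) = cst 0).
      by apply: cvg_cst; exact: nbhs_filter.
    by apply/funext => c; rewrite big_nil.
  rewrite big_cons (_ : (fun c => _) = g i \+ (fun c => \sum_(i <- r) g i c)).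
    by apply: cvgD; [exact: nbhs_filter|exact: gc|exact: IH].
  by apply/funext => c; rewrite big_cons.
have cq : continuous (q \o ve).
  rewrite (_ : q \o ve = fun c => \sum_i \sum_j
      c ord0 i * (c ord0 j * inner (B (e i)) (B (e j)))); last first.
    by apply/funext => c; rewrite /= qve.
  apply: (csum) => i; apply: csum => j c.
  apply: cvgM; [exact: nbhs_filter|exact: cc|].
  by apply: cvgM; [exact: nbhs_filter|exact: cc|exact: (@cvg_cst _ _ _ _
    (nbhs_filter _))].
have cS : continuous (fun c : 'rV[R]_m => \sum_i (c ord0 i) ^+ 2).
  apply: csum => i.
  rewrite (_ : (fun c => _) = fun c : 'rV[R]_m => c ord0 i * c ord0 i).
    by move=> c; apply: cvgM; [exact: nbhs_filter|exact: cc|exact: cc].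
  by apply/funext => c; rewrite expr2.
have compS : compact S.
  apply: bounded_closed_compact.
    exists 1; split => // M M1 c /= Sc; rewrite [leLHS](mx_normrE c).
    apply/bigmax_leP; split; first by lra.
    move=> [i j] _ /=; rewrite ord1; apply: le_trans (ltW M1).
    rewrite -(@ler_pXn2r _ 2) ?nnegrE// expr1n real_normK ?num_real// -Sc.
    by rewrite (bigD1 j)//= lerDl sumr_ge0// => k _; exact: sqr_ge0.
  rewrite (_ : S = (fun c : 'rV[R]_m => \sum_i (c ord0 i) ^+ 2) @^-1` [set
    1])//.
  by apply: closed_comp => [c _|]; [exact: cS|exact: closed_eq].
have normalize w : V w -> w != 0 -> S (\row_i inner (`|w|^-1 *: w) (e i)).
  move=> Vw w0; rewrite /S/= -nve veE; last exact: lin_spanZ.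
  by rewrite normrZ normfV normr_id mulVf ?normr_eq0// expr1n.
(* The sphere is nonempty because it contains the normalized eigenvector [v1]. *)
have [c0 c0S c0min] := EVT_min_rV (ex_intro _ _ (normalize _ Vv1 v1_neq0)) compS
  (continuous_subspaceT cq).
have v0n : `|ve c0| ^+ 2 = 1 by rewrite nve; exact/set_mem.
have qmin w : V w -> q (ve c0) * `|w| ^+ 2 <= q w.
  move=> Vw; have [->|w0] := eqVneq w 0.
    rewrite normr0 expr0n mulr0 /q innerNl AhE// ?opprK ?inner_normE ?sqr_ge0//.
      by rewrite -(scale0r v); exact: lin_spanZ.
    by rewrite -(scale0r v); exact: lin_spanZ.
  have := c0min _ (mem_set (normalize _ Vw w0)).
  rewrite /= veE; last exact: lin_spanZ.
  have Vnw : V (`|w|^-1 *: w) by exact: lin_spanZ.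
  have -> : q (`|w|^-1 *: w) = `|w| ^- 2 * q w.
    by rewrite /q !innerNl !AhE// BZ// innerZl innerZr -exprVn; ring.
  by rewrite mulrC ler_pdivlMr// exprn_gt0// normr_gt0.
apply: le_trans (qmin _ Vv); rewrite ler_wpM2r ?sqr_ge0//; apply: lmin.
exists (ve c0); split; first exact: Vsum.
  by rewrite -normr_eq0 -sqrf_eq0 v0n oner_eq0.
by apply: minimizer_eigenvector => //; [exact: Vsum|rewrite v0n mulr1].
Qed.

Variables (lambda dt : R).
Hypotheses (hlambda : smallest_eigenvalue V (fun v => - Ah v) lambda)
  (dt0 : 0 < dt).

Lemma smallest_eigenvalue_ge0 : 0 <= lambda.
Proof.
have [[v [Vv v0 Av]] _] := hlambda.
have : 0 <= lambda * `|v| ^+ 2.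
  by rewrite -inner_normE -innerZl -Av innerNl AhE// opprK inner_normE sqr_ge0.
by rewrite pmulr_lge0// exprn_gt0// normr_gt0.
Qed.

Let f v := v - dt *: Ah v.

(** Coercivity: [<f v, v> >= (1 + dt lambda) |v|^2] by the Rayleigh bound, then Cauchy-Schwarz. It
    gives both the injectivity of [f] and the norm of its inverse. *)
Let norm_f v : V v -> (1 + dt * lambda) * `|v| <= `|f v|.
Proof.
move=> Vv; have [->|v0] := eqVneq v 0; first by rewrite normr0 mulr0.
rewrite -(@ler_pM2r _ `|v|) ?normr_gt0//.
apply: le_trans (cauchy_schwarz (f v) v).
apply: le_trans (ler_norm _).
rewrite /f innerBl innerZl inner_normE.
have := eigenvalue_rayleigh hlambda Vv; rewrite innerNl.
move=> /(ler_wpM2l (ltW dt0)); rewrite mulrN -mulrA -expr2; lra.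
Qed.

Let dl0 : 0 < 1 + dt * lambda.
Proof. by rewrite ltr_wpDr// mulr_ge0 ?smallest_eigenvalue_ge0// ltW. Qed.

Let f_linear a x y : V x -> V y -> f (a *: x + y) = a *: f x + f y.
Proof.
move=> Vx Vy; rewrite /f galerkin_linear// scalerBr scalerDr opprD !scalerA.
by rewrite addrACA (mulrC dt).
Qed.

Let Vf v : V v -> V (f v).
Proof.
by move=> Vv; rewrite /f -scaleNr; apply: lin_spanD => //; apply/lin_spanZ/VAh.
Qed.

Let f_inj : {in V &, injective f}.
Proof.
move=> x y /set_mem Vx /set_mem Vy fxy.
have Vyx : V ((-1) *: y + x) by apply: lin_spanD => //; exact: lin_spanZ.
have := norm_f Vyx; rewrite f_linear// fxy !scaleN1r addNr normr0.
rewrite pmulr_rle0// normr_le0 addrC subr_eq0 => /eqP //.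
Qed.

(** An injective linear map of the finite-dimensional [V] into itself is onto. [M] is its matrix in
    the basis [e], acting on coordinate rows from the right. *)
Let f_surj y : V y -> exists2 x, V x & f x = y.
Proof.
move=> Vy; have V0 : V 0 by rewrite -(scale0r y); exact: lin_spanZ.
have f0 : f 0 = 0.
  have := f_linear 1 V0 V0; rewrite !scale1r addr0 => /eqP.
  by rewrite -subr_eq subrr => /eqP.
have Ve i : V (e i) by exact: mem_lin_span.
pose M : 'M[R]_m := \matrix_(i, j) inner (f (e i)) (e j).
have fM (c : 'rV[R]_m) : f (sume (fun i => c ord0 i)) =
    sume (fun j => (c *m M) ord0 j).
  have [_ ->] : V (sume (fun i => c ord0 i)) /\
      f (sume (fun i => c ord0 i)) = \sum_i c ord0 i *: f (e i).
    elim/big_ind2 : _ => [|x' x z' z [Vx fx] [Vz fz]|i _].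
    - by [].
    - split; first exact: lin_spanD.
      by rewrite -fx -fz -[in LHS](scale1r x) f_linear// scale1r.
    - split; first exact: lin_spanZ.
      by rewrite -[in LHS](addr0 (_ *: e i)) f_linear// f0 addr0.
  under [RHS]eq_bigr do rewrite mxE scaler_suml.
  rewrite exchange_big; apply: eq_bigr => i _ /=.
  rewrite {1}(orthonormal_expansion oe (Vf (Ve i))).
  by rewrite scaler_sumr; apply: eq_bigr => j _; rewrite mxE scalerA.
have uM : M \in unitmx.
  rewrite -row_free_unit; apply: inj_row_free => c cM.
  have fc0 : f (sume (fun i => c ord0 i)) = f 0.
    by rewrite fM f0 big1// => i _; rewrite cM mxE scale0r.
  have := f_inj (mem_set (Vsum _)) (mem_set V0) fc0.
  move=> sum0; apply/rowP => i.
  by rewrite mxE -(inner_orthonormal_sum (fun i => c ord0 i) i oe) sum0 inner0l.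
pose c := (\row_i inner y (e i)) *m invmx M.
exists (sume (fun i => c ord0 i)) => //; rewrite fM mulmxKV//.
rewrite [RHS](orthonormal_expansion oe)//.
by apply: eq_bigr => i _; rewrite mxE.
Qed.

Lemma resolvent_stable y : V y -> V (resolvent V Ah dt y).
Proof.
by move=> /f_surj[x Vx <-]; rewrite /resolvent (pinvKV _ f_inj)// inE.
Qed.

Lemma resolvent_linear a x y : V x -> V y ->
  resolvent V Ah dt (a *: x + y) =
  a *: resolvent V Ah dt x + resolvent V Ah dt y.
Proof.
move=> /f_surj[x' Vx' <-] /f_surj[y' Vy' <-]; rewrite -f_linear// /resolvent.
by rewrite !(pinvKV _ f_inj)// inE//; apply: lin_spanD => //; exact: lin_spanZ.
Qed.

Lemma resolvent_norm y : V y ->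
  (1 + dt * lambda) * `|resolvent V Ah dt y| <= `|y|.
Proof.
move=> /f_surj[x Vx <-]; rewrite /resolvent (pinvKV _ f_inj) ?inE//.
exact: norm_f.
Qed.

End resolvent_bound.

(** * Measurability, independence and mean squares *)

Section measurable_wrt.
Context {d : measure_display} {Omega : measurableType d} {R : realType}.
Implicit Types (F : set (set Omega)) (c : Omega -> R).

Lemma borel_realE : @borel R = measurable.
Proof.
apply/seteqP; split.
  apply: smallest_sub; first exact: sigma_algebra_measurable.
  by move=> A; exact: open_measurable.
move=> B mB.
have {mB} : (@RGenOInfty.G R).-sigma.-measurable B.
  by rewrite -RGenOInfty.measurableE.
move: B; apply: smallest_sub.
  exact: smallest_sigma_algebra.
move=> _ [x ->]; apply: sub_sigma_algebra; exact: interval_open.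
Qed.

Lemma measurable_wrt_funP F c : sigma_algebra setT F ->
  measurable_wrt F c <->
  measurable_fun setT (c : g_sigma_algebraType F -> R).
Proof.
move=> sF; rewrite /measurable_wrt borel_realE; split=> mc.
  by move=> _ B mB; rewrite setTI measurable_g_measurableTypeE//; exact: mc.
move=> B mB; have := mc measurableT B mB.
by rewrite setTI measurable_g_measurableTypeE.
Qed.

Lemma measurable_wrt_measurableP c :
  measurable_wrt measurable c <-> measurable_fun setT c.
Proof.
rewrite /measurable_wrt borel_realE; split=> mc.
  by move=> _ B mB; rewrite setTI; exact: mc.
by move=> B mB; rewrite -[_ @^-1` _]setTI; exact: mc.
Qed.

Lemma measurable_wrt_sub (E : topologicalType) F F' (X : Omega -> E) :
  F `<=` F' -> measurable_wrt F X -> measurable_wrt F' X.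
Proof. by move=> FF' mX B /mX/FF'. Qed.

Lemma preimage_borel (E E' : topologicalType) (g : E -> E') (B : set E') :
  continuous g -> borel B -> borel (g @^-1` B).
Proof.
move=> /continuousP cg; move: B.
apply: smallest_sub => /= [|B oB]; last by apply: sub_sigma_algebra; exact: cg.
have [b0 bC bU] : sigma_algebra setT (@borel E) by exact:
  smallest_sigma_algebra.
split => [|A bA|A bA].
- by rewrite /= preimage_set0.
- by rewrite /= setTD -preimage_setC -setTD; exact: bC.
- by rewrite /= preimage_bigcup; exact: bU.
Qed.

Lemma measurable_wrt_comp (E E' : topologicalType) F (X : Omega -> E)
  (g : E -> E') : continuous g -> measurable_wrt F X ->
  measurable_wrt F (g \o X).
Proof.
by move=> cg mX B bB; apply: (mX (g @^-1` B)); exact: preimage_borel.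
Qed.

Lemma measurable_wrt_measurable_comp F c (g : R -> R) :
  measurable_fun setT g -> measurable_wrt F c -> measurable_wrt F (g \o c).
Proof.
move=> mg mc B; rewrite borel_realE => mB; apply: (mc (g @^-1` B)).
by rewrite borel_realE -[X in measurable X]setTI; exact: mg.
Qed.

Section sigma_algebra.
Variable F : set (set Omega).
Hypothesis sF : sigma_algebra setT F.

Lemma measurable_wrt_cst (r : R) : measurable_wrt F (fun=> r).
Proof. by apply/(measurable_wrt_funP _ sF); exact: measurable_cst. Qed.

Lemma measurable_wrtM c c' : measurable_wrt F c -> measurable_wrt F c' ->
  measurable_wrt F (fun w => c w * c' w).
Proof.
by move=> /(measurable_wrt_funP _ sF) ? /(measurable_wrt_funP _ sF) ?;
  apply/(measurable_wrt_funP _ sF); exact: measurable_funM.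
Qed.

Lemma measurable_wrtB c c' : measurable_wrt F c -> measurable_wrt F c' ->
  measurable_wrt F (fun w => c w - c' w).
Proof.
by move=> /(measurable_wrt_funP _ sF) ? /(measurable_wrt_funP _ sF) ?;
  apply/(measurable_wrt_funP _ sF); exact: measurable_funB.
Qed.

Lemma measurable_wrt_sum (I : Type) (r : seq I) (c : I -> Omega -> R) :
  (forall i, measurable_wrt F (c i)) ->
  measurable_wrt F (fun w => \sum_(i <- r) c i w).
Proof.
move=> mc; apply/(measurable_wrt_funP _ sF); apply: measurable_sum => i.
exact/(measurable_wrt_funP _ sF).
Qed.

Lemma measurable_wrt_cvg (c_ : nat -> Omega -> R) c :
  (forall n, measurable_wrt F (c_ n)) ->
  (forall w, c_ ^~ w @ \oo --> c w) -> measurable_wrt F c.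
Proof.
move=> mc cc; apply/(measurable_wrt_funP _ sF).
apply: (@measurable_fun_cvg _ (g_sigma_algebraType F) R setT c_ c) => [n|w _];
  last exact: cc.
exact/(measurable_wrt_funP _ sF).
Qed.

End sigma_algebra.

End measurable_wrt.

Section expectation.
Context {d : measure_display} {Omega : measurableType d} {R : realType}.
Variable P : probability Omega R.
Implicit Types (f g : Omega -> R).

Definition L1 f : Prop := P.-integrable setT (EFin \o f).
Definition expect f : R := \int[P]_w f w.
Definition L2 f : Prop := measurable_fun setT f /\ L1 (fun w => f w ^+ 2).

Lemma L1_measurable f : L1 f -> measurable_fun setT f.
Proof. by move=> /integrableP[/measurable_EFinP]. Qed.

Lemma expectE f : L1 f -> (\int[P]_w (f w)%:E)%E = (expect f)%:E.
Proof. by move=> f1; rewrite /expect /Rintegral fineK// integrable_fin_num. Qed.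

Lemma L1_cst (r : R) : L1 (fun=> r).
Proof. exact: finite_measure_integrable_cst. Qed.

Lemma expect_cst (r : R) : expect (fun=> r) = r.
Proof.
by rewrite /expect Rintegral_cst// [X in fine X]probability_setT mulr1.
Qed.

Lemma L1D f g : L1 f -> L1 g -> L1 (fun w => f w + g w).
Proof. by move=> f1 g1; exact: (integrableD measurableT f1 g1). Qed.

Lemma L1Z (r : R) f : L1 f -> L1 (fun w => r * f w).
Proof. by move=> f1; exact: (integrableZl measurableT r f1). Qed.

Lemma expectD f g : L1 f -> L1 g ->
  expect (fun w => f w + g w) = expect f + expect g.
Proof. by move=> f1 g1; rewrite /expect RintegralD. Qed.

Lemma expectB f g : L1 f -> L1 g ->
  expect (fun w => f w - g w) = expect f - expect g.
Proof. by move=> f1 g1; rewrite /expect RintegralB. Qed.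

Lemma expectZ (r : R) f : L1 f -> expect (fun w => r * f w) = r * expect f.
Proof. by move=> f1; rewrite /expect RintegralZl. Qed.

Lemma L1_sum (I : Type) (s : seq I) (f : I -> Omega -> R) :
  (forall i, L1 (f i)) -> L1 (fun w => \sum_(i <- s) f i w).
Proof.
move=> f1; elim: s => [|i s IH].
  by under eq_fun do rewrite big_nil; exact: L1_cst.
by under eq_fun do rewrite big_cons; exact: L1D.
Qed.

Lemma expect_sum (I : Type) (s : seq I) (f : I -> Omega -> R) :
  (forall i, L1 (f i)) ->
  expect (fun w => \sum_(i <- s) f i w) = \sum_(i <- s) expect (f i).
Proof.
move=> f1; elim: s => [|i s IH].
  by under eq_fun do rewrite big_nil; rewrite big_nil expect_cst.
under eq_fun do rewrite big_cons; rewrite big_cons -IH expectD//.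
exact: L1_sum.
Qed.

Lemma le_expect f g : L1 f -> L1 g -> (forall w, f w <= g w) ->
  expect f <= expect g.
Proof. by move=> f1 g1 fg; rewrite /expect; apply: le_Rintegral. Qed.

Lemma expect_ge0 f : (forall w, 0 <= f w) -> 0 <= expect f.
Proof. by move=> f0; rewrite /expect; apply: Rintegral_ge0. Qed.

Lemma le_L1 f g : measurable_fun setT f -> L1 g -> (forall w, `|f w| <= g w) ->
  L1 f.
Proof.
move=> mf g1 fg; apply: (le_integrable _ _ _ g1) => //.
  exact/measurable_EFinP.
move=> w _ /=; rewrite lee_fin (le_trans (fg w))//; exact: ler_norm.
Qed.

Lemma L1_lty f : measurable_fun setT f -> (forall w, 0 <= f w) ->
  (\int[P]_w (f w)%:E < +oo)%E -> L1 f.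
Proof.
move=> mf f0 foo; apply/integrableP; split; first exact/measurable_EFinP.
by under eq_integral do rewrite gee0_abs ?lee_fin//=.
Qed.

Lemma L1M_L2 f g : L2 f -> L2 g -> L1 (fun w => f w * g w).
Proof.
move=> [mf f2] [mg g2].
apply: (@le_L1 _ (fun w => f w ^+ 2 + g w ^+ 2)).
- exact: measurable_funM.
- exact: L1D.
- move=> w; rewrite ler_norml.
  have := sqr_ge0 (f w + g w); have := sqr_ge0 (f w - g w).
  have := sqr_ge0 (f w); have := sqr_ge0 (g w).
  by move=> ? ? ? ?; apply/andP; split; lra.
Qed.

Lemma L2_cst (r : R) : L2 (fun=> r).
Proof. by split; [exact: measurable_cst|exact: L1_cst]. Qed.

Lemma L2D f g : L2 f -> L2 g -> L2 (fun w => f w + g w).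
Proof.
move=> f2 g2; split; first by apply: measurable_funD; [case: f2|case: g2].
under eq_fun do rewrite sqrrD -mulr_natl.
apply: L1D; last by case: g2.
by apply: L1D; [case: f2|apply: L1Z; exact: L1M_L2].
Qed.

Lemma L2Z (r : R) f : L2 f -> L2 (fun w => r * f w).
Proof.
move=> [mf f2]; split; first exact: measurable_funM.
by under eq_fun do rewrite exprMn; exact: L1Z.
Qed.

Lemma L2B f g : L2 f -> L2 g -> L2 (fun w => f w - g w).
Proof.
move=> f2 g2; under eq_fun do rewrite -mulN1r; apply: L2D => //; exact: L2Z.
Qed.

Lemma L2_sum (I : Type) (s : seq I) (f : I -> Omega -> R) :
  (forall i, L2 (f i)) -> L2 (fun w => \sum_(i <- s) f i w).
Proof.
move=> f1; elim: s => [|i s IH].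
  by under eq_fun do rewrite big_nil; exact: L2_cst.
by under eq_fun do rewrite big_cons; exact: L2D.
Qed.

Lemma L2_L1 f : L2 f -> L1 f.
Proof.
move=> f2; have := L1M_L2 f2 (L2_cst 1); by under eq_fun do rewrite mulr1.
Qed.

Lemma bounded_L2 f (K : R) : measurable_fun setT f -> (forall w, `|f w| <= K) ->
  L2 f.
Proof.
move=> mf fK; split => //; apply: (le_L1 _ (L1_cst (K ^+ 2))) => [|w].
  exact: measurable_funX.
by rewrite normrX ler_sqr ?nnegrE ?(le_trans _ (fK w)).
Qed.

End expectation.

(** * Expectation of a product of independent variables *)

Section independence.
Context {d : measure_display} {Omega : measurableType d} {R : realType}.
Variables (P : probability Omega R) (Y eta : Omega -> R).
Hypotheses (Y1 : L1 P Y) (eta1 : L1 P eta).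
Hypothesis indep : forall A B, measurable A -> measurable B ->
  P (Y @^-1` A `&` eta @^-1` B) = (P (Y @^-1` A) * P (eta @^-1` B))%E.

Let mY : measurable_fun setT Y := L1_measurable Y1.
Let meta : measurable_fun setT eta := L1_measurable eta1.
Let Yf : {mfun Omega >-> R} := HB.pack Y (isMeasurableFun.Build _ _ _ _ _ mY).
Let etaf : {mfun Omega >-> R} :=
  HB.pack eta (isMeasurableFun.Build _ _ _ _ _ meta).
Let pair_fun w := (Y w, eta w).
Let mpair : measurable_fun setT pair_fun.
Proof. exact: measurable_fun_pair. Qed.
Let pairf : {mfun Omega >-> (R * R)%type} :=
  HB.pack pair_fun (isMeasurableFun.Build _ _ _ _ _ mpair).
Let muY := distribution P Yf.
Let mueta := distribution P etaf.
Let mup := distribution P pairf.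

(** By independence the joint law of [Y] and [eta] agrees with the product of their laws on
    rectangles, and rectangles determine the measure. *)
Let prodE (f : R * R -> \bar R) :
  (\int[muY \x mueta]_z f z = \int[mup]_z f z)%E.
Proof.
apply: eq_measure_integral => A mA _.
by apply: (@product_measure_unique _ _ _ _ _ muY mueta mup) => // A1 A2;
  exact: indep.
Qed.

Let mprod : measurable_fun setT (fun z : R * R => (z.1 * z.2)%:E).
Proof.
apply/measurable_EFinP; apply: measurable_funM.
  exact: measurable_fst.
exact: measurable_snd.
Qed.

Let int_abs f (X : {mfun Omega >-> R}) : f = X :> (_ -> _) -> L1 P f ->
  (\int[distribution P X]_x `|x|%:E < +oo)%E.
Proof.
move=> -> /integrableP[_]; rewrite ge0_integral_distribution//.
by apply/measurable_EFinP; exact: normr_measurable.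
Qed.

Let integrable_prod : (muY \x mueta)%E.-integrable setT (fun z => (z.1 *
  z.2)%:E).
Proof.
apply/integrableP; split => //.
rewrite fubini_tonelli1//; last exact: measurableT_comp.
rewrite /fubini_F/=.
under eq_integral => x _.
  under eq_integral do rewrite normrM EFinM.
  rewrite ge0_integralZl//; last first.
    by apply/measurable_EFinP; exact: normr_measurable.
  over.
rewrite ge0_integralZr//.
- rewrite lte_mul_pinfty ?integral_ge0//.
  + rewrite ge0_fin_numE ?integral_ge0//; exact: (@int_abs Y).
  + exact: (@int_abs eta).
- by apply/measurable_EFinP; exact: normr_measurable.
- exact: integral_ge0.
Qed.

(** Tonelli's theorem for the product of the laws replaces the square-integrability that a product
    usually requires. This allows factors such as [|Xi|^2] and a squared increment. *)
Lemma independent_L1M : L1 P (fun w => Y w * eta w).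
Proof.
apply/integrableP; split.
  by apply/measurable_EFinP; exact: measurable_funM.
have /integrableP[_] := integrable_prod.
by rewrite prodE ge0_integral_distribution//; exact: measurableT_comp.
Qed.

Lemma independent_expectM :
  expect P (fun w => Y w * eta w) = expect P Y * expect P eta.
Proof.
have E (X : {mfun Omega >-> R}) : L1 P X ->
    (\int[distribution P X]_x x%:E = (expect P X)%:E)%E.
  move=> X1; rewrite integral_distribution; [exact: expectE| |exact: X1].
  exact/measurable_EFinP/measurable_id.
have i (X : {mfun Omega >-> R}) : L1 P X ->
    (distribution P X).-integrable setT EFin.
  move=> X1; apply: integrable_pushforward => //.
apply: EFin_inj; rewrite -expectE; last exact: independent_L1M.
transitivity (\int[mup]_z (z.1 * z.2)%:E)%E.
  rewrite integral_distribution//; exact: independent_L1M.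
rewrite -prodE -(integral12_prod_meas1 integrable_prod)/fubini_F/=.
under eq_integral => x _.
  under eq_integral do rewrite EFinM.
  rewrite integralZl//; last exact: (i etaf eta1).
  rewrite (E etaf eta1).
  over.
rewrite integralZr//; last exact: (i Yf Y1).
by rewrite (E Yf Y1) EFinM.
Qed.

End independence.

(** * Mean squares and their limits *)

Section mean_square_integral.
Context {d : measure_display} {T : measurableType d} {R : realType}.
Variable mu : {measure set T -> \bar R}.
Implicit Types f g h : T -> R.

(** Extended-real valued, so that bounds can be stated before square-integrability is known. *)
Definition msq f : \bar R := (\int[mu]_x (f x ^+ 2)%:E)%E.

Lemma msq_ge0 f : (0 <= msq f)%E.
Proof. by apply: integral_ge0 => x _; rewrite lee_fin sqr_ge0. Qed.

Lemma le_msq f g : measurable_fun setT f -> measurable_fun setT g ->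
  (forall x, `|f x| <= `|g x|) -> (msq f <= msq g)%E.
Proof.
move=> mf mg fg; apply: ge0_le_integral => //.
- by move=> x _; rewrite lee_fin sqr_ge0.
- by apply/measurable_EFinP; exact: measurable_funX.
- by apply/measurable_EFinP; exact: measurable_funX.
- move=> x _; rewrite lee_fin -(real_normK (num_real (f x))).
  by rewrite -(real_normK (num_real (g x))) ler_sqr ?nnegrE.
Qed.

Lemma msqZ (r : R) f : measurable_fun setT f ->
  msq (fun x => r * f x) = ((r ^+ 2)%:E * msq f)%E.
Proof.
move=> mf; rewrite /msq -ge0_integralZl//.
- by apply: eq_integral => x _; rewrite exprMn EFinM.
- by apply/measurable_EFinP; exact: measurable_funX.
- by move=> x _; rewrite lee_fin sqr_ge0.
- by rewrite lee_fin sqr_ge0.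
Qed.

(* [(a + b)^2 <= (1 + r) a^2 + (1 + 1/r) b^2] *)
Lemma msq_le_young (r : R) f g h : 0 < r -> measurable_fun setT f ->
  measurable_fun setT g -> measurable_fun setT h ->
  (forall x, `|f x| <= `|g x| + `|h x|) ->
  (msq f <= (1 + r)%:E * msq g + (1 + r^-1)%:E * msq h)%E.
Proof.
move=> r0 mf mg mh fgh.
have m2 (k : T -> R) : measurable_fun setT k ->
  measurable_fun setT (fun x => (k x ^+ 2)%:E).
  by move=> mk; apply/measurable_EFinP; exact: measurable_funX.
have k0 (k : T -> R) x : (0 <= (k x ^+ 2)%:E :> \bar R)%E by rewrite lee_fin
  sqr_ge0.
have r1 : (0 <= (1 + r)%:E :> \bar R)%E by rewrite lee_fin addr_ge0// ltW.
have r2 : (0 <= (1 + r^-1)%:E :> \bar R)%E.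
  by rewrite lee_fin addr_ge0// ltW// invr_gt0.
rewrite /msq -!ge0_integralZl//; [|exact: m2|exact: m2].
rewrite -ge0_integralD//.
- apply: ge0_le_integral => //.
  + exact: m2.
  + by apply: emeasurable_funD; apply: measurable_funeM; exact: m2.
  + move=> x _; rewrite -!EFinM -EFinD lee_fin -(real_normK (num_real (f x))).
    rewrite -(real_normK (num_real (g x))) -(real_normK (num_real (h x))).
    set a := `|g x|; set b := `|h x|.
    apply: (@le_trans _ _ ((a + b) ^+ 2)).
      by rewrite ler_sqr ?nnegrE ?addr_ge0 ?normr_ge0//; exact: fgh.
    rewrite -subr_ge0 (_ : _ - _ = r^-1 * (r * a - b) ^+ 2).
      by rewrite mulr_ge0 ?invr_ge0 ?sqr_ge0// ltW.
    by field; rewrite gt_eqF.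
- by move=> x _; rewrite mule_ge0.
- by apply: measurable_funeM; exact: m2.
- by move=> x _; rewrite mule_ge0.
- by apply: measurable_funeM; exact: m2.
Qed.

Lemma msq_le_2 f g h : measurable_fun setT f ->
  measurable_fun setT g -> measurable_fun setT h ->
  (forall x, `|f x| <= `|g x| + `|h x|) ->
  (msq f <= 2%:E * msq g + 2%:E * msq h)%E.
Proof.
move=> mf mg mh fgh; have := msq_le_young ltr01 mf mg mh fgh.
by rewrite invr1.
Qed.

(** The bound [c] of the approximants survives without loss, as the sharp stability constant
    demands; a fixed split into halves would double it. *)
Lemma msq_approx f (c : R) : 0 <= c -> measurable_fun setT f ->
  (forall eps : R, 0 < eps -> exists g h,
    [/\ measurable_fun setT g, measurable_fun setT h,
      (forall x, `|f x| <= `|g x| + `|h x|),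
      (msq g <= c%:E)%E & (msq h <= eps%:E)%E]) ->
  (msq f <= c%:E)%E.
Proof.
move=> c0 mf fgh; apply/lee_addgt0Pr => e e0.
have c1 : 0 < c + 1 by lra.
(* With error [r / (1 + 1/r)], Young's inequality gives [(1 + r) c + r = c + e]. *)
pose r := e / (c + 1); have r0 : 0 < r by rewrite divr_gt0.
have r10 : 0 < 1 + r^-1 by rewrite addr_gt0// invr_gt0.
have [g [h [mg mh fgh' gc hc]]] := fgh (r / (1 + r^-1)) (divr_gt0 r0 r10).
apply: (le_trans (msq_le_young r0 mf mg mh fgh')).
apply: (@le_trans _ _ ((1 + r)%:E * c%:E +
    (1 + r^-1)%:E * (r / (1 + r^-1))%:E)%E).
  by apply: leeD; apply: lee_wpmul2l => //; rewrite lee_fin ltW// addr_gt0.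
rewrite -!EFinM -EFinD lee_fin [X in _ + X]mulrC divfK ?gt_eqF//.
have -> : (1 + r) * c + r = c + e by rewrite /r; field; rewrite gt_eqF.
exact: lexx.
Qed.

Lemma msq_eq0 f : measurable_fun setT f -> msq f = 0%E ->
  {ae mu, forall x, f x = 0}.
Proof.
move=> mf /eqP f0.
have m2 : measurable_fun setT (fun x => (f x ^+ 2)%:E).
  by apply/measurable_EFinP; exact: measurable_funX.
have := (ae_eq_integral_abs mu measurableT m2).1.
under eq_integral do rewrite gee0_abs ?lee_fin ?sqr_ge0//.
move=> /(_ (eqP f0)); apply: filterS => x /(_ I) /eqP.
by rewrite eqe sqrf_eq0 => /eqP.
Qed.

(** Fatou's lemma for squares. No domination is asked for; it serves for left limits, Parseval
    partial sums and the removal of the cut-off. *)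
Lemma msq_limit_le (f_ : nat -> T -> R) f (C : R) :
  (forall n, measurable_fun setT (f_ n)) -> measurable_fun setT f ->
  {ae mu, forall x, f_ ^~ x @ \oo --> f x} ->
  (forall n, (msq (f_ n) <= C%:E)%E) -> (msq f <= C%:E)%E.
Proof.
move=> mf_ mf f_f f_C.
have m2 (k : T -> R) : measurable_fun setT k ->
    measurable_fun setT (fun x => (k x ^+ 2)%:E).
  by move=> mk; apply/measurable_EFinP; exact: measurable_funX.
pose g n x := ((f_ n x) ^+ 2)%:E.
have mg n : measurable_fun setT (g n) by exact: m2.
have g0 n x : setT x -> (0 <= g n x)%E by rewrite lee_fin sqr_ge0.
have -> : msq f = (\int[mu]_x limn_einf (g^~ x))%E.
  apply: ae_eq_integral => //; first exact: m2.
    apply: (measurableT_comp (@oppe_measurable R setT)).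
    apply: (@measurable_fun_limn_esup _ _ _ setT (fun n x => - g n x)%E) => n.
    by apply: measurableT_comp => //; exact: mg.
  apply: filterS f_f => x fx _.
  have /cvg_limn_einf_sup[-> _]// : g ^~ x @ \oo --> (f x ^+ 2)%:E.
  by apply/cvg_EFin; [exact: nearW|apply: cvgM; exact: fx].
apply: (le_trans (fatou _ _ mg g0)) => //.
rewrite limn_einf_lim; apply: lime_le; first exact: is_cvg_einfs.
apply: nearW => n; apply: (le_trans _ (f_C n)).
by apply: ereal_inf_lbound; exists n => /=.
Qed.

End mean_square_integral.

Lemma msq_prod d d' (T1 : measurableType d) (T2 : measurableType d') (R :
  realType)
    (m1 : {sigma_finite_measure set T1 -> \bar R})
    (m2 : {sigma_finite_measure set T2 -> \bar R}) (chi : T1 -> T2 -> R) :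
  measurable_fun setT (fun z => chi z.1 z.2) ->
  (msq (m1 \x m2)%E (fun z => chi z.1 z.2) =
    \int[m1]_x \int[m2]_y (chi x y ^+ 2)%:E)%E /\
  (msq (m1 \x m2)%E (fun z => chi z.1 z.2) =
    \int[m2]_y \int[m1]_x (chi x y ^+ 2)%:E)%E.
Proof.
move=> mchi; have m : measurable_fun setT (fun z => (chi z.1 z.2 ^+ 2)%:E).
  by apply/measurable_EFinP; exact: measurable_funX.
by split; [rewrite /msq fubini_tonelli1|rewrite /msq fubini_tonelli2];
  rewrite // => z; rewrite lee_fin sqr_ge0.
Qed.

(** * Measurability up to null sets *)

Section null_sets.
Context {d : measure_display} {Omega : measurableType d} {R : realType}.
Variables (P : probability Omega R) (F : set (set Omega)).
Hypotheses (sF : sigma_algebra setT F) (Fm : F `<=` measurable)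
  (nullF : P.-negligible `<=` F).

Lemma sub_measurable_wrt (c : Omega -> R) :
  measurable_wrt F c -> measurable_fun setT c.
Proof.
by move=> /(measurable_wrt_sub Fm) /measurable_wrt_measurableP.
Qed.

(** [F] contains every subset of the exceptional set [N], in particular the part of the preimage
    that lies inside it. *)
Lemma ae_measurable_wrt (c c' : Omega -> R) : measurable_wrt F c' ->
  {ae P, forall w, c w = c' w} -> measurable_wrt F c.
Proof.
move=> mc' cc' B bB; set N := ~` [set w | c w = c' w].
have FN A : A `<=` N -> F A by move=> AN; apply/nullF/(negligibleS AN).
have -> : c @^-1` B = (c' @^-1` B `\` N) `|` (c @^-1` B `&` N).
  apply/seteqP; split=> w /=.
    by have [cw|cw] := pselect (c w = c' w) => Bw;
      [left; split; [rewrite -cw|case]|right].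
  by case=> [[Bw /contrapT ->]|[]].
pose T := g_sigma_algebraType F.
have mT (A : set T) : measurable A =
  F A by rewrite measurable_g_measurableTypeE.
rewrite -(mT (_ `|` _)); apply: measurableU; first apply: measurableD.
- by rewrite mT; exact: mc'.
- by rewrite mT; exact: FN.
- by rewrite mT; apply: FN => w [].
Qed.

(** A fast L2-approximating sequence converges almost surely: the sum of its squared errors is
    integrable, hence almost surely finite, so the errors tend to 0. *)
Lemma L2_limit_measurable_wrt (c : Omega -> R) : measurable_fun setT c ->
  (forall eps : R, 0 < eps -> exists c' : Omega -> R, measurable_wrt F c' /\
     (msq P (fun w => c' w - c w)%R <= eps%:E)%E) ->
  measurable_wrt F c.
Proof.
move=> mc approx.
have pos n : 0 < 1 / (2 ^ n.+1)%:R :> R by rewrite divr_gt0// ltr0n expn_gt0.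
have /choice[c_ c_P] := fun n => approx _ (pos n).
have mc_ n : measurable_fun setT (c_ n) by case: (c_P n) => /sub_measurable_wrt.
pose g n w := (c_ n w - c w) ^+ 2.
have g0 n w : (0 <= (g n w)%:E :> \bar R)%E by rewrite lee_fin sqr_ge0.
have mg n : measurable_fun setT (fun w => (g n w)%:E).
  by apply/measurable_EFinP/measurable_funX; exact: measurable_funB.
have msum : measurable_fun setT (fun w => \sum_(n <oo) (g n w)%:E)%E.
  exact: ge0_emeasurable_sum.
have intsum : P.-integrable setT (fun w => \sum_(n <oo) (g n w)%:E)%E.
  apply/integrableP; split => //.
  under eq_integral do rewrite gee0_abs ?nneseries_ge0//.
  rewrite integral_nneseries//.
  apply: (@le_lt_trans _ _ (\sum_(n <oo) (1 / (2 ^ n.+1)%:R)%:E)%E).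
    by apply: lee_nneseries => [n _ _|n _]; [exact: integral_ge0|case: (c_P n)].
  by apply: le_lt_trans (epsilon_trick0 xpredT ler01) _; exact: ltry.
have [N [mN N0 subN]] : {ae P, forall w, c_ ^~ w @ \oo --> c w}.
  have := integrable_ae measurableT intsum; apply: filterS => w /(_ I) fin.
  have cg : cvgn (series (g ^~ w)).
    apply: nondecreasing_is_cvgn.
      by apply: nondecreasing_series => n _ _; exact: sqr_ge0.
    exists (fine (\sum_(n <oo) (g n w)%:E)%E) => _ [n _ <-].
    rewrite -lee_fin fineK// seriesEnat/= -sumEFin.
    by apply: nneseries_lim_ge.
  have /cvgrPdist_lt gcvg := cvg_series_cvg_0 cg.
  apply/cvgrPdist_lt => e e0; have e20 : 0 < e ^+ 2 by rewrite exprn_gt0.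
  have := gcvg _ e20; apply: filterS => n; rewrite sub0r normrN /g normrX.
  by rewrite ltr_sqr ?nnegrE ?normr_ge0 ?(ltW e0)// distrC.
have FN A : A `<=` N -> F A by move=> AN; apply: nullF; exists N.
(* The indicator makes the convergence hold at every point and costs only a modification on the null
   set [N]. *)
apply: (@ae_measurable_wrt _ (fun w => c w * \1_(~` N) w)).
  apply: (@measurable_wrt_cvg _ _ _ _ sF (fun n w => c_ n w * \1_(~` N) w)).
    move=> n; apply: measurable_wrtM => //; first by case: (c_P n).
    apply/(measurable_wrt_funP _ sF)/(measurable_indicP _).
    apply: measurableC; rewrite measurable_g_measurableTypeE//; exact: FN.
  move=> w; have [Nw|Nw] := pselect (N w).
    rewrite indicE memNset ?mulr0; last exact.
    under eq_fun do rewrite mulr0; exact: cvg_cst.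
  rewrite indicE mem_set// mulr1; under eq_fun do rewrite mulr1.
  by apply: contrapT => Nc; apply/Nw/subN.
exists N; split => // w /= h; apply: contrapT => Nw; apply: h.
by rewrite indicE mem_set// mulr1.
Qed.

End null_sets.

Section finite_rank.
Context {Omega : Type} {R : realType} {H : hilbertType R}.
Implicit Types (C : (Omega -> R) -> Prop) (Z : Omega -> H).

(** [C] is a class of real random variables, such as the measurable, the square-integrable or the
    adapted ones. Norms and inner products become polynomials in coefficients of class [C]. *)
Definition finite_rank C Z : Prop :=
  exists n (c : 'I_n -> Omega -> R) (v : 'I_n -> H),
    (forall i, C (c i)) /\ (forall w, Z w = \sum_i c i w *: v i).

Lemma finite_rank_sub C C' Z : (forall c, C c -> C' c) ->
  finite_rank C Z -> finite_rank C' Z.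
Proof.
by move=> CC' [n [c [v [Cc ZE]]]]; exists n, c, v; split => // i; exact: CC'.
Qed.

Lemma finite_rankD C Z Z' : finite_rank C Z -> finite_rank C Z' ->
  finite_rank C (fun w => Z w + Z' w).
Proof.
move=> [n [c [v [Cc ZE]]]] [n' [c' [v' [Cc' ZE']]]].
exists (n + n')%N, (fun i => match fintype.split i with inl j => c j | inr j =>
  c' j end),
  (fun i => match fintype.split i with inl j => v j | inr j => v' j end).
split=> [i|w]; first by case: (fintype.split i).
rewrite ZE ZE' big_split_ord/=; congr (_ + _); apply: eq_bigr => i _.
  by rewrite (unsplitK (inl i)).
by rewrite (unsplitK (inr i)).
Qed.

Lemma finite_rank_sum C (I : Type) (r : seq I) (Z : I -> Omega -> H) :
  (forall i, finite_rank C (Z i)) ->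
  finite_rank C (fun w => \sum_(i <- r) Z i w).
Proof.
move=> CZ; elim: r => [|i r IH].
  exists 0%N, (fun=> fun=> 0), (fun=> 0); split => [[]//|w].
  by rewrite big_nil big_ord0.
by under eq_fun do rewrite big_cons; exact: finite_rankD.
Qed.

Lemma finite_rank_scale C C' (eta : Omega -> R) Z :
  (forall c, C c -> C' (fun w => c w * eta w)) ->
  finite_rank C Z -> finite_rank C' (fun w => eta w *: Z w).
Proof.
move=> CC' [n [c [v [Cc ZE]]]].
exists n, (fun i w => c i w * eta w), v; split=> [i|w]; first exact: CC'.
by rewrite ZE scaler_sumr; apply: eq_bigr => i _; rewrite scalerA mulrC.
Qed.

Lemma finite_rank_inner C Z v : finite_rank C Z ->
  exists n (c : 'I_n -> Omega -> R) (a : 'I_n -> R),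
    (forall i, C (c i)) /\ forall w, inner (Z w) v = \sum_i a i * c i w.
Proof.
move=> [n [c [u [Cc ZE]]]]; exists n, c, (fun i => inner (u i) v);
  split => // w.
by rewrite ZE inner_suml; apply: eq_bigr => i _; rewrite innerZl mulrC.
Qed.

Lemma finite_rank_inner2 C C' Z Z' : finite_rank C Z -> finite_rank C' Z' ->
  exists n (c : 'I_n -> Omega -> R) n' (c' : 'I_n' -> Omega -> R)
      (a : 'I_n -> 'I_n' -> R),
    [/\ (forall i, C (c i)), (forall i, C' (c' i)) &
      forall w, inner (Z w) (Z' w) =
        \sum_i \sum_j a i j * (c i w * c' j w)].
Proof.
move=> [n [c [v [Cc ZE]]]] [n' [c' [v' [Cc' ZE']]]].
exists n, c, n', c', (fun i j => inner (v i) (v' j)); split => // w.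
rewrite ZE ZE' inner_suml; apply: eq_bigr => i _.
rewrite innerZl inner_sumr mulr_sumr; apply: eq_bigr => j _.
by rewrite innerZr; ring.
Qed.

End finite_rank.

Lemma finite_rank_map (Omega : Type) (R : realType) (H H' : hilbertType R)
    (C : (Omega -> R) -> Prop) (T : {linear H -> H'}) (Z : Omega -> H) :
  finite_rank C Z -> finite_rank C (fun w => T (Z w)).
Proof.
move=> [n [c [v [Cc ZE]]]]; exists n, c, (T \o v); split => // w.
by rewrite ZE linear_sum; apply: eq_bigr => i _; rewrite linearZ.
Qed.

Section square_integrable_finite_rank.
Context {d : measure_display} {Omega : measurableType d} {R : realType}.
Context {H : hilbertType R}.
Variable P : probability Omega R.
Implicit Types Z : Omega -> H.

Lemma L1_inner Z Z' : finite_rank (L2 P) Z -> finite_rank (L2 P) Z' ->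
  L1 P (fun w => inner (Z w) (Z' w)).
Proof.
move=> Z2 Z2'; have [n [c [n' [c' [a [c2 c2' E]]]]]] :=
  finite_rank_inner2 Z2 Z2'.
rewrite (_ : (fun w => _) = fun w => \sum_i \sum_j a i j * (c i w * c' j w)).
  by apply: L1_sum => i; apply: L1_sum => j; apply/L1Z/L1M_L2.
exact/funext.
Qed.

Lemma L1_norm_sqr Z : finite_rank (L2 P) Z -> L1 P (fun w => `|Z w| ^+ 2).
Proof.
by move=> Z2; under eq_fun do rewrite -inner_normE; exact: L1_inner.
Qed.

End square_integrable_finite_rank.

(** * Lebesgue inner products of step functions *)

Section elementary_functions.
Context {R : realType}.
Local Notation leb := (@lebesgue_measure R).
Local Notation oc s t := (`]s, t]%classic : set R).

Definition overlap (s t s' t' : R) : R := fine (leb (oc s t `&` oc s' t')).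

Lemma overlapC s t s' t' : overlap s t s' t' = overlap s' t' s t.
Proof. by rewrite /overlap setIC. Qed.

Lemma overlap_eq0 s t s' t' : t <= s' -> overlap s t s' t' = 0.
Proof.
move=> ts; rewrite /overlap (_ : _ `&` _ = set0) ?measure0//.
apply/seteqP; split=> // x /=; rewrite !in_itv/= => -[/andP[_ xt] /andP[sx _]].
by have := lt_le_trans sx (le_trans xt ts); rewrite ltxx.
Qed.

Lemma lebesgue_oc s t : s <= t -> leb (oc s t) = (t - s)%:E.
Proof.
rewrite lebesgue_measure_itv/= lte_fin le_eqVlt => /predU1P[->|->//].
by rewrite ltxx subrr.
Qed.

Lemma overlap_min s t s' t' : s <= s' -> s' <= t -> s' <= t' ->
  overlap s t s' t' = Num.min t t' - s'.
Proof.
move=> ss st st'; rewrite /overlap (_ : _ `&` _ = oc s' (Num.min t t')).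
  by rewrite lebesgue_oc// le_min st st'.
apply/seteqP; split=> x /=; rewrite !in_itv/= le_min.
  by move=> [/andP[_ ->] /andP[-> ->]].
by move=> /and3P[sx -> ->]; rewrite sx (le_lt_trans ss sx).
Qed.

(** The intervals may overlap, so step functions on different partitions are compared without a
    common refinement. *)
Lemma integral_elementary_sqr (I : finType) (s t c : I -> R) :
  (\int[leb]_x ((\sum_i c i * \1_(oc (s i) (t i)) x) ^+ 2)%:E =
  (\sum_i \sum_j c i * c j * overlap (s i) (t i) (s j) (t j))%R%:E)%E.
Proof.
pose A (p : I * I) := oc (s p.1) (t p.1) `&` oc (s p.2) (t p.2).
have mA p : measurable (A p) by apply: measurableI; exact: measurable_itv.
have Aoo p : (leb (A p) < +oo)%E.
  apply: (@le_lt_trans _ _ (leb (oc (s p.1) (t p.1)))).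
    apply: le_measure; rewrite ?inE; [exact: mA| |exact: subIsetl].
    exact: measurable_itv.
  by rewrite lebesgue_measure_itv/=; case: ifP => _; exact: ltry.
have i1 p : leb.-integrable setT (fun x => (\1_(A p) x)%:E).
  apply/integrableP; split.
    by apply/measurable_EFinP; apply: measurable_indic; exact: (mA p).
  under eq_integral do rewrite gee0_abs ?lee_fin//.
  by rewrite integral_indic ?setIT//; [exact: Aoo|exact: mA].
have intA p : leb.-integrable setT (EFin \o (fun x => c p.1 * c p.2 * \1_(A p)
  x)).
  exact: (integrableZl measurableT (c p.1 * c p.2) (i1 p)).
transitivity (\int[leb]_x (\sum_p (c p.1 * c p.2 * \1_(A p) x)%:E))%E.
  apply: eq_integral => x _; rewrite sumEFin; congr EFin.
  rewrite expr2 mulr_suml -(pair_bigA _ (fun i j =>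
    c i * c j * \1_(oc (s i) (t i) `&` oc (s j) (t j)) x))/=.
  apply: eq_bigr => i _; rewrite mulr_sumr; apply: eq_bigr => j _.
  by rewrite indicI/=; ring.
rewrite integral_sum// (pair_bigA _ (fun i j =>
  c i * c j * overlap (s i) (t i) (s j) (t j))) -sumEFin; apply: eq_bigr => p _.
under eq_integral do rewrite EFinM.
rewrite integralZl//.
rewrite integral_indic ?setIT//; last exact: mA.
by rewrite [in RHS]EFinM /overlap fineK// ge0_fin_numE//; exact: Aoo.
Qed.

End elementary_functions.

(** * The Levy process and iterated integrals *)

Section levy.
Context {d : measure_display} {Omega : measurableType d} {R : realType}.
Variables (P : probability Omega R) (Ft : R -> set (set Omega)).
Hypothesis hFt : usual_filtration P Ft.
Variable U : hilbertType R.
Variables (Q : {linear U -> U}) (mu : nat -> R) (f : nat -> U).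
Hypotheses (onb : orthonormal_basis f) (mu_ge0 : forall k, 0 <= mu k)
  (Qf : forall k, Q (f k) = mu k *: f k).
Variable L : R -> Omega -> U.
Hypotheses (levyL : levy_process P Ft L)
  (sqL : forall t, 0 <= t -> square_integrable P (L t))
  (martL : martingale P Ft L) (covL : covariance_operator P L Q).

Lemma filtration_sigma_algebra t : 0 <= t -> sigma_algebra setT (Ft t).
Proof. by move=> t0; apply: (filt_sigma hFt). Qed.

Let sFt := filtration_sigma_algebra.

Lemma filtration_measurable_fun t (c : Omega -> R) : 0 <= t ->
  measurable_wrt (Ft t) c -> measurable_fun setT c.
Proof. by move=> t0; apply/sub_measurable_wrt/(filt_measurable hFt). Qed.

Lemma levy_inner_measurable t u : 0 <= t ->
  measurable_wrt (Ft t) (fun w => inner (L t w) u).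
Proof.
move=> t0; apply: (measurable_wrt_comp (@continuous_inner _ _ u)).
exact: (levy_adapted levyL).
Qed.

Lemma levy_norm_sqr_L1 t : 0 <= t -> L1 P (fun w => `|L t w| ^+ 2).
Proof.
move=> t0; have [mL Loo] := sqL t0; apply: L1_lty.
- apply: measurable_funX; apply/measurable_wrt_measurableP.
  by apply: (measurable_wrt_comp _ mL); exact: norm_continuous.
- by move=> w; exact: sqr_ge0.
- by move: Loo; rewrite /mean_square unlock.
Qed.

Lemma levy_inner_L2 t u : 0 <= t -> L2 P (fun w => inner (L t w) u).
Proof.
move=> t0.
have mLu := filtration_measurable_fun t0 (levy_inner_measurable u t0).
split => //; apply: (le_L1 _ (L1Z (`|u| ^+ 2) (levy_norm_sqr_L1 t0))) => [|w].
  exact: measurable_funX.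
rewrite normrX -exprMn ler_sqr ?nnegrE ?mulr_ge0// mulrC.
exact: cauchy_schwarz.
Qed.

Lemma increment_inner_L2 s t u : 0 <= s -> s <= t ->
  L2 P (fun w => inner (increment L s t w) u).
Proof.
move=> s0 st; rewrite /increment; under eq_fun do rewrite innerBl.
by apply: L2B; apply: levy_inner_L2 => //; exact: (le_trans s0 st).
Qed.

Lemma increment_inner_measurable s t u : 0 <= s -> s <= t ->
  measurable_wrt (Ft t) (fun w => inner (increment L s t w) u).
Proof.
move=> s0 st; have t0 := le_trans s0 st.
rewrite /increment; under eq_fun do rewrite innerBl.
apply: measurable_wrtB; first exact: sFt.
  exact: levy_inner_measurable.
apply: (measurable_wrt_sub (filt_mono hFt s0 st)).
exact: levy_inner_measurable.
Qed.

Lemma expect_increment_inner s t u : 0 <= s -> s <= t ->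
  expect P (fun w => inner (increment L s t w) u) = 0.
Proof.
move=> s0 st; have t0 := le_trans s0 st.
rewrite /increment; under eq_fun do rewrite innerBl.
rewrite expectB; [|exact/L2_L1/levy_inner_L2|exact/L2_L1/levy_inner_L2].
apply/eqP; rewrite subr_eq0; apply/eqP/EFin_inj.
rewrite -!expectE; [|exact/L2_L1/levy_inner_L2|exact/L2_L1/levy_inner_L2].
have FT : Ft s setT by have [F0 FC _] := sFt s0; rewrite -[setT]setD0;
  exact: FC.
by apply: (mart_cond martL (A := setT)).
Qed.

Lemma independent_increment s t (g : U -> R) Y : 0 <= s -> s <= t ->
  continuous g -> measurable_wrt (Ft s) Y -> L1 P Y ->
  L1 P (fun w => g (increment L s t w)) ->
  L1 P (fun w => Y w * g (increment L s t w)) /\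
  expect P (fun w => Y w * g (increment L s t w)) =
    expect P Y * expect P (fun w => g (increment L s t w)).
Proof.
move=> s0 st cg mY Y1 g1.
have ind A B : measurable A -> measurable B ->
    P (Y @^-1` A `&` (fun w => g (increment L s t w)) @^-1` B) =
    (P (Y @^-1` A) * P ((fun w => g (increment L s t w)) @^-1` B))%E.
  rewrite -borel_realE => mA mB.
  apply: (levy_independent levyL (B := g @^-1` B)) => //; first exact: mY.
  exact: preimage_borel.
by split; [exact: independent_L1M|exact: independent_expectM].
Qed.

(** The covariance is prescribed for [L t] only. Stationarity equates the laws of the increments
    over [[s, t]] and [[0, t - s]], and [L 0 = 0] almost surely turns the latter into
    [L (t - s)]. *)
Lemma increment_inner_var s t u : 0 <= s -> s <= t ->
  expect P (fun w => inner (increment L s t w) u ^+ 2) =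
  (t - s) * inner (Q u) u.
Proof.
move=> s0 st; have ts0 : 0 <= t - s by rewrite subr_ge0.
have L1i a b : 0 <= a -> a <= b ->
    L1 P (fun w => inner (increment L a b w) u ^+ 2).
  by move=> a0 ab; case: (increment_inner_L2 u a0 ab).
have mi a b : 0 <= a -> a <= b ->
    measurable_fun setT (fun w => inner (increment L a b w) u).
  by move=> a0 ab; case: (increment_inner_L2 u a0 ab).
pose mf a b (a0 : 0 <= a) (ab : a <= b) : {mfun Omega >-> R} :=
  HB.pack (fun w => inner (increment L a b w) u)
    (isMeasurableFun.Build _ _ _ _ _ (mi a b a0 ab)).
have sqE a b (a0 : 0 <= a) (ab : a <= b) :
    (expect P (fun w => inner (increment L a b w) u ^+ 2))%:E =
    (\int[distribution P (mf a b a0 ab)]_x (x ^+ 2)%:E)%E.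
  rewrite -expectE; last exact: L1i.
  rewrite ge0_integral_distribution//;
    first exact/measurable_EFinP/measurable_funX.
  by move=> x; rewrite lee_fin sqr_ge0.
apply: EFin_inj; rewrite (sqE _ _ s0 st).
transitivity (\int[distribution P (mf 0 (t - s) (lexx 0) ts0)%R]_x (x ^+
  2)%:E)%E.
  apply: eq_measure_integral => A mA _.
  apply: (levy_stationary levyL (B := (fun v => inner v u) @^-1` A)) => //.
  apply: preimage_borel; first exact: continuous_inner.
  by rewrite borel_realE.
rewrite -sqE -expectE; last exact: L1i.
have /= := covL u u ts0; rewrite unlock => <-.
have m2 : measurable_fun setT (fun w => (inner (increment L 0 (t - s) w) u ^+
  2)%:E).
  by apply/measurable_EFinP/measurable_funX; exact: (mi 0 (t - s) (lexx 0)).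
have m2' : measurable_fun setT (fun w => (inner (L (t - s) w) u * inner (L (t -
  s) w) u)%:E).
  have [mL _] := levy_inner_L2 u ts0.
  by apply/measurable_EFinP; exact: measurable_funM.
apply: ae_eq_integral => //.
have := levy_0 levyL; apply: filterS => w L0 _.
by rewrite /increment L0 subr0 expr2.
Qed.

Local Notation l := (levy_coord L mu f).

Definition coord_increment k s t w : R := l k t w - l k s w.

Local Notation dl := coord_increment.

(* If [mu k = 0], then [l k] vanishes identically. *)
Definition active k : R := (mu k != 0)%:R.

Let lin k u : R := (Num.sqrt (mu k))^-1 * inner u (f k).

Let lin_continuous k : continuous (lin k).
Proof.
by move=> u; apply: cvgM; [exact: cvg_cst|exact: continuous_inner].
Qed.

Lemma coord_incrementE k s t w : dl k s t w = lin k (increment L s t w).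
Proof. by rewrite /lin innerBl mulrBr. Qed.

Lemma coord_increment_L2 k s t : 0 <= s -> s <= t -> L2 P (dl k s t).
Proof.
move=> s0 st; rewrite (_ : dl k s t = fun w => lin k (increment L s t w)).
  by apply/L2Z/increment_inner_L2.
by apply/funext => w; exact: coord_incrementE.
Qed.

Lemma coord_increment_measurable k s t : 0 <= s -> s <= t ->
  measurable_wrt (Ft t) (dl k s t).
Proof.
move=> s0 st; rewrite (_ : dl k s t = fun w => lin k (increment L s t w)).
  have sF := sFt (le_trans s0 st).
  apply: (measurable_wrtM sF); first exact: measurable_wrt_cst.
  exact: increment_inner_measurable.
by apply/funext => w; exact: coord_incrementE.
Qed.

Lemma coord_increment_var k s t : 0 <= s -> s <= t ->
  expect P (fun w => dl k s t w ^+ 2) = active k * (t - s).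
Proof.
move=> s0 st; rewrite (_ : (fun w => _) = fun w =>
    (Num.sqrt (mu k))^-1 ^+ 2 * inner (increment L s t w) (f k) ^+ 2).
  rewrite expectZ; last by case: (increment_inner_L2 (f k) s0 st).
  rewrite increment_inner_var// Qf innerZl; case: onb => ortho _.
  rewrite ortho eqxx mulr1 exprVn sqr_sqrtr// mulrC -mulrA mulrC /active.
  have [->|mu0] := eqVneq (mu k) 0; first by rewrite mul0r !mul0r.
  by rewrite mulfV.
by apply/funext => w; rewrite coord_incrementE /lin exprMn.
Qed.

Lemma independent_coord_increment k s t Y : 0 <= s -> s <= t ->
  measurable_wrt (Ft s) Y -> L1 P Y ->
  L1 P (fun w => Y w * dl k s t w) /\
  expect P (fun w => Y w * dl k s t w) = 0.
Proof.
move=> s0 st mY Y1.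
have dlE : dl k s t = fun w => lin k (increment L s t w).
  by apply/funext => w; exact: coord_incrementE.
have lin1 : L1 P (fun w => lin k (increment L s t w)).
  by rewrite -dlE; exact/L2_L1/coord_increment_L2.
have [YL YE] := independent_increment s0 st (@lin_continuous k) mY Y1 lin1.
rewrite (_ : (fun w => _) = fun w => Y w * lin k (increment L s t w)).
  split => //; rewrite YE /lin expectZ; last exact/L2_L1/increment_inner_L2.
  by rewrite expect_increment_inner// !mulr0.
by apply/funext => w; rewrite coord_incrementE.
Qed.

Lemma independent_coord_increment_sqr k s t Y : 0 <= s -> s <= t ->
  measurable_wrt (Ft s) Y -> L1 P Y ->
  L1 P (fun w => Y w * dl k s t w ^+ 2) /\
  expect P (fun w => Y w * dl k s t w ^+ 2) = expect P Y * (active k * (t - s)).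
Proof.
move=> s0 st mY Y1; rewrite -(coord_increment_var k s0 st).
have dlE : (fun w => dl k s t w ^+ 2) = fun w => lin k (increment L s t w) ^+ 2.
  by apply/funext => w; rewrite coord_incrementE.
have lin1 : L1 P (fun w => lin k (increment L s t w) ^+ 2).
  by rewrite -dlE; case: (coord_increment_L2 k s0 st).
have clin2 : continuous (fun u => lin k u ^+ 2).
  by move=> u; apply: cvgM; exact: lin_continuous.
have := independent_increment s0 st clin2 mY Y1 lin1.
rewrite -dlE (_ : (fun w => Y w * dl k s t w ^+ 2) =
  fun w => Y w * lin k (increment L s t w) ^+ 2)//.
by apply/funext => w; rewrite coord_incrementE.
Qed.

Definition L2_adapted t (c : Omega -> R) : Prop :=
  measurable_wrt (Ft t) c /\ L2 P c.

Lemma L2_adapted_mono s t c : 0 <= s -> s <= t -> L2_adapted s c ->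
  L2_adapted t c.
Proof.
by move=> s0 st [mc c2]; split => //; apply: measurable_wrt_sub mc;
  exact: (filt_mono hFt).
Qed.

(** The product of two L2 variables is in general only in L1. Here the squares of the factors are
    independent, so their product is integrable. *)
Lemma L2_adaptedM k s t c : 0 <= s -> s <= t -> L2_adapted s c ->
  L2_adapted t (fun w => c w * dl k s t w).
Proof.
move=> s0 st [mc [mc' c2]]; have t0 := le_trans s0 st; have sF := sFt t0.
have m : measurable_wrt (Ft t) (fun w => c w * dl k s t w).
  apply: (measurable_wrtM sF); last exact: coord_increment_measurable.
  by apply: measurable_wrt_sub mc; exact: (filt_mono hFt).
split => //; split; first exact: filtration_measurable_fun m.
rewrite (_ : (fun w => _) = fun w => c w ^+ 2 * dl k s t w ^+ 2).
  apply: (independent_coord_increment_sqr k s0 st _ c2).1.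
  by apply: (measurable_wrtM (sFt s0)).
by apply/funext => w; rewrite exprMn.
Qed.

(* The projection of [L t - L s] to the first [N] eigenvectors of [Q] with a
   nonzero eigenvalue. *)
Definition trunc_increment N s t w : U :=
  \sum_(k < N) dl k s t w *: (Num.sqrt (mu k) *: f k).

(** A pathwise identity, from the orthonormality of [f]; the correlation of different coordinates
    does not enter. *)
Lemma norm_trunc_increment N s t w :
  `|trunc_increment N s t w| ^+ 2 = \sum_(k < N) mu k * dl k s t w ^+ 2.
Proof.
have [ortho _] := onb.
rewrite -inner_normE inner_suml; apply: eq_bigr => i _.
rewrite innerZl inner_sumr (bigD1 i)//= big1 ?addr0 => [|j ji].
  rewrite innerZr innerZl innerZr ortho eqxx mulr1.
  by rewrite [in RHS]expr2 -[in RHS](sqr_sqrtr (mu_ge0 i)); ring.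
rewrite innerZr innerZl innerZr ortho (_ : (i == j :> nat) = false) ?mulr0//.
by apply/negbTE; rewrite eq_sym.
Qed.

Section discrete_stochastic_integral.
Context {H : hilbertType R}.

Lemma measurable_wrt_inner (F : set (set Omega)) (Z Z' : Omega -> H) :
  sigma_algebra setT F -> finite_rank (measurable_wrt F) Z ->
  finite_rank (measurable_wrt F) Z' ->
  measurable_wrt F (fun w => inner (Z w) (Z' w)).
Proof.
move=> sF mZ mZ'; have [n [c [n' [c' [a [mc mc' E]]]]]] :=
  finite_rank_inner2 mZ mZ'.
rewrite (_ : (fun w => _) = fun w => \sum_i \sum_j a i j * (c i w * c' j w)).
  do 2 (apply: (measurable_wrt_sum sF) => ?); apply: (measurable_wrtM sF).
    exact: measurable_wrt_cst.
  exact: (measurable_wrtM sF).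
exact/funext.
Qed.

Local Notation adapted_rv t := (finite_rank (L2_adapted t)).

Let adapted_L2 t (Z : Omega -> H) : adapted_rv t Z -> finite_rank (L2 P) Z.
Proof. by apply: finite_rank_sub => c []. Qed.

Let adapted_measurable t (Z : Omega -> H) :
  adapted_rv t Z -> finite_rank (measurable_wrt (Ft t)) Z.
Proof. by apply: finite_rank_sub => c []. Qed.

Variables (T : {bilinear H -> U -> H}) (K : R).
Hypothesis TK : forall x u, `|T x u| <= K * `|x| * `|u|.

Let trunc_incrementE N s t w x : T x (trunc_increment N s t w) =
  \sum_(k < N) dl k s t w *: T x (Num.sqrt (mu k) *: f k).
Proof. by rewrite linear_sumr; apply: eq_bigr => k _; rewrite linearZr. Qed.

(** Pythagoras in L2: the increment after [s] is centred and independent of [Z] and [Xi], so the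
    cross term vanishes and only the second moment of the added term remains. *)
Lemma stochastic_step N s t (Z Xi : Omega -> H) (q : R) : 0 <= s -> s <= t ->
  \sum_(k < N) mu k <= q ->
  adapted_rv s Z -> adapted_rv s Xi ->
  adapted_rv t (fun w => Z w + T (Xi w) (trunc_increment N s t w)) /\
  expect P (fun w => `|Z w + T (Xi w) (trunc_increment N s t w)| ^+ 2) <=
  expect P (fun w => `|Z w| ^+ 2) +
  K ^+ 2 * q * (t - s) * expect P (fun w => `|Xi w| ^+ 2).
Proof.
move=> s0 st Nq aZ aXi; have t0 := le_trans s0 st.
pose TXi k w := T (Xi w) (Num.sqrt (mu k) *: f k).
have aTXi k : adapted_rv s (TXi k).
  have [n [c [v [ac XiE]]]] := aXi.
  exists n, c, (fun i => T (v i) (Num.sqrt (mu k) *: f k)); split => // w.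
  rewrite /TXi XiE linear_sumlz; apply: eq_bigr => i _.
  by rewrite linearZl_LR.
have TE w : T (Xi w) (trunc_increment N s t w) =
    \sum_(k < N) dl k s t w *: TXi k w by exact: trunc_incrementE.
have aT : adapted_rv t (fun w => T (Xi w) (trunc_increment N s t w)).
  rewrite (_ : (fun w => _) = fun w => \sum_(k < N) dl k s t w *: TXi k w).
    apply: finite_rank_sum => k; apply: finite_rank_scale (aTXi k) => c.
    exact: L2_adaptedM.
  exact/funext.
have aZt : adapted_rv t Z.
  by apply: finite_rank_sub aZ => c; exact: L2_adapted_mono.
split; first exact: finite_rankD.
(* The cross term is a sum of known factors times centred increments; the inner product of two L2
   variables is just integrable enough for independence to apply. *)
have Y k : L1 P (fun w => inner (Z w) (TXi k w) * dl k s t w) /\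
    expect P (fun w => inner (Z w) (TXi k w) * dl k s t w) = 0.
  apply: independent_coord_increment => //.
    by apply: measurable_wrt_inner; [exact: sFt|exact: adapted_measurable..].
  exact: L1_inner (adapted_L2 aZ) (adapted_L2 (aTXi k)).
have innerE : (fun w => inner (Z w) (T (Xi w) (trunc_increment N s t w))) =
    fun w => \sum_(k < N) inner (Z w) (TXi k w) * dl k s t w.
  apply/funext => w; rewrite TE inner_sumr; apply: eq_bigr => k _.
  by rewrite innerZr mulrC.
have L1i : L1 P (fun w => inner (Z w) (T (Xi w) (trunc_increment N s t w))).
  by rewrite innerE; apply: L1_sum => k; case: (Y k).
have Ei : expect P
    (fun w => inner (Z w) (T (Xi w) (trunc_increment N s t w))) = 0.
  rewrite innerE expect_sum => [|k]; last by case: (Y k).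
  by rewrite big1// => k _; case: (Y k).
have L1Z' := L1_norm_sqr (adapted_L2 aZ).
have L1T := L1_norm_sqr (adapted_L2 aT).
rewrite (_ : (fun w => _) = fun w => `|Z w| ^+ 2 +
    2 * inner (Z w) (T (Xi w) (trunc_increment N s t w)) +
    `|T (Xi w) (trunc_increment N s t w)| ^+ 2); last first.
  by apply/funext => w; rewrite norm_sqrD.
rewrite expectD//; last by apply: L1D => //; exact: L1Z.
rewrite expectD//; last exact: L1Z.
rewrite expectZ// Ei mulr0 addr0 lerD2l.
have L1Xi := L1_norm_sqr (adapted_L2 aXi).
have mXi : measurable_wrt (Ft s) (fun w => `|Xi w| ^+ 2).
  under eq_fun do rewrite -inner_normE.
  by apply: measurable_wrt_inner; [exact: sFt|exact: adapted_measurable..].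
have S k := independent_coord_increment_sqr k s0 st mXi L1Xi.
have L1b : L1 P (fun w => \sum_(k < N)
    (K ^+ 2 * mu k) * (`|Xi w| ^+ 2 * dl k s t w ^+ 2)).
  by apply: L1_sum => k; apply: L1Z; case: (S k).
apply: (le_trans (le_expect L1T L1b _)) => [w|].
  apply: (@le_trans _ _ ((K * `|Xi w| * `|trunc_increment N s t w|) ^+ 2)).
    by rewrite ler_sqr ?nnegrE ?(le_trans _ (TK _ _))//.
  rewrite !exprMn norm_trunc_increment mulr_sumr ler_sum// => k _.
  by rewrite le_eqVlt; apply/orP; left; apply/eqP; ring.
rewrite expect_sum => [|k]; last by apply: L1Z; case: (S k).
have E0 : 0 <= expect P (fun w => `|Xi w| ^+ 2).
  by apply: expect_ge0 => w; exact: sqr_ge0.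
have ts0 : 0 <= t - s by rewrite subr_ge0.
apply: (@le_trans _ _ (K ^+ 2 * (\sum_(k < N) mu k) * (t - s) *
    expect P (fun w => `|Xi w| ^+ 2))); last first.
  do 2 apply: ler_wpM2r => //.
  by apply: ler_wpM2l => //; exact: sqr_ge0.
rewrite mulr_sumr !mulr_suml ler_sum// => k _.
rewrite expectZ; last by case: (S k).
have [_ ->] := S k; have := sqr_ge0 K; move: (K ^+ 2) => K2 K20.
rewrite -!mulrA; apply: ler_wpM2l => //.
apply: ler_wpM2l => //; rewrite [leRHS]mulrC; apply: ler_wpM2l => //.
(* The variance is [t - s] or, for a zero eigenvalue, 0. *)
by rewrite /active; case: (mu k != 0); rewrite ?mul1r// mul0r.
Qed.

End discrete_stochastic_integral.

Lemma L2_adapted_norm_sqr (H : hilbertType R) t (Z : Omega -> H) :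
  finite_rank (L2_adapted t) Z -> L1 P (fun w => `|Z w| ^+ 2).
Proof.
by move=> aZ; apply: L1_norm_sqr; apply: finite_rank_sub aZ => c [].
Qed.

(** * The coupled Euler recursions on a grid *)

Section discrete_milstein.
Context {H : hilbertType R}.
Variables (G T : {bilinear H -> U -> H}) (K q : R) (N : nat).
Hypotheses (GK : forall x u, `|G x u| <= K * `|x| * `|u|)
  (TK : forall x u, `|T x u| <= K * `|x| * `|u|)
  (Nq : \sum_(k < N) mu k <= q).
Variables (a tau : R) (X Z0 : Omega -> H).
Hypotheses (a0 : 0 <= a) (tau0 : 0 <= tau)
  (aX : finite_rank (L2_adapted a) X) (aZ0 : finite_rank (L2_adapted a) Z0).

Definition grid (a tau : R) (i : nat) : R := a + i%:R * tau.

Lemma grid0 b r : grid b r 0 = b. Proof. by rewrite /grid mul0r addr0. Qed.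

Lemma gridS b r i : grid b r i.+1 = grid b r i + r.
Proof. by rewrite /grid -natr1 mulrDl mul1r addrA. Qed.

Local Notation t := (grid a tau).

Lemma grid_ge_start i : a <= t i.
Proof. by rewrite /grid lerDl mulr_ge0. Qed.

Lemma grid_ge0 i : 0 <= t i.
Proof. exact: le_trans a0 (grid_ge_start i). Qed.

Lemma grid_leS i : t i <= t i.+1.
Proof. by rewrite gridS lerDl. Qed.

Local Notation dL j w := (trunc_increment N (t j) (t j.+1) w).

(* The Euler scheme for [dY = G(X) dL]; the double stochastic integral in the
   Milstein scheme is the integral of [G(Y - X) dL]. *)
Definition inner_state i w : H := X w + \sum_(j < i) G (X w) (dL j w).

Definition outer_state i w : H :=
  Z0 w + \sum_(j < i) T (inner_state j w) (dL j w).

Let adapted_later i (Z : Omega -> H) :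
  finite_rank (L2_adapted a) Z -> finite_rank (L2_adapted (t i)) Z.
Proof.
by apply: finite_rank_sub => c; apply: L2_adapted_mono => //;
  exact: grid_ge_start.
Qed.

(** The coefficient [G] is frozen at [X], so each step adds the same amount and the bound grows
    linearly in time, not exponentially. *)
Lemma inner_state_bound i : finite_rank (L2_adapted (t i)) (inner_state i) /\
  expect P (fun w => `|inner_state i w| ^+ 2) <=
  expect P (fun w => `|X w| ^+ 2) * (1 + K ^+ 2 * q * (i%:R * tau)).
Proof.
elim: i => [|i [aY IH]].
  rewrite grid0 mul0r mulr0 addr0 mulr1.
  rewrite (_ : inner_state 0 = X)//.
  by apply/funext => w; rewrite /inner_state big_ord0 addr0.
have YS : inner_state i.+1 = fun w => inner_state i w + G (X w) (dL i w).
  by apply/funext => w; rewrite /inner_state big_ord_recr/= addrA.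
have [aYS ES] := stochastic_step GK (grid_ge0 i) (grid_leS i) Nq aY
  (adapted_later i aX).
rewrite YS; split => //; apply: (le_trans ES).
rewrite gridS [t i + _ - _]addrAC subrr add0r.
apply: (le_trans (lerD IH (lexx _))).
by rewrite le_eqVlt; apply/orP; left; apply/eqP; rewrite -natr1; ring.
Qed.

(** With [c = K^2 q], the linear bound on [inner_state] is summed once more: [c t + (c t)^2 / 2]
    dominates the left Riemann sum of the integral of [c (1 + c s)] up to [t]. *)
Lemma outer_state_bound i : finite_rank (L2_adapted (t i)) (outer_state i) /\
  expect P (fun w => `|outer_state i w| ^+ 2) <=
  expect P (fun w => `|Z0 w| ^+ 2) + expect P (fun w => `|X w| ^+ 2) *
    (K ^+ 2 * q * (i%:R * tau) + (K ^+ 2 * q * (i%:R * tau)) ^+ 2 / 2).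
Proof.
have q0 : 0 <= q by apply: le_trans Nq; exact: sumr_ge0.
have EX0 : 0 <= expect P (fun w => `|X w| ^+ 2).
  by apply: expect_ge0 => w; exact: sqr_ge0.
elim: i => [|i [aY IH]].
  rewrite grid0 mul0r mulr0 expr0n mul0r addr0 mulr0 addr0.
  rewrite (_ : outer_state 0 = Z0)//.
  by apply/funext => w; rewrite /outer_state big_ord0 addr0.
have YS : outer_state i.+1 = fun w => outer_state i w + T (inner_state i w) (dL
  i w).
  by apply/funext => w; rewrite /outer_state big_ord_recr/= addrA.
have [aI EI] := inner_state_bound i.
have [aYS ES] := stochastic_step TK (grid_ge0 i) (grid_leS i) Nq aY aI.
rewrite YS; split => //; apply: (le_trans ES).
rewrite gridS [t i + _ - _]addrAC subrr add0r.
have K20 := sqr_ge0 K.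
have c0 : 0 <= K ^+ 2 * q * tau by do 2 apply: mulr_ge0 => //.
apply: (le_trans (lerD IH (ler_wpM2l c0 EI))).
(* The slack of one step is [e1 (c r)^2 / 2], the area between the integral and its left Riemann
   sum. *)
have key (e0 e1 c n r : R) : 0 <= e1 ->
    e0 + e1 * (c * (n * r) + (c * (n * r)) ^+ 2 / 2) +
      c * r * (e1 * (1 + c * (n * r))) <=
    e0 + e1 * (c * ((n + 1) * r) + (c * ((n + 1) * r)) ^+ 2 / 2).
  move=> e10; rewrite -subr_ge0.
  rewrite (_ : _ - _ = e1 * ((c * r) ^+ 2 / 2)); last by field.
  by rewrite mulr_ge0// mulr_ge0 ?sqr_ge0// invr_ge0.
by rewrite -[i.+1%:R]natr1; exact: key.
Qed.

Lemma telescope_coord_increment k i w :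
  \sum_(j < i) dl k (t j) (t j.+1) w = dl k a (t i) w.
Proof.
elim: i => [|i IH]; first by rewrite big_ord0 grid0 /dl subrr.
by rewrite big_ord_recr IH/= /dl addrC addrA subrK.
Qed.

(* Riemann-sum approximation of the iterated integral of [l k] against [l l]. *)
Definition iterated_sum (b r : R) k l m w : R :=
  \sum_(i < m) dl k b (grid b r i) w *
    dl l (grid b r i) (grid b r i.+1) w.

(** By telescoping, [inner_state j] is [X + G(X, pi_N (L(t_j) - L(a)))]. Inserted into [T], its two
    summands produce the single integral and, after bilinear expansion, the left-point sums of the
    iterated ones. *)
Lemma outer_stateE m w : outer_state m w =
  Z0 w + T (X w) (trunc_increment N a (t m) w) +
  \sum_(k < N) \sum_(l < N) (Num.sqrt (mu k * mu l) *
     iterated_sum a tau k l m w) *: T (G (X w) (f k)) (f l).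
Proof.
have sum_dL i : \sum_(j < i) dL j w = trunc_increment N a (t i) w.
  rewrite exchange_big; apply: eq_bigr => k _ /=.
  by rewrite -scaler_suml telescope_coord_increment.
rewrite /outer_state -addrA; congr (_ + _).
under eq_bigr do rewrite linearDl.
rewrite big_split/= -linear_sumr sum_dL; congr (_ + _).
under eq_bigr => i _.
  rewrite -linear_sumr sum_dL /trunc_increment [G _ _]linear_sumr linear_sumlz.
  under eq_bigr => k _.
    rewrite linear_sumr.
    under eq_bigr => l' _.
      rewrite !linearZr_LR !linearZl_LR/=.
      over.
    over.
  over.
rewrite exchange_big; apply: eq_bigr => k _ /=.
rewrite exchange_big; apply: eq_bigr => l' _ /=.
rewrite mulr_sumr scaler_suml; apply: eq_bigr => i _.
rewrite !scalerA sqrtrM//; congr (_ *: _); ring.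
Qed.

End discrete_milstein.

Lemma L2_adapted_L1M s t c c' : L2_adapted s c -> L2_adapted t c' ->
  L1 P (fun w => c w * c' w).
Proof. by move=> [_ c2] [_ c2']; exact: L1M_L2. Qed.

Lemma expect_mul_sub (f1 f2 f3 : Omega -> R) :
  L1 P f1 -> L1 P f2 -> (forall w, f3 w = f1 w + f2 w) ->
  expect P f3 = expect P f1 + expect P f2.
Proof.
by move=> i1 i2 E; rewrite -expectD//; congr expect; exact/funext.
Qed.

Lemma dl_split k r s t w : dl k r t w = dl k r s w + dl k s t w.
Proof. by rewrite /dl; ring. Qed.

(** * Ito isometry for elementary integrands *)

Section isometry.
Variable k : nat.

Let same_start_le c c' s t t' : 0 <= s -> s <= t -> t <= t' ->
  L2_adapted s c -> L2_adapted s c' ->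
  expect P (fun w => (c w * dl k s t w) * (c' w * dl k s t' w)) =
  active k * expect P (fun w => c w * c' w) * (t - s).
Proof.
move=> s0 st tt' ac ac'; have t0 := le_trans s0 st.
have L1cc := L2_adapted_L1M ac ac'.
have mcc : measurable_wrt (Ft s) (fun w => c w * c' w).
  by apply: (measurable_wrtM (sFt s0)); [case: ac|case: ac'].
have [L1a Ea] := independent_coord_increment_sqr k s0 st mcc L1cc.
have at1 := L2_adaptedM k s0 st ac.
have at2 := L2_adapted_mono s0 st ac'.
have m2 : measurable_wrt (Ft t) (fun w => c w * dl k s t w * c' w).
  by apply: (measurable_wrtM (sFt t0)); [case: at1|case: at2].
have [L1b Eb] := independent_coord_increment k t0 tt' m2 (L2_adapted_L1M at1
  at2).
rewrite (expect_mul_sub L1a L1b) => [|w]; last by rewrite (dl_split k s t t');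
  ring.
by rewrite Ea Eb addr0; ring.
Qed.

Lemma isometry_same_start c c' s t t' : 0 <= s -> s <= t -> s <= t' ->
  L2_adapted s c -> L2_adapted s c' ->
  expect P (fun w => (c w * dl k s t w) * (c' w * dl k s t' w)) =
  active k * expect P (fun w => c w * c' w) * (Num.min t t' - s).
Proof.
move=> s0 st st' ac ac'; have [tt'|/ltW tt'] := leP t t'.
  exact: same_start_le.
rewrite (_ : (fun w => _) = fun w => (c' w * dl k s t' w) * (c w * dl k s t w)).
  rewrite same_start_le//; congr (_ * _ * _); congr expect.
  by apply/funext => w; rewrite mulrC.
by apply/funext => w; rewrite mulrC.
Qed.

Let isometry_pair_le c c' s t s' t' : 0 <= s -> s <= t -> s' <= t' -> s <= s' ->
  L2_adapted s c -> L2_adapted s' c' ->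
  expect P (fun w => (c w * dl k s t w) * (c' w * dl k s' t' w)) =
  active k * expect P (fun w => c w * c' w) * overlap s t s' t'.
Proof.
move=> s0 st st' ss' ac ac'; have s'0 := le_trans s0 ss'.
have t0 := le_trans s0 st.
have [ts'|/ltW s't] := leP t s'.
  rewrite overlap_eq0// mulr0.
  have at1 := L2_adapted_mono t0 ts' (L2_adaptedM k s0 st ac).
  have m1 : measurable_wrt (Ft s') (fun w => c w * dl k s t w * c' w).
    by apply: (measurable_wrtM (sFt s'0)); [case: at1|case: ac'].
  have [_ E1] := independent_coord_increment k s'0 st' m1 (L2_adapted_L1M at1
    ac').
  rewrite -[RHS]E1; congr expect; apply/funext => w; ring.
have at1 := L2_adaptedM k s0 ss' ac.
have m1 : measurable_wrt (Ft s') (fun w => c w * dl k s s' w * c' w).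
  by apply: (measurable_wrtM (sFt s'0)); [case: at1|case: ac'].
have [L1a Ea] := independent_coord_increment k s'0 st' m1 (L2_adapted_L1M at1
  ac').
have ac1 := L2_adapted_mono s0 ss' ac.
have L1b : L1 P (fun w => (c w * dl k s' t w) * (c' w * dl k s' t' w)).
  exact: (L2_adapted_L1M (L2_adaptedM k s'0 s't ac1) (L2_adaptedM k s'0 st'
    ac')).
rewrite (expect_mul_sub L1a L1b) => [|w]; last by rewrite (dl_split k s s' t);
  ring.
by rewrite Ea add0r isometry_same_start// overlap_min.
Qed.

(** The interval that starts first is split at the later start, and a common start is split at the
    earlier end. The pieces outside the overlap meet a centred independent increment and contribute
    nothing. *)
Lemma isometry_pair c c' s t s' t' : 0 <= s -> s <= t -> 0 <= s' -> s' <= t' ->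
  L2_adapted s c -> L2_adapted s' c' ->
  expect P (fun w => (c w * dl k s t w) * (c' w * dl k s' t' w)) =
  active k * expect P (fun w => c w * c' w) * overlap s t s' t'.
Proof.
move=> s0 st s'0 st' ac ac'; have [ss'|/ltW ss'] := leP s s'.
  exact: isometry_pair_le.
rewrite (_ : (fun w => _) = fun w => (c' w * dl k s' t' w) * (c w * dl k s t
  w)).
  rewrite isometry_pair_le// overlapC; congr (_ * _ * _); congr expect.
  by apply/funext => w; rewrite mulrC.
by apply/funext => w; rewrite mulrC.
Qed.

Section elementary.
Variables (I : finType) (s t : I -> R) (c : I -> Omega -> R).
Hypotheses (s0 : forall i, 0 <= s i) (st : forall i, s i <= t i)
  (ac : forall i, L2_adapted (s i) (c i)).

Definition elementary_process w r : R :=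
  \sum_i c i w * \1_(`]s i, t i]%classic : set R) r.

Definition elementary_integral w : R := \sum_i c i w * dl k (s i) (t i) w.

Lemma measurable_elementary_process :
  measurable_fun setT (fun z => elementary_process z.1 z.2).
Proof.
apply: measurable_sum => i; apply: measurable_funM.
  apply: (measurableT_comp _ measurable_fst).
  by case: (ac i) => _ [].
by apply: measurableT_comp => //; exact: measurable_indic.
Qed.

Lemma elementary_integral_L2 : L2 P elementary_integral.
Proof.
apply: L2_sum => i.
by case: (L2_adaptedM k (s0 i) (st i) (ac i)).
Qed.

(** Equality holds if [mu k] is nonzero; otherwise [active k = 0] and the left-hand side
    vanishes. *)
Lemma ito_isometry : (msq P elementary_integral <=
  \int[P]_w \int[lebesgue_measure]_r ((elementary_process w r) ^+ 2)%:E)%E.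
Proof.
have L1cc i j : L1 P (fun w => c i w * c j w *
    overlap (s i) (t i) (s j) (t j)).
  under eq_fun do rewrite mulrC.
  exact/L1Z/(L2_adapted_L1M (ac i) (ac j)).
under eq_integral do rewrite integral_elementary_sqr.
rewrite expectE; last by do 2 apply: L1_sum => ?.
rewrite /msq expectE; last by case: elementary_integral_L2.
have L1dd i j : L1 P (fun w =>
    (c i w * dl k (s i) (t i) w) * (c j w * dl k (s j) (t j) w)).
  by apply: (L2_adapted_L1M (s := t i) (t := t j)); exact: L2_adaptedM.
have E : expect P (fun w => elementary_integral w ^+ 2) = active k *
    \sum_i \sum_j expect P (fun w => c i w * c j w) *
      overlap (s i) (t i) (s j) (t j).
  rewrite (_ : (fun w => _) = fun w => \sum_i \sum_j
      (c i w * dl k (s i) (t i) w) * (c j w * dl k (s j) (t j) w)).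
    rewrite expect_sum => [|i]; last exact: L1_sum.
    rewrite mulr_sumr; apply: eq_bigr => i _.
    rewrite expect_sum// mulr_sumr; apply: eq_bigr => j _.
    by rewrite isometry_pair// mulrA.
  apply/funext => w; rewrite expr2 mulr_suml; apply: eq_bigr => i _.
  by rewrite mulr_sumr.
have E' : expect P (fun w => \sum_i \sum_j c i w * c j w *
      overlap (s i) (t i) (s j) (t j)) =
    \sum_i \sum_j expect P (fun w => c i w * c j w) *
      overlap (s i) (t i) (s j) (t j).
  rewrite expect_sum => [|i]; last exact: L1_sum.
  apply: eq_bigr => i _; rewrite expect_sum//; apply: eq_bigr => j _.
  under eq_fun do rewrite mulrC.
  by rewrite expectZ 1?mulrC//; exact: (L2_adapted_L1M (ac i) (ac j)).
rewrite E' E lee_fin -E' /active; case: (mu k != 0); rewrite ?mul1r// mul0r.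
apply: expect_ge0 => w.
rewrite -lee_fin -integral_elementary_sqr.
by apply: integral_ge0 => x _; rewrite lee_fin sqr_ge0.
Qed.

End elementary.
End isometry.

Lemma grid_le (b r : R) i j : 0 <= r -> (i <= j)%N -> grid b r i <= grid b r j.
Proof. by move=> r0 ij; rewrite lerD2l ler_wpM2r// ler_nat. Qed.

Lemma grid_cell (b r x : R) n : b < x -> x <= grid b r n ->
  exists2 i, (i < n)%N & grid b r i < x <= grid b r i.+1.
Proof.
elim: n => [bx|n IH bx xn].
  by rewrite grid0 => /(lt_le_trans bx); rewrite ltxx.
have [xn'|xn'] := leP x (grid b r n).
  by have [i im ix] := IH bx xn'; exists i => //; exact: ltnW.
by exists n => //; rewrite xn' xn.
Qed.

(** * Riemann sums converge to the iterated integrals *)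

Section iterated_integral.
Variables (a b : R) (ki kj : nat).
Hypotheses (a0 : 0 <= a) (ab : a < b).
Local Notation leb := (@lebesgue_measure R).
Local Notation D := (`]a, b]%classic : set R).

Definition mesh m : R := (b - a) / m.+1%:R.

Lemma mesh_gt0 m : 0 < mesh m.
Proof. by rewrite divr_gt0 ?subr_gt0. Qed.

Let tau0 m : 0 <= mesh m := ltW (mesh_gt0 m).

Local Notation t m i := (grid a (mesh m) i).

Lemma grid_end m : t m m.+1 = b.
Proof. by rewrite /grid mulrC divfK ?pnatr_eq0// addrC subrK. Qed.

Let t0 m i : 0 <= t m i.
Proof. exact: le_trans a0 (grid_ge_start _ (tau0 m) i). Qed.

Let tS m i : t m i <= t m i.+1.
Proof. by apply: grid_le. Qed.

Let psi m : Omega -> R -> R := elementary_process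
  (fun i : 'I_m.+1 => t m i) (fun i => t m i.+1) (fun i => dl ki a (t m i)).

Let psi_adapted m (i : 'I_m.+1) : L2_adapted (t m i) (dl ki a (t m i)).
Proof.
have at_ : a <= t m i by exact: grid_ge_start.
by split; [exact: coord_increment_measurable|exact: coord_increment_L2].
Qed.

Let psi_cell m i w r : (i < m.+1)%N -> t m i < r <= t m i.+1 ->
  psi m w r = dl ki a (t m i) w.
Proof.
move=> im /andP[ir ri]; rewrite /psi /elementary_process.
rewrite (bigD1 (Ordinal im))//= big1 ?addr0 => [|j].
  by rewrite indicE mem_set ?mulr1//= in_itv/= ir ri.
rewrite -val_eqE/= neq_ltn => ji; rewrite indicE memNset ?mulr0//= in_itv/=.
move=> /andP[jr rj]; case/orP: ji => ji.
  have := le_lt_trans (le_trans rj (grid_le a (tau0 m) ji)) ir.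
  by rewrite ltxx.
have := lt_le_trans (le_lt_trans ri (le_lt_trans (grid_le a (tau0 m) ji) jr)).
by move=> /(_ _ (lexx _)); rewrite ltxx.
Qed.

Let psi_out m w r : ~ D r -> psi m w r = 0.
Proof.
move=> Dr; rewrite /psi /elementary_process big1// => i _.
rewrite indicE memNset ?mulr0//= in_itv/= => /andP[ir ri]; apply: Dr.
rewrite /= in_itv/= (le_lt_trans (grid_ge_start _ (tau0 m) i) ir)/=.
by rewrite (le_trans ri)// -(grid_end m) grid_le.
Qed.

Let Phi w r : R := lim (l ki x w @[x --> r^'-]) - l ki a w.

Let left_limit w r : cadlag (L ^~ w) -> D r ->
  l ki x w @[x --> r^'-] --> lim (l ki x w @[x --> r^'-]).
Proof.
move=> [_ cadL] /=; rewrite in_itv/= => /andP[ar _].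
have /cvg_ex[v vlim] := cadL r (le_lt_trans a0 ar).
apply/cvg_ex; exists (lin ki v).
exact: (cvg_comp _ _ vlim (@lin_continuous ki v)).
Qed.

Lemma mesh_cvg0 : mesh m @[m --> \oo] --> 0.
Proof.
rewrite -[X in _ --> X](mulr0 (b - a)); apply: cvgM; first exact: cvg_cst.
exact: cvg_harmonic.
Qed.

Let cell m r : D r -> exists2 i, (i < m.+1)%N & t m i < r <= t m i.+1.
Proof.
rewrite /= in_itv/= => /andP[ar rb].
by apply: grid_cell => //; rewrite grid_end.
Qed.

(** The left end of the cell containing [r] tends to [r] and stays strictly below it, which is why
    the left limit appears. *)
Let psi_cvg w r : cadlag (L ^~ w) -> D r -> psi m w r @[m --> \oo] --> Phi w r.
Proof.
move=> cadL Dr.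
have /choice[i_ iP] : forall m, exists i, (i < m.+1)%N /\ t m i < r <= t m i.+1.
  by move=> m; have [i] := cell m Dr; exists i.
have -> : psi ^~ w ^~ r = fun m => l ki (t m (i_ m)) w - l ki a w.
  by apply/funext => m; case: (iP m) => im ir; rewrite (psi_cell _ im ir).
apply: cvgB; last exact: cvg_cst.
have /cvg_at_leftP := left_limit cadL Dr; apply; split=> [m|].
  by case: (iP m) => _ /andP[].
apply/cvgrPdist_lt => e e0; have /cvgrPdist_lt/(_ _ e0) := mesh_cvg0.
apply: filterS => m; rewrite sub0r normrN gtr0_norm ?mesh_gt0//.
case: (iP m) => _ /andP[ir ri]; rewrite gtr0_norm ?subr_gt0//.
apply: le_lt_trans; rewrite lerBlDl; apply: le_trans ri _.
by rewrite gridS.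
Qed.

Variable N : set Omega.
Hypotheses (mN : measurable N) (N0 : P N = 0%E)
  (cadN : forall w, ~ N w -> cadlag (L ^~ w)).

(* [Phi] is the pointwise limit of the step processes [psi m] only where the
   path is cadlag, hence this product-measurable version, which vanishes on the
   null set [N]. *)
Let PhiN w r : R := \1_(~` N) w * (\1_D r * Phi w r).

Let measurable_psi m : measurable_fun setT (fun z => psi m z.1 z.2).
Proof.
by apply: measurable_elementary_process => i; exact: psi_adapted.
Qed.

Let measurable_PhiN : measurable_fun setT (fun z => PhiN z.1 z.2).
Proof.
apply: (@measurable_fun_cvg _ _ _ setT
    (fun m z => \1_(~` N) z.1 * psi m z.1 z.2)) => [m|[w r] _ /=].
  apply: measurable_funM => //; apply: (measurableT_comp _ measurable_fst).
  by apply: measurable_indic; exact: measurableC.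
have [Nw|Nw] := pselect (N w).
  rewrite /PhiN indicE memNset ?mul0r; last exact.
  by under eq_fun do rewrite mul0r; exact: cvg_cst.
rewrite /PhiN indicE mem_set// mul1r; under eq_fun do rewrite mul1r.
have [Dr|Dr] := pselect (D r).
  by rewrite indicE mem_set// mul1r; apply: psi_cvg => //; exact: cadN.
rewrite indicE memNset// mul0r; under eq_fun do rewrite psi_out//.
exact: cvg_cst.
Qed.

Let ae_notN : {ae P, forall w, ~ N w}.
Proof. by exists N; split => // w /= /contrapT. Qed.

(** At a fixed time the error is the increment from the left end of the cell up to [r-]. Its second
    moment is bounded, by Fatou, through increments ending at times [u p] below [r], all of length
    at most the mesh. *)
Let psi_PhiN_section m r : (msq P (fun w => psi m w r - PhiN w r)%R <=
  (mesh m * \1_D r)%:E)%E.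
Proof.
have [Dr|Dr] := pselect (D r); last first.
  rewrite indicE memNset// mulr0 /PhiN indicE memNset//.
  rewrite (_ : (fun w => _) = fun=> 0)%R; last first.
    by apply/funext => w; rewrite psi_out// mul0r mulr0 subr0.
  by rewrite /msq; under eq_integral do rewrite expr0n/=; rewrite integral0.
rewrite indicE mem_set// mulr1.
have [i im ir] := cell m Dr; have /andP[ir1 ir2] := ir.
(* This sequence starts at the left end of the cell and tends to [r] from strictly below. *)
pose u p := r - (r - t m i) / p.+1%:R.
have d0 : 0 < r - t m i by rewrite subr_gt0.
have tu p : t m i <= u p.
  rewrite /u lerBrDl -lerBrDr ler_pdivrMr//.
  by apply: ler_peMr; [exact: ltW|rewrite ler1n].
have ur p : u p < r by rewrite /u ltrBlDr ltrDl divr_gt0.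
have u_r : u p @[p --> \oo] --> r.
  rewrite -[X in _ --> X]subr0 -[X in r - X](mulr0 (r - t m i)).
  apply: cvgB; first exact: cvg_cst.
  by apply: cvgM; [exact: cvg_cst|exact: cvg_harmonic].
apply: (@msq_limit_le _ _ _ P (fun p => dl ki (u p) (t m i))).
- move=> p; rewrite (_ : dl ki _ _ = fun w => (-1) * dl ki (t m i) (u p) w).
    by case: (L2Z (-1) (coord_increment_L2 ki (t0 m i) (tu p))).
  by apply/funext => w; rewrite /dl; ring.
- have := measurableT_comp (measurable_funB (measurable_psi m) measurable_PhiN)
    (measurable_pair2 r).
  exact.
- apply: filterS ae_notN => w Nw.
  rewrite (psi_cell _ im ir) /PhiN indicE mem_set// mul1r.
  rewrite indicE mem_set// mul1r /Phi /dl.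
  rewrite [X in _ --> X](_ : _ = l ki (t m i) w - lim (l ki x w @[x --> r^'-]));
    last by ring.
  apply: cvgB; first exact: cvg_cst.
  by have /cvg_at_leftP := left_limit (cadN Nw) Dr; apply.
- move=> p; rewrite /msq.
  have /= E := coord_increment_var ki (t0 m i) (tu p).
  have [_ L1d] := coord_increment_L2 ki (t0 m i) (tu p).
  rewrite (_ : (fun w => _) = fun w => (dl ki (t m i) (u p) w ^+ 2)%:E).
    rewrite expectE// E lee_fin; apply: (@le_trans _ _ (u p - t m i)).
      rewrite /active; case: (mu ki != 0); rewrite ?mul1r// mul0r subr_ge0.
      exact: tu.
    rewrite lerBlDl -gridS; apply: (le_trans (ltW (ur p))) => //.
  by apply/funext => w; rewrite /dl -[in RHS]sqrrN opprB.
Qed.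

Let psi_PhiN m : (msq (P \x leb)%E (fun z => psi m z.1 z.2 - PhiN z.1 z.2)%R <=
  (mesh m * (b - a))%:E)%E.
Proof.
have mchi : measurable_fun setT (fun z => psi m z.1 z.2 - PhiN z.1 z.2).
  exact: measurable_funB (measurable_psi m) measurable_PhiN.
have [_ ->] := msq_prod P leb (chi := fun w r => psi m w r - PhiN w r) mchi.
apply: (@le_trans _ _ (\int[leb]_r (mesh m * \1_D r)%:E)%E).
  apply: ge0_le_integral => //.
  - by move=> r _; apply: integral_ge0 => w _; rewrite lee_fin sqr_ge0.
  - apply: (measurable_fun_fubini_tonelli_G (m1 := P)
      (fun z => ((psi m z.1 z.2 - PhiN z.1 z.2) ^+ 2)%:E)).
    + by apply/measurable_EFinP; exact: measurable_funX.
    + by move=> z; rewrite lee_fin sqr_ge0.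
  - apply/measurable_EFinP; exact: measurable_funM.
  - by move=> r _; exact: psi_PhiN_section.
under eq_integral do rewrite EFinM.
rewrite ge0_integralZl//; last 2 first.
- exact/measurable_EFinP.
- by rewrite lee_fin.
rewrite integral_indic ?setIT//.
by rewrite [X in (_ * X)%E](lebesgue_oc (ltW ab)).
Qed.

Lemma cvge0_near_lt (T : Type) (F : set_system T) (u : T -> \bar R) (e : R) :
  u x @[x --> F] --> 0%E -> 0 < e -> \forall x \near F, (u x < e%:E)%E.
Proof.
move=> u0 e0; have e0' : (0%E < e%:E)%E by rewrite lte_fin.
exact: (u0 _ (open_ereal_lt' e0')).
Qed.

Section simple_approximation.
Variable phi : @simple_process d Omega R.
Hypothesis phi_pred : predictable_on Ft a b phi.

Let sp_time_bounds i : (i <= sp_size phi)%N ->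
  a <= sp_time phi i /\ sp_time phi i <= b.
Proof.
have [ta tb tle] := phi_pred.
have mono i' j : (i' + j <= sp_size phi)%N ->
  sp_time phi i' <= sp_time phi (i' + j).
  elim: j => [|j IH]; first by rewrite addn0.
  rewrite addnS => ij; apply: (le_trans (IH (ltnW ij))).
  by have [] := tle _ ij.
move=> ip; split; first by rewrite -ta; exact: (mono 0%N i).
by rewrite -tb -(subnKC ip); apply: mono; rewrite subnKC.
Qed.

Variable m : nat.

(** The difference of [phi] and the step process [psi m] is one elementary process, indexed by the
    disjoint union of the two partitions. *)
Let I := ('I_(sp_size phi) + 'I_m.+1)%type.

Let s (x : I) : R := match x with
  | inl i => sp_time phi i | inr j => t m j end.
Let s' (x : I) : R := match x with
  | inl i => sp_time phi i.+1 | inr j => t m j.+1 end.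
Let c (x : I) : Omega -> R := match x with
  | inl i => sp_coef phi i | inr j => fun w => (-1) * dl ki a (t m j) w end.

Let s0 x : 0 <= s x.
Proof.
case: x => [i|j] /=; last exact: t0.
by apply: (le_trans a0); have [] := sp_time_bounds (ltnW (ltn_ord i)).
Qed.

Let ss' x : s x <= s' x.
Proof.
case: x => [i|j] /=; last exact: tS.
by have [_ _ /(_ _ (ltn_ord i))[]] := phi_pred.
Qed.

Let ac x : L2_adapted (s x) (c x).
Proof.
case: x => [i|j] /=.
  have [_ _ /(_ _ (ltn_ord i))[_ mc [C cC]]] := phi_pred.
  split => //; apply: (bounded_L2 _ _ cC).
  by apply: filtration_measurable_fun mc; exact: (s0 (inl i)).
have [mdl dl2] := psi_adapted j; split; last exact: L2Z.
by apply: (measurable_wrtM (sFt (t0 m j))) => //;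
  exact: measurable_wrt_cst (sFt (t0 m j)) _.
Qed.

Let processE w r : elementary_process s s' c w r =
  simple_eval phi r w - psi m w r.
Proof.
rewrite /elementary_process big_sumType/=; congr (_ + _).
rewrite /psi /elementary_process -sumrN; apply: eq_bigr => j _ /=.
by rewrite mulN1r mulNr.
Qed.

Let integralE w : elementary_integral kj s s' c w =
  simple_integral phi (l kj) w - iterated_sum a (mesh m) ki kj m.+1 w.
Proof.
rewrite /elementary_integral big_sumType/=; congr (_ + _).
rewrite /iterated_sum -sumrN; apply: eq_bigr => j _ /=.
by rewrite mulN1r mulNr.
Qed.

Lemma iterated_sum_L2 : L2 P (iterated_sum a (mesh m) ki kj m.+1).
Proof.
apply: L2_sum => i.
by case: (L2_adaptedM kj (t0 m i) (tS m i) (psi_adapted i)).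
Qed.

Lemma simple_integral_L2 : L2 P (simple_integral phi (l kj)).
Proof.
have := L2D (elementary_integral_L2 kj s0 ss' ac) iterated_sum_L2.
by under eq_fun do rewrite integralE subrK.
Qed.

Let simple_eval_out w r : ~ D r -> simple_eval phi r w = 0.
Proof.
move=> Dr; rewrite /simple_eval big1// => i _.
rewrite indicE memNset ?mulr0//= in_itv/= => /andP[ir ri]; apply: Dr.
have [ai _] := sp_time_bounds (ltnW (ltn_ord i)).
have [_ ib] := sp_time_bounds (ltn_ord i).
by rewrite /= in_itv/= (le_lt_trans ai ir) (le_trans ri ib).
Qed.

Let measurable_process :
  measurable_fun setT (fun z => simple_eval phi z.2 z.1 - psi m z.1 z.2).
Proof.
have := measurable_elementary_process s' ac.
by under eq_fun do rewrite processE.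
Qed.

Let measurable_eval : measurable_fun setT (fun z => simple_eval phi z.2 z.1).
Proof.
apply: eq_measurable_fun (measurable_funD measurable_process (measurable_psi
  m)).
by move=> z _ /=; rewrite subrK.
Qed.

Let E2 : \bar R := (\int[P]_w \int[leb]_(r in D)
  ((simple_eval phi r w - Phi w r) ^+ 2)%R%:E)%E.

(** The inner integrals agree outside [N]. Measurability in [w] of the one containing [Phi] is not
    given; it follows from the other by completeness of [P]. *)
Let E2E : E2 = msq (P \x leb)%E (fun z => simple_eval phi z.2 z.1 - PhiN z.1
  z.2)%R.
Proof.
have mchi : measurable_fun setT (fun z => simple_eval phi z.2 z.1 - PhiN z.1
  z.2).
  exact: measurable_funB measurable_eval measurable_PhiN.
have [-> _] := msq_prod P leb (chi :=
  fun w r => simple_eval phi r w - PhiN w r) mchi.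
have mG : measurable_fun setT
    (fun w => \int[leb]_r ((simple_eval phi r w - PhiN w r) ^+ 2)%:E)%E.
  apply: (measurable_fun_fubini_tonelli_F (m2 := leb)
    (fun z => ((simple_eval phi z.2 z.1 - PhiN z.1 z.2) ^+ 2)%:E)).
  + by apply/measurable_EFinP; exact: measurable_funX.
  + by move=> z; rewrite lee_fin sqr_ge0.
have aeE : ae_eq P setT
    (fun w => \int[leb]_r ((simple_eval phi r w - PhiN w r) ^+ 2)%:E)%E
    (fun w => \int[leb]_(r in D) ((simple_eval phi r w - Phi w r) ^+ 2)%:E)%E.
  apply: filterS ae_notN => w Nw _.
  rewrite [RHS]integral_mkcond; apply: eq_integral => r _.
  rewrite patchE; case: ifPn => [/set_mem Dr|].
    by rewrite /PhiN indicE mem_set// mul1r indicE mem_set// mul1r.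
  move=> /negP Dr; have {}Dr : ~ D r by move=> Dr'; apply: Dr; exact: mem_set.
  rewrite simple_eval_out// /PhiN [\1_D r]indicE memNset// mul0r mulr0 subr0.
  by rewrite expr0n.
apply/esym/ae_eq_integral => //.
exact: (ae_measurable_fun (filt_complete hFt) aeE mG).
Qed.

(** The isometry turns the distance of the integrals into the distance of the integrands on the
    product space, which is then split at [PhiN]. *)
Lemma simple_integral_approx :
  (msq P (fun w => iterated_sum a (mesh m) ki kj m.+1 w -
     simple_integral phi (l kj) w)%R <=
   2%:E * (mesh m * (b - a))%:E + 2%:E * E2)%E.
Proof.
have := ito_isometry kj s0 ss' ac.
rewrite (_ : msq P (elementary_integral _ _ _ _) = msq P
  (fun w => iterated_sum a (mesh m) ki kj m.+1 w - simple_integral phi (l kj)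
    w)%R);
  last first.
  by apply: eq_integral => w _; rewrite integralE -sqrrN opprB.
move=> /le_trans; apply.
rewrite (_ : (\int[P]_w _)%E = (\int[P]_w \int[leb]_r
    ((simple_eval phi r w - psi m w r) ^+ 2)%:E)%E); last first.
  by apply: eq_integral => w _; apply: eq_integral => r _; rewrite processE.
have [<- _] := msq_prod P leb (chi :=
  fun w r => simple_eval phi r w - psi m w r)
  measurable_process.
have mpP := measurable_funB (measurable_psi m) measurable_PhiN.
have mvP := measurable_funB measurable_eval measurable_PhiN.
apply: (le_trans (msq_le_2 (P \x leb)%E measurable_process mpP mvP _)).
  move=> z /=; rewrite [leRHS]addrC; apply: (le_trans _ (ler_normB _ _)).
  by rewrite opprB addrA subrK.
apply: leeD; apply: lee_wpmul2l; rewrite ?lee_fin//; first exact: psi_PhiN.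
by rewrite -E2E.
Qed.

End simple_approximation.

(** A single late member [phi n] of the sequence defining [J] is the intermediary. Its own errors
    are arbitrarily small, and what remains depends on the mesh alone. *)
Lemma iterated_sum_approx_ae J m :
  iterated_integral P Ft (l ki) (l kj) a b J ->
  (msq P (fun w => iterated_sum a (mesh m) ki kj m.+1 w - J w)%R <=
   (4 * (mesh m * (b - a)))%:E)%E.
Proof.
move=> [mJ [phi [phi_pred cvg_eval cvg_int]]].
have mJ' : measurable_fun setT J by exact/measurable_wrt_measurableP.
apply/lee_addgt0Pr => e e0.
(* The error of the integrand enters with factor 2 * 2 and that of the integral with factor 2, six
   parts in all. *)
have e60 : 0 < e / 6 by rewrite divr_gt0.
have near1 := cvge0_near_lt cvg_eval e60.
have near2 := cvge0_near_lt cvg_int e60.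
have [n [n1 n2]] : exists n,
    ((\int[P]_w \int[leb]_(r in D)
      ((simple_eval (phi n) r w - Phi w r) ^+ 2)%R%:E) < (e / 6)%:E)%E /\
    (msq P (fun w => simple_integral (phi n) (l kj) w - J w)%R < (e / 6)%:E)%E.
  have [k0 _ k0P] := near1; have [k1 _ k1P] := near2.
  exists (maxn k0 k1); split; first exact: k0P (leq_maxl _ _).
  have := k1P _ (leq_maxr k0 k1); rewrite /mean_square unlock /=.
  by under eq_integral do rewrite real_normK ?num_real//.
have [mI _] := iterated_sum_L2 m.
have [mS _] := simple_integral_L2 (phi_pred n) m.
apply: (le_trans (msq_le_2 P (measurable_funB mI mJ') (measurable_funB mI mS)
  (measurable_funB mS mJ') _)).
  move=> w; apply: (le_trans _ (ler_normD _ _)).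
  by rewrite addrA subrK.
have approx := simple_integral_approx (phi_pred n) m.
apply: (@le_trans _ _ (2%:E * (2%:E * (mesh m * (b - a))%:E + 2%:E * (e /
  6)%:E) +
    2%:E * (e / 6)%:E)%E).
  apply: leeD; apply: lee_wpmul2l; rewrite ?lee_fin//; last exact: ltW.
  apply: (le_trans approx); apply: leeD => //.
  by apply: lee_wpmul2l; rewrite ?lee_fin//; exact: ltW.
rewrite -!(EFinM, EFinD) lee_fin; lra.
Qed.

End iterated_integral.

Lemma iterated_sum_approx (a b : R) ki kj J m : 0 <= a -> a < b ->
  iterated_integral P Ft (l ki) (l kj) a b J ->
  (msq P (fun w => iterated_sum a (mesh a b m) ki kj m.+1 w - J w)%R <=
   (4 * (mesh a b m * (b - a)))%:E)%E.
Proof.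
move=> a0 ab itJ; have [N [mN N0 subN]] := levy_cadlag levyL.
apply: (iterated_sum_approx_ae a0 ab mN N0) => // w Nw.
by apply: contrapT => ncad; apply: Nw; exact: subN.
Qed.

(** * Truncation of the noise to finitely many eigenvectors *)

Section truncation.
Variables (q : R) (s t : R).
Hypotheses (mu_q : series mu @ \oo --> q) (s0 : 0 <= s) (st : s <= t).

Lemma sum_eigenvalues_le N : \sum_(k < N) mu k <= q.
Proof.
have mono : nondecreasing_seq (series mu).
  by apply: nondecreasing_series => n _ _.
have := nondecreasing_cvgn_le mono (cvgP _ mu_q) N.
by rewrite (cvg_lim _ mu_q)// seriesEord.
Qed.

(* The coefficients [inner (increment L s t w) (f k)] that remain after the
   truncation: those with [k >= N], and those with [mu k = 0], which vanish
   almost surely. *)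
Let rho N k w := (1 - (k < N)%:R * active k) * inner (increment L s t w) (f k).

Let rho_inner N k w :
  inner (increment L s t w - trunc_increment N s t w) (f k) = rho N k w.
Proof.
have [ortho _] := onb.
rewrite innerBl /rho mulrBl mul1r; congr (_ - _).
rewrite inner_suml.
have term (i : nat) : inner (dl i s t w *: (Num.sqrt (mu i) *: f i)) (f k) =
    (i == k)%:R * (active k * inner (increment L s t w) (f k)).
  rewrite !innerZl ortho; have [->|_] := eqVneq i k;
    last by rewrite mulr0 !mul0r mulr0.
  rewrite mulr1 mul1r coord_incrementE /lin /active.
  have [->|mu0] := eqVneq (mu k) 0; first by rewrite sqrtr0 invr0 !mul0r.
  rewrite mul1r mulrC mulrA divff ?mul1r// gt_eqF// sqrtr_gt0.
  by rewrite lt_neqAle eq_sym mu0 mu_ge0.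
under eq_bigr do rewrite term.
have [kN|Nk] := ltnP k N.
  rewrite (bigD1 (Ordinal kN))//= eqxx big1 ?addr0 ?mul1r// => i.
  by rewrite -val_eqE/= => /negbTE ->; rewrite mul0r.
rewrite !mul0r big1// => i _; rewrite (_ : (i == k :> nat) = false) ?mul0r//.
by apply/negbTE; rewrite neq_ltn (leq_trans (ltn_ord i) Nk).
Qed.

Let rho_L2 N k : L2 P (rho N k).
Proof. exact/L2Z/increment_inner_L2. Qed.

Let partial N n w : R := Num.sqrt (\sum_(k < n) rho N k w ^+ 2).

Let partial_cvg N w : partial N n w @[n --> \oo] -->
  `|increment L s t w - trunc_increment N s t w|.
Proof.
have [ortho expansion] := onb.
set u := increment L s t w - _.
have pE n : partial N n w = `|series (fun k => inner u (f k) *: f k) n|.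
  have -> : series (fun k => inner u (f k) *: f k) n =
      \sum_(k < n) rho N k w *: f k.
    by rewrite seriesEord; apply: eq_bigr => i _; rewrite rho_inner.
  have on : orthonormal_family (fun k : 'I_n => f k).
    by move=> i j; rewrite ortho val_eqE.
  rewrite -[RHS]ger0_norm// -sqrtr_sqr.
  by rewrite (norm_orthonormal_sum (fun k : 'I_n => rho N k w) on).
under eq_fun do rewrite pE.
exact: (cvg_norm (expansion u)).
Qed.

Let measurable_partial N n : measurable_fun setT (partial N n).
Proof.
apply: measurableT_comp.
  by apply: continuous_measurable_fun; exact: sqrt_continuous.
by apply: measurable_sum => k; apply: measurable_funX; case: (rho_L2 N k).
Qed.

Lemma measurable_trunc_error N : measurable_fun setT
  (fun w => `|increment L s t w - trunc_increment N s t w|).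
Proof.
apply: (@measurable_fun_cvg _ _ _ setT (partial N)) => [n|w _].
  exact: measurable_partial.
exact: partial_cvg.
Qed.

(** The squared norm is the limit of Parseval's partial sums, whose expectations are bounded by the
    tail of the trace; Fatou's lemma passes to the limit. *)
Lemma trunc_error N :
  (msq P (fun w => `|increment L s t w - trunc_increment N s t w|)%R <=
   ((t - s) * (q - \sum_(k < N) mu k))%:E)%E.
Proof.
have [ortho _] := onb.
have ts0 : 0 <= t - s by rewrite subr_ge0.
apply: (@msq_limit_le _ _ _ P (partial N)).
- exact: measurable_partial.
- exact: measurable_trunc_error.
- by apply: aeW => w; exact: partial_cvg.
move=> n; rewrite /msq.
have L1r k : L1 P (fun w => rho N k w ^+ 2) by case: (rho_L2 N k).
rewrite (_ : (fun w => _) = fun w => (\sum_(k < n) rho N k w ^+ 2)%:E);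
  last first.
  by apply/funext => w; rewrite sqr_sqrtr// sumr_ge0// => k _; exact: sqr_ge0.
rewrite expectE; last exact: L1_sum.
rewrite expect_sum// lee_fin.
(* A coefficient with [k < N] survives in [rho] only if [mu k = 0], and then its variance is 0. *)
have Er k : expect P (fun w => rho N k w ^+ 2) =
  (t - s) * ((N <= k)%N%:R * mu k).
  under eq_fun do rewrite exprMn.
  rewrite expectZ; last by case: (increment_inner_L2 (f k) s0 st).
  rewrite increment_inner_var// Qf innerZl ortho eqxx mulr1 /active.
  have [->|mu0] := eqVneq (mu k) 0; first by rewrite !mulr0.
  by rewrite ltnNge; case: (N <= k)%N => /=; rewrite ?mulr1n ?mulr0n; ring.
under eq_bigr do rewrite Er.
rewrite -mulr_sumr; apply: ler_wpM2l => //.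
(* The maximum covers partial sums that end before [N], whose bound is 0. *)
rewrite lerBrDl; apply: le_trans (sum_eigenvalues_le (maxn N n)).
rewrite -(big_mkord xpredT (fun k => (N <= k)%N%:R * mu k)).
rewrite -(big_mkord xpredT mu) -[X in _ <= X](big_mkord xpredT mu).
rewrite [leRHS](big_cat_nat (n := N))//= ?leq_maxl// lerD2l.
have [nN|Nn] := leqP n N.
  rewrite big_nat_cond big1 ?sumr_ge0// => k /andP[/andP[_ kn] _].
  by rewrite leqNgt (leq_trans kn nN) mul0r.
rewrite [leLHS](big_cat_nat (n := N))//= ?(ltnW Nn)//.
rewrite big_nat_cond big1 ?add0r => [|k /andP[/andP[_ kN] _]]; last first.
  by rewrite leqNgt kN mul0r.
apply: ler_sum_nat => k /andP[Nk _].
by rewrite Nk mul1r.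
Qed.

End truncation.

Lemma measurable_norm (H : hilbertType R) (Z : Omega -> H) :
  finite_rank (fun c : Omega -> R => measurable_fun setT c) Z ->
  measurable_fun setT (fun w => `|Z w|).
Proof.
move=> mZ; have [n [c [n' [c' [a [mc mc' E]]]]]] := finite_rank_inner2 mZ mZ.
rewrite (_ : (fun w => _) = fun w =>
    Num.sqrt (\sum_i \sum_j a i j * (c i w * c' j w))); last first.
  by apply/funext => w; rewrite -E inner_normE sqrtr_sqr normr_id.
apply: measurableT_comp.
  by apply: continuous_measurable_fun; exact: sqrt_continuous.
do 2 (apply: measurable_sum => ?); apply: measurable_funM => //.
exact: measurable_funM.
Qed.

(** The crude factor is harmless: the number of summands is fixed before [delta] is made small. *)
Lemma msq_sum_le (I : Type) (r : seq I) (g : I -> Omega -> R) (delta : R) :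
  0 <= delta -> (forall i, measurable_fun setT (g i)) ->
  (forall i, (msq P (g i) <= delta%:E)%E) ->
  (msq P (fun w => \sum_(i <- r) g i w)%R <= ((4 ^ size r)%:R * delta)%:E)%E.
Proof.
move=> d0 mg gd; elim: r => [|i r IH].
  rewrite (_ : (fun w => _) = fun=> 0)%R; last first.
    by apply/funext => w; rewrite big_nil.
  rewrite /msq; under eq_integral do rewrite expr0n/=.
  by rewrite integral0 lee_fin mulr_ge0.
have mr : measurable_fun setT (fun w => \sum_(i <- r) g i w).
  exact: measurable_sum.
apply: (le_trans (msq_le_2 P _ (mg i) mr _)).
- by apply: measurable_sum.
- by move=> w; rewrite big_cons ler_normD.
apply: (@le_trans _ _ (2%:E * delta%:E + 2%:E * ((4 ^ size r)%:R *
  delta)%:E)%E).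
  by apply: leeD; apply: lee_wpmul2l; rewrite ?lee_fin.
rewrite -!(EFinM, EFinD) lee_fin /= expnS natrM.
have : 1 <= (4 ^ size r)%:R :> R by rewrite ler1n expn_gt0.
by move: ((4 ^ size r)%:R : R) => c c1; nra.
Qed.

(** * The Milstein increment *)

Section milstein_core.
Context {H : hilbertType R}.
Variables (n : nat) (e : 'I_n -> H) (Ph F : {linear H -> H})
  (G T : {bilinear H -> U -> H}) (KF K q a b : R).
Hypotheses (oe : orthonormal_family e) (VPh : forall x, lin_span e (Ph x))
  (Ph_le : forall x, `|Ph x| <= `|x|) (FK : forall x, `|F x| <= KF * `|x|)
  (KF0 : 0 <= KF) (K0 : 0 <= K)
  (GK : forall x u, `|G x u| <= K * `|x| * `|u|)
  (TE : forall x u, T x u = Ph (G x u))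
  (mu_q : series mu @ \oo --> q) (a0 : 0 <= a) (ab : a < b).
Variables (x sigma : 'I_n -> Omega -> R) (J : nat -> nat -> Omega -> R).
Hypotheses (mx : forall i, measurable_wrt (Ft a) (x i))
  (x2 : forall i, L2 P (x i)) (msigma : forall i, measurable_fun setT (sigma i))
  (itJ : forall k k', iterated_integral P Ft (l k) (l k') a b (J k k')).

Definition coord_comb (c : 'I_n -> Omega -> R) w : H := \sum_i c i w *: e i.

Local Notation X := (coord_comb x).
Local Notation S := (coord_comb sigma).

Definition double_sum N w : H := \sum_(k < N) \sum_(k' < N)
  (Num.sqrt (mu k * mu k') * J k k' w) *: T (G (X w) (f k)) (f k').

Hypothesis double_sum_cvg : forall eps : R, 0 < eps ->
  \forall N \near \oo, (msq P (fun w => `|double_sum N w - S w|)%R <= eps%:E)%E.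

Definition milstein_increment w : H :=
  X w + (b - a) *: Ph (F (X w)) + T (X w) (increment L a b w) + S w.

Local Notation Y := milstein_increment.

Let b0 : 0 <= b := le_trans a0 (ltW ab).
Let dt0 : 0 <= b - a. Proof. by rewrite subr_ge0 ltW. Qed.
Let sFa := sFt a0.
Let sFb := sFt b0.

Let TK y u : `|T y u| <= K * `|y| * `|u|.
Proof. by rewrite TE (le_trans (Ph_le _)). Qed.

Let norm_X_sqr w : `|X w| ^+ 2 = \sum_i x i w ^+ 2.
Proof. exact: norm_orthonormal_sum. Qed.

(** The indicator of [|X| <= M], written with the squared norm because that is a polynomial in the
    coordinates and hence [Ft a]-measurable. *)
Let chi M w : R := \1_(`]-oo, M%:R ^+ 2]%classic : set R) (`|X w| ^+ 2).

Let chi_cases M w : chi M w = 1 /\ `|X w| <= M%:R \/ chi M w = 0.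
Proof.
rewrite /chi indicE; case: (boolP (_ \in _)) => [|_]; last by right.
by rewrite inE/= in_itv/= ler_sqr ?nnegrE// => XM; left.
Qed.

Let chi_measurable M : measurable_wrt (Ft a) (chi M).
Proof.
have mX : measurable_wrt (Ft a) (fun w => `|X w| ^+ 2).
  under eq_fun do rewrite norm_X_sqr.
  apply: (measurable_wrt_sum sFa) => i.
  by under eq_fun do rewrite expr2; exact: (measurable_wrtM sFa).
apply: measurable_wrt_measurable_comp mX.
by apply: measurable_indic; exact: measurable_itv.
Qed.

Let XM M w := chi M w *: X w.

Let XM_le M w : `|XM M w| <= M%:R.
Proof.
rewrite /XM; case: (chi_cases M w) => [[-> ?]|->]; first by rewrite scale1r.
by rewrite scale0r normr0.
Qed.

Let XM_le_X M w : `|XM M w| <= `|X w|.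
Proof.
rewrite /XM; case: (chi_cases M w) => [[-> _]|->]; first by rewrite scale1r.
by rewrite scale0r normr0.
Qed.

Let XM_adapted M : finite_rank (L2_adapted a) (XM M).
Proof.
exists n, (fun i w => chi M w * x i w), e; split=> [i|w]; last first.
  by rewrite /XM scaler_sumr; apply: eq_bigr => i _; rewrite scalerA.
have m : measurable_wrt (Ft a) (fun w => chi M w * x i w).
  exact: (measurable_wrtM sFa).
split => //; apply: (@bounded_L2 _ _ _ _ _ M%:R) => [|w].
  exact: filtration_measurable_fun m.
apply: le_trans (XM_le M w); rewrite normrM /XM normrZ ler_wpM2l//.
rewrite -ler_sqr ?nnegrE// norm_X_sqr real_normK ?num_real//.
by rewrite (bigD1 i)//= lerDl sumr_ge0// => j _; exact: sqr_ge0.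
Qed.

Let Z0 M w := XM M w + (b - a) *: Ph (F (XM M w)).

Let Z0_adapted M : finite_rank (L2_adapted a) (Z0 M).
Proof.
have [p [c [v [ac E]]]] := XM_adapted M.
exists p, c, (fun i => v i + (b - a) *: Ph (F (v i))); split => // w.
rewrite /Z0 E !linear_sum -big_split/=; apply: eq_bigr => i _.
by rewrite !linearZ/= scalerDr !scalerA mulrC.
Qed.

Let EX := expect P (fun w => `|X w| ^+ 2).

Let L1X : L1 P (fun w => `|X w| ^+ 2).
Proof.
under eq_fun do rewrite norm_X_sqr.
by apply: L1_sum => i; case: (x2 i).
Qed.

Let EX0 : 0 <= EX. Proof. by apply: expect_ge0 => w; exact: sqr_ge0. Qed.

Let EXM_le M : expect P (fun w => `|XM M w| ^+ 2) <= EX.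
Proof.
apply: le_expect => //; first exact: (L2_adapted_norm_sqr (XM_adapted M)).
by move=> w; rewrite ler_sqr ?nnegrE//; exact: XM_le_X.
Qed.

Let EZ0_le M : expect P (fun w => `|Z0 M w| ^+ 2) <=
  (1 + (b - a) * KF) ^+ 2 * EX.
Proof.
apply: (@le_trans _ _ ((1 + (b - a) * KF) ^+ 2 *
    expect P (fun w => `|XM M w| ^+ 2))); last first.
  by apply: ler_wpM2l => //; exact: sqr_ge0.
have LXM := L2_adapted_norm_sqr (XM_adapted M).
rewrite -expectZ//; apply: le_expect.
- exact: (L2_adapted_norm_sqr (Z0_adapted M)).
- exact: L1Z.
- move=> w; rewrite -exprMn ler_sqr ?nnegrE ?mulr_ge0 ?addr_ge0 ?mulr_ge0//.
  apply: (le_trans (ler_normD _ _)).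
  rewrite [X in _ + X]normrZ (ger0_norm dt0) [leRHS]mulrDl mul1r lerD2l -mulrA.
  by apply: ler_wpM2l => //; apply: le_trans (FK _); exact: Ph_le.
Qed.

(** With [c = K^2 q (b - a)] the last two terms are the [c + c^2 / 2] of [outer_state_bound]; the
    first bounds the drift part [Z0]. *)
Definition growth : R := (1 + (b - a) * KF) ^+ 2 + (b - a) * q * K ^+ 2 +
  (b - a) ^+ 2 / 2 * q ^+ 2 * K ^+ 4.

Let q0 : 0 <= q.
Proof. by have := sum_eigenvalues_le mu_q 0; rewrite big_ord0. Qed.

Let mu_le k : mu k <= q.
Proof.
apply: le_trans (sum_eigenvalues_le mu_q k.+1).
by rewrite big_ord_recr/= lerDr sumr_ge0.
Qed.

Lemma growth_ge0 : 0 <= growth.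
Proof.
by rewrite /growth !addr_ge0 ?sqr_ge0// !mulr_ge0 ?exprn_ge0 ?invr_ge0.
Qed.

Let W M N m := outer_state G T N a (mesh a b m) (XM M) (Z0 M) m.+1.

(** The constant is independent of the cut-off, the truncation and the mesh, so it passes to the
    limit in all three. *)
Let W_bound M N m : finite_rank (L2_adapted b) (W M N m) /\
  expect P (fun w => `|W M N m w| ^+ 2) <= growth * EX.
Proof.
have [] := outer_state_bound GK TK (sum_eigenvalues_le mu_q N) a0
  (ltW (mesh_gt0 ab m)) (XM_adapted M) (Z0_adapted M) m.+1.
rewrite grid_end => aW EW; split => //; apply: (le_trans EW).
have -> : m.+1%:R * mesh a b m = b - a.
  by rewrite /mesh mulrC divfK ?pnatr_eq0.
have c0 : 0 <= K ^+ 2 * q * (b - a) + (K ^+ 2 * q * (b - a)) ^+ 2 / 2.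
  rewrite addr_ge0// ?mulr_ge0 ?sqr_ge0 ?invr_ge0//.
apply: (le_trans (lerD (EZ0_le M) (ler_wpM2r c0 (EXM_le M)))).
by rewrite /growth le_eqVlt; apply/orP; left; apply/eqP; field.
Qed.

Let YM M w := chi M w *: Y w.

(** The summands are the errors of truncating the noise, of truncating the double series, and of
    replacing the iterated integrals by Riemann sums. All are real-valued, and the cut-off has
    turned [|X|] into the constant [M]. *)
Let bound M N m w : R := K * M%:R * `|increment L a b w - trunc_increment N a b
  w| +
  (`|double_sum N w - S w| + \sum_(k < N) \sum_(k' < N) q * K * (K * M%:R) *
    `|iterated_sum a (mesh a b m) k k' m.+1 w - J k k' w|).

Let YM_W M N m w : `|YM M w - W M N m w| <= bound M N m w.
Proof.
have chiT u : chi M w *: T (X w) u = T (XM M w) u by rewrite linearZl_LR.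
have YE : YM M w = Z0 M w + T (XM M w) (increment L a b w) + chi M w *: S w.
  rewrite /YM /Y /Z0 !scalerDr chiT; congr (_ + _ + _ + _).
  by rewrite !linearZ/= !scalerA mulrC.
have dsE : chi M w *: double_sum N w = \sum_(k < N) \sum_(k' < N)
    (Num.sqrt (mu k * mu k') * J k k' w) *: T (G (XM M w) (f k)) (f k').
  rewrite scaler_sumr; apply: eq_bigr => k _; rewrite scaler_sumr.
  by apply: eq_bigr => k' _; rewrite !linearZl_LR/= !scalerA mulrC.
(* The truncated double series with the true integrals is inserted between the series [S] and the
   Riemann sums. *)
have -> : YM M w - W M N m w =
    T (XM M w) (increment L a b w - trunc_increment N a b w) +
    (- (chi M w *: (double_sum N w - S w)) -
     \sum_(k < N) \sum_(k' < N) (Num.sqrt (mu k * mu k') *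
       (iterated_sum a (mesh a b m) k k' m.+1 w - J k k' w)) *:
       T (G (XM M w) (f k)) (f k')).
  rewrite YE /W outer_stateE grid_end; move: (increment L a b w) => u.
  rewrite linearBr scalerBr dsE.
  under [X in _ = _ + (_ - X)]eq_bigr do
    under eq_bigr do rewrite mulrBr scalerBl.
  under [X in _ = _ + (_ - X)]eq_bigr do rewrite sumrB.
  rewrite sumrB.
  rewrite [X in _ = _ + (X - _)]opprB [X in _ = _ + (_ + X)]opprB.
  rewrite [X in _ = _ + X]addrA subrK.
  by rewrite opprD addrACA; congr (_ + _); rewrite opprD addrACA subrr add0r.
apply: (le_trans (ler_normD _ _)); apply: lerD.
  by apply: (le_trans (TK _ _)); apply: ler_wpM2r => //; apply: ler_wpM2l.
apply: (le_trans (ler_normB _ _)); apply: lerD.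
  rewrite normrN normrZ; case: (chi_cases M w) => [[-> _]|->].
    by rewrite normr1 mul1r.
  by rewrite normr0 mul0r.
apply: (le_trans (ler_norm_sum _ _ _)); apply: ler_sum => k _.
apply: (le_trans (ler_norm_sum _ _ _)); apply: ler_sum => k' _.
rewrite normrZ normrM ger0_norm ?sqrtr_ge0//.
rewrite mulrAC; apply: ler_wpM2r => //.
have fk i : `|f i| = 1.
  have [ortho _] := onb; apply/eqP.
  by rewrite -(@eqrXn2 _ 2)// -inner_normE ortho eqxx expr1n.
rewrite -mulrA; apply: ler_pM => //.
  have : Num.sqrt (mu k * mu k') <= Num.sqrt (q ^+ 2).
    by rewrite ler_sqrt ?sqr_ge0// expr2 ler_pM.
  by rewrite sqrtr_sqr (ger0_norm q0).
apply: (le_trans (TK _ _)); rewrite fk mulr1; apply: ler_wpM2l => //.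
by apply: (le_trans (GK _ _)); rewrite fk mulr1; apply: ler_wpM2l.
Qed.

Local Notation measurable_fr :=
  (finite_rank (fun c : Omega -> R => measurable_fun setT c)).

Let mxf i : measurable_fun setT (x i). Proof. by case: (x2 i). Qed.

Let mJ k k' : measurable_fun setT (J k k').
Proof. by case: (itJ k k') => + _; move/measurable_wrt_measurableP. Qed.

Let X_fr : measurable_fr X.
Proof. by exists n, x, e. Qed.

Let S_fr : measurable_fr S.
Proof. by exists n, sigma, e. Qed.

Let scale_fr (c : Omega -> R) (Z : Omega -> H) : measurable_fun setT c ->
  measurable_fr Z -> measurable_fr (fun w => c w *: Z w).
Proof.
move=> mc; apply: finite_rank_scale => c' mc'; exact: measurable_funM.
Qed.

Lemma measurable_double_sum N : measurable_fr (double_sum N).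
Proof.
do 2 (apply: finite_rank_sum => ?); apply: scale_fr.
  exact: measurable_funM.
eexists n, x, (fun i => T (G (e i) _) _); split => // w.
rewrite linear_sumlz linear_sumlz; apply: eq_bigr => i _.
by rewrite !linearZl_LR.
Qed.

Let measurable_double_sum_error N :
  measurable_fun setT (fun w => `|double_sum N w - S w|).
Proof.
apply: measurable_norm; apply: finite_rankD; first exact: measurable_double_sum.
rewrite (_ : (fun w => _) = fun w => (-1) *: S w).
  by apply: scale_fr.
by apply/funext => w; rewrite scaleN1r.
Qed.

Let measurable_iterated_error m k k' : measurable_fun setT
  (fun w => `|iterated_sum a (mesh a b m) k k' m.+1 w - J k k' w|).
Proof.
apply: measurableT_comp => //; apply: measurable_funB => //.
by case: (iterated_sum_L2 k k' a0 ab m).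
Qed.

Let msq_norm (Z : Omega -> R) : msq P (fun w => `|Z w|)%R = msq P Z.
Proof. by apply: eq_integral => w _; rewrite real_normK ?num_real. Qed.

(** [N] is chosen first, from the tail of the trace and the convergence of the series, and then the
    mesh. The splits add up to [2 eps / 16 + 2 (2 eps / 16 + 2 eps / 16) = 5 eps / 8]. *)
Let bound_small M (eps : R) : 0 < eps -> exists N m,
  measurable_fun setT (bound M N m) /\ (msq P (bound M N m) <= eps%:E)%E.
Proof.
move=> eps0; have eps16 : 0 < eps / 16 by rewrite divr_gt0.
pose c1 := (K * M%:R) ^+ 2 * (b - a).
have c10 : 0 <= c1 by rewrite mulr_ge0// sqr_ge0.
have [N [N1 N2]] : exists N, c1 * (q - \sum_(k < N) mu k) <= eps / 16 /\
    (msq P (fun w => `|double_sum N w - S w|)%R <= (eps / 16)%:E)%E.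
  have [n0 _ n0P] := double_sum_cvg eps16.
  have d0 : 0 < eps / 16 / (c1 + 1) by rewrite divr_gt0// ltr_wpDl.
  have [n1 _ n1P] : \forall N \near \oo,
    `|q - series mu N| <= eps / 16 / (c1 + 1).
    by move/cvgrPdist_le : mu_q; apply.
  exists (maxn n0 n1); split; last exact: n0P (leq_maxl _ _).
  have := n1P _ (leq_maxr n0 n1); rewrite /= seriesEord.
  move=> /(le_trans (ler_norm _)); rewrite ler_pdivlMr;
    last by rewrite ltr_wpDl.
  apply: le_trans; rewrite mulrC; apply: ler_wpM2l; last by rewrite lerDl.
  by rewrite subr_ge0 sum_eigenvalues_le.
(* [c2] times the mesh bounds the error of one pair of indices; [c3] adds a factor [4^N] for each of
   the two summations. *)
pose c2 := (q * K * (K * M%:R)) ^+ 2 * (4 * (b - a)).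
have c20 : 0 <= c2 by rewrite mulr_ge0 ?sqr_ge0// mulr_ge0.
pose c3 : R := (4 ^ N)%:R * ((4 ^ N)%:R * c2).
have c30 : 0 <= c3 by rewrite !mulr_ge0.
have [m m1] : exists m, c3 * mesh a b m <= eps / 16.
  have d0 : 0 < eps / 16 / (c3 + 1) by rewrite divr_gt0// ltr_wpDl.
  have /cvgrPdist_le/(_ _ d0)[n0 _ n0P] := @mesh_cvg0 a b.
  exists n0; have := n0P n0 (leqnn _); rewrite /= sub0r normrN.
  move=> /(le_trans (ler_norm _)); rewrite ler_pdivlMr;
    last by rewrite ltr_wpDl.
  apply: le_trans; rewrite mulrC; apply: ler_wpM2l; last by rewrite lerDl.
  by rewrite ltW// mesh_gt0.
have mD := measurable_double_sum_error N.
have mT : measurable_fun setT (fun w => K * M%:R *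
    `|increment L a b w - trunc_increment N a b w|).
  by apply: measurable_funM => //; exact: (measurable_trunc_error a0 (ltW ab)).
have mI k k' : measurable_fun setT (fun w => q * K * (K * M%:R) *
    `|iterated_sum a (mesh a b m) k k' m.+1 w - J k k' w|).
  exact: measurable_funM.
have mII : measurable_fun setT (fun w => \sum_(k < N) \sum_(k' < N)
    q * K * (K * M%:R) *
    `|iterated_sum a (mesh a b m) k k' m.+1 w - J k k' w|).
  by do 2 (apply: measurable_sum => ?).
have mDI := measurable_funD mD mII.
exists N, m; split; first exact: measurable_funD.
apply: (le_trans (msq_le_2 P (measurable_funD mT mDI) mT mDI _)).
  by move=> w /=; exact: ler_normD.
have E1 : (msq P (fun w => K * M%:R *
    `|increment L a b w - trunc_increment N a b w|)%R <= (eps / 16)%:E)%E.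
  rewrite msqZ; last exact: (measurable_trunc_error a0 (ltW ab)).
  apply: (@le_trans _ _ (((K * M%:R) ^+ 2)%:E *
      ((b - a) * (q - \sum_(k < N) mu k))%:E)%E).
    by apply: lee_wpmul2l; rewrite ?lee_fin ?sqr_ge0//;
      exact: trunc_error (ltW ab) _.
  by rewrite -EFinM lee_fin mulrA.
have E3 : (msq P (fun w => \sum_(k < N) \sum_(k' < N) q * K * (K * M%:R) *
    `|iterated_sum a (mesh a b m) k k' m.+1 w - J k k' w|)%R <= (eps /
      16)%:E)%E.
  have mesh0 : 0 <= mesh a b m by rewrite ltW// mesh_gt0.
  have d0 : 0 <= c2 * mesh a b m by rewrite mulr_ge0.
  apply: (@le_trans _ _ ((4 ^ size (index_enum 'I_N))%:R *
      ((4 ^ size (index_enum 'I_N))%:R * (c2 * mesh a b m)))%:E).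
    apply: msq_sum_le => [|k|k]; first by rewrite mulr_ge0.
    - by apply: measurable_sum => k'; exact: mI.
    - apply: msq_sum_le => // k'.
      rewrite msqZ; last exact: measurable_iterated_error.
      rewrite msq_norm.
      apply: (@le_trans _ _ (((q * K * (K * M%:R)) ^+ 2)%:E *
          (4 * (mesh a b m * (b - a)))%:E)%E).
        apply: lee_wpmul2l; first by rewrite lee_fin sqr_ge0.
        exact: iterated_sum_approx.
      rewrite -EFinM lee_fin /c2 le_eqVlt; apply/orP; left; apply/eqP.
      by ring.
  rewrite lee_fin [size _](_ : _ = N); last first.
    by rewrite -sum1_size sum1_card card_ord.
  by apply: le_trans m1; rewrite /c3 !mulrA.
have E23 : (msq P (fun w => `|double_sum N w - S w| + \sum_(k < N) \sum_(k' < N)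
    q * K * (K * M%:R) *
    `|iterated_sum a (mesh a b m) k k' m.+1 w - J k k' w|)%R <= (eps / 4)%:E)%E.
  apply: (le_trans (msq_le_2 P mDI mD mII _)).
    by move=> w /=; exact: ler_normD.
  apply: (@le_trans _ _ (2%:E * (eps / 16)%:E + 2%:E * (eps / 16)%:E)%E).
    by apply: leeD; apply: lee_wpmul2l; rewrite ?lee_fin.
  by rewrite -!(EFinM, EFinD) lee_fin; lra.
apply: (@le_trans _ _ (2%:E * (eps / 16)%:E + 2%:E * (eps / 4)%:E)%E).
  by apply: leeD; apply: lee_wpmul2l; rewrite ?lee_fin.
by rewrite -!(EFinM, EFinD) lee_fin; lra.
Qed.

(** The increment itself need not have finite rank, but the values of [T] lie in [V] and can be
    expanded in [e]. *)
Let T_increment_fr : measurable_fr (fun w => T (X w) (increment L a b w)).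
Proof.
rewrite (_ : (fun w => _) = fun w => \sum_i x i w *: \sum_j
    inner (T (e i) (increment L a b w)) (e j) *: e j); last first.
  apply/funext => w; rewrite linear_sumlz; apply: eq_bigr => i _.
  rewrite linearZl_LR/=; congr (_ *: _); apply: orthonormal_expansion => //.
  by rewrite TE; exact: VPh.
apply: finite_rank_sum => i; apply: scale_fr => //.
apply: finite_rank_sum => j.
exists 1%N, (fun=> fun w => inner (T (e i) (increment L a b w)) (e j)),
  (fun=> e j).
split=> [_|w]; last by rewrite big_ord1.
have mTt t : 0 <= t -> measurable_fun setT (fun w => inner (T (e i) (L t w)) (e
  j)).
  move=> t0; apply/measurable_wrt_measurableP; case: (sqL t0) => mL _.
  apply: (measurable_wrt_comp (g := fun u => inner (T (e i) u) (e j)) _ mL).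
  have cT : continuous (T (e i)).
    apply/bounded_linear_continuous/linear_boundedP.
    exists (K * `|e i|); split; first exact: num_real.
    by move=> r /ltW Kr u; apply: (le_trans (TK _ _)); exact: ler_wpM2r.
  by move=> u; exact: (cvg_comp _ _ (cT u) (@continuous_inner _ _ (e j) _)).
rewrite /increment; under eq_fun do rewrite linearBr innerBl.
by apply: measurable_funB; exact: mTt.
Qed.

Let Y_fr : measurable_fr Y.
Proof.
apply: finite_rankD => //; apply: finite_rankD => //; apply: finite_rankD => //.
apply: scale_fr; first exact: measurable_cst.
exact: (finite_rank_map (Ph \o F)).
Qed.

Let chi_fun M : measurable_fun setT (chi M).
Proof. exact: filtration_measurable_fun (chi_measurable M). Qed.

Let YM_fr M : measurable_fr (YM M).
Proof. exact: scale_fr. Qed.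

Let adapted_fr t (Z : Omega -> H) :
  finite_rank (L2_adapted t) Z -> measurable_fr Z.
Proof. by apply: finite_rank_sub => c [_ []]. Qed.

(** [YM M] is approximated by the discrete states [W], whose bound it inherits through
    [msq_approx]. *)
Let YM_bound M : (msq P (fun w => `|YM M w|)%R <= (growth * EX)%:E)%E.
Proof.
apply: msq_approx; first by rewrite mulr_ge0// growth_ge0.
  exact: measurable_norm.
move=> eps /(bound_small M)[N [m [mb eb]]].
have [aW EW] := W_bound M N m.
exists (fun w => `|W M N m w|), (bound M N m); split => //.
- exact/measurable_norm/adapted_fr/aW.
- move=> w; rewrite !normr_id.
  have := YM_W M N m w => /le_trans/(_ (ler_norm _)).
  rewrite -[YM M w](subrK (W M N m w)) => YW.
  by rewrite (le_trans (ler_normD _ _))// addrC lerD2l -[_ - _](addrK (W M N m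
    w)).
- by rewrite /msq expectE ?lee_fin//; exact: L2_adapted_norm_sqr aW.
Qed.

Let inner_fr (Z : Omega -> H) v : measurable_fr Z ->
  measurable_fun setT (fun w => inner (Z w) v).
Proof.
move=> /finite_rank_inner - /(_ v)[p [c [d' [mc E]]]].
rewrite (_ : (fun w => _) = fun w => \sum_i d' i * c i w); last exact/funext.
by apply: measurable_sum => i; exact: measurable_funM.
Qed.

(** [J] and [sigma] are only known to be measurable for the full sigma-algebra. Measurability at
    time [b] is inherited from the adapted [W] through the L2 limit. *)
Let YM_measurable M v : measurable_wrt (Ft b) (fun w => inner (YM M w) v).
Proof.
apply: (L2_limit_measurable_wrt (P := P)) => //.
- exact: (filt_measurable hFt).
- by move=> A /(filt_null hFt); exact: (filt_mono hFt).
- exact: inner_fr.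
move=> eps eps0.
have v1 : 0 < `|v| ^+ 2 + 1 by rewrite ltr_wpDl// sqr_ge0.
have [N [m [mb eb]]] := bound_small M (divr_gt0 eps0 v1).
have [aW EW] := W_bound M N m.
exists (fun w => inner (W M N m w) v); split.
  have [p [c [d' [ac E]]]] := finite_rank_inner v aW.
  rewrite (_ : (fun w => _) = fun w => \sum_i d' i * c i w); last exact/funext.
  apply: (measurable_wrt_sum sFb) => i; apply: (measurable_wrtM sFb).
    exact: measurable_wrt_cst.
  by case: (ac i).
apply: (@le_trans _ _ (msq P (fun w => `|v| * bound M N m w)%R)).
  apply: le_msq.
  - by apply: measurable_funB; apply: inner_fr => //; exact: adapted_fr aW.
  - exact: measurable_funM.
  - move=> w; rewrite -innerBl (le_trans (cauchy_schwarz _ _))//.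
    rewrite normrM normr_id mulrC ler_wpM2l// distrC.
    exact: (le_trans (YM_W M N m w) (ler_norm _)).
rewrite msqZ//; apply: (@le_trans _ _ ((`|v| ^+ 2)%:E *
    (eps / (`|v| ^+ 2 + 1))%:E)%E).
  by apply: lee_wpmul2l => //; rewrite lee_fin sqr_ge0.
rewrite -EFinM lee_fin mulrCA; apply: ler_piMr; first exact: ltW.
by rewrite ler_pdivrMr// mul1r lerDl.
Qed.

Let YM_cvg w : \forall M \near \oo, YM M w = Y w.
Proof.
near=> M; rewrite /YM /chi indicE mem_set ?scale1r//= in_itv/= ler_sqr
  ?nnegrE//.
by near: M; exact: nbhs_infty_ger.
Unshelve. all: end_near. Qed.

(** For each [w] the cut-off is inactive once [M >= |X w|], so Fatou's lemma removes it. *)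
Lemma milstein_increment_bound :
  (msq P (fun w => `|Y w|)%R <= (growth * expect P (fun w => `|X w| ^+
    2))%:E)%E.
Proof.
apply: (@msq_limit_le _ _ _ P (fun M w => `|YM M w|)).
- by move=> M; exact: measurable_norm.
- exact: measurable_norm.
- by apply: aeW => w; apply: cvg_near_cst; apply: filterS (YM_cvg w) => M ->.
- exact: YM_bound.
Qed.

Lemma milstein_increment_measurable v :
  measurable_wrt (Ft b) (fun w => inner (Y w) v).
Proof.
apply: (measurable_wrt_cvg sFb (c_ := fun M w => inner (YM M w) v)) => [M|w].
  exact: YM_measurable.
by apply: cvg_near_cst; apply: filterS (YM_cvg w) => M ->.
Qed.

End milstein_core.

End levy.

(** * Stability *)

Section galerkin_milstein.
Context {d : measure_display} {Omega : measurableType d} {R : realType}.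
Variables (P : probability Omega R) (Ft : R -> set (set Omega)).
Hypothesis hFt : usual_filtration P Ft.
Variables (H U : hilbertType R).
Variables (F : {linear H -> H}) (G : {bilinear H -> U -> H}).
Hypotheses (cF : continuous F) (bG : bounded_operator_valued G).
Variables (Q : {linear U -> U}) (mu : nat -> R) (f : nat -> U).
Hypotheses (onb : orthonormal_basis f) (mu_ge0 : forall k, 0 <= mu k)
  (Qf : forall k, Q (f k) = mu k *: f k) (tcQ : trace_class f Q).
Variable L : R -> Omega -> U.
Hypotheses (levyL : levy_process P Ft L)
  (sqL : forall t, 0 <= t -> square_integrable P (L t))
  (martL : martingale P Ft L) (covL : covariance_operator P L Q).
Variables (n : nat) (e : 'I_n -> H) (DB : set H) (B Ph Ah : H -> H).
Local Notation V := (lin_span e).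
Hypotheses (oe : orthonormal_family e) (linB : linear_on DB B)
  (VDB : V `<=` DB) (hPh : orthogonal_projection V Ph)
  (hAh : galerkin_operator V B Ah).
Variables (lambda dt : R).
Hypotheses (dt0 : 0 < dt)
  (hlambda : smallest_eigenvalue V (fun v => - Ah v) lambda).

Let q := trace f Q.

Let mu_q : series mu @ \oo --> q.
Proof.
have [ortho _] := onb.
rewrite (_ : mu = fun k => inner (Q (f k)) (f k)); first exact: tcQ.
by apply/funext => k; rewrite Qf innerZl ortho eqxx mulr1.
Qed.

Let Ph_linear : linear Ph.
Proof.
move=> c y z.
by rewrite (orthogonal_projectionD oe hPh) (orthogonal_projectionZ oe hPh).
Qed.

Let PhL : {linear H -> H} := HB.pack Ph (GRing.isLinear.Build R H H *:%R Ph
  Ph_linear).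

Let T_bilinear : bilinear_for *:%R *:%R (fun y u => Ph (G y u)).
Proof.
split=> [u c y z|y c u v].
  by rewrite /= linearPl Ph_linear.
by rewrite /= linearPr Ph_linear.
Qed.

Let T : {bilinear H -> U -> H} := HB.pack (fun y u => Ph (G y u))
  (bilinear_isBilinear.Build R H U H *:%R *:%R _ T_bilinear).

Let VPh y : V (Ph y). Proof. by case: (hPh y). Qed.

Let rate := growth (opnorm F) (opnorm2 G) q 0 dt / (1 + dt * lambda) ^+ 2.

Let dl0 : 0 < 1 + dt * lambda.
Proof.
by rewrite ltr_wpDr// mulr_ge0 ?(smallest_eigenvalue_ge0 hAh hlambda)// ltW.
Qed.

Let q_ge0 : 0 <= q.
Proof. by have := sum_eigenvalues_le mu_ge0 mu_q 0; rewrite big_ord0. Qed.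

Let growth0_ge0 : 0 <= growth (opnorm F) (opnorm2 G) q 0 dt.
Proof.
have K0 := opnorm2_ge0 bG; have dt_ge0 := ltW dt0.
by rewrite /growth subr0 !addr_ge0 ?sqr_ge0// !mulr_ge0 ?exprn_ge0 ?invr_ge0.
Qed.

(** [S] is merely Borel and need not have finite rank. Expanding the squared norm leaves only [|S|]
    and the inner products of [S] with the finitely many vectors that span [Z]. *)
Lemma measurable_norm_sub (S Z : Omega -> H) : measurable_wrt measurable S ->
  finite_rank (fun c : Omega -> R => measurable_fun setT c) Z ->
  measurable_fun setT (fun w => `|Z w - S w|).
Proof.
move=> mS mZ; have [p [c [v [mc ZE]]]] := mZ.
have mSv u : measurable_fun setT (fun w => inner (S w) u).
  apply/measurable_wrt_measurableP.
  exact: (measurable_wrt_comp (@continuous_inner _ _ u) mS).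
rewrite (_ : (fun w => _) = fun w => Num.sqrt (`|Z w| ^+ 2 +
    2 * (- \sum_i c i w * inner (S w) (v i)) + `|S w| ^+ 2)); last first.
  apply/funext => w; rewrite -[LHS]ger0_norm// -sqrtr_sqr norm_sqrD normrN.
  rewrite innerNr [X in inner X _]ZE inner_suml;
    congr (Num.sqrt (_ + _ * - _ + _)).
  by apply: eq_bigr => i _; rewrite innerZl innerC.
apply: measurableT_comp.
  by apply: continuous_measurable_fun; exact: sqrt_continuous.
apply: measurable_funD; first apply: measurable_funD.
- by apply: measurable_funX; exact: measurable_norm.
- apply: measurable_funM => //; apply: measurable_funN.
  by apply: measurable_sum => i; apply: measurable_funM.
- apply: measurable_funX; apply/measurable_wrt_measurableP.
  exact: (measurable_wrt_comp (@norm_continuous _ _) mS).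
Qed.

(** [Y] is not assumed measurable; completeness of [P] transfers the measurability of [|Z|]. *)
Lemma mean_square_ae (Y Z : Omega -> H) :
  measurable_fun setT (fun w => `|Z w|) -> {ae P, forall w, Y w = Z w} ->
  mean_square P Y = msq P (fun w => `|Z w|).
Proof.
move=> mZ YZ; rewrite /mean_square unlock; apply/esym/ae_eq_integral => //.
- by apply/measurable_EFinP; exact: measurable_funX.
- apply: (ae_measurable_fun (filt_complete hFt)
    (f := fun w => (`|Z w| ^+ 2)%:E)); last first.
    by apply/measurable_EFinP; exact: measurable_funX.
  by apply: filterS YZ => w ->.
- by apply: filterS YZ => w ->.
Qed.

Lemma mean_square_ge0 (Y : Omega -> H) : (0 <= mean_square P Y)%E.
Proof.
rewrite /mean_square unlock; apply: integral_ge0 => w _.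
by rewrite lee_fin sqr_ge0.
Qed.

Section step.
Variables (X : nat -> Omega -> H) (j : nat).
Hypothesis stepX :
  milstein_step P Ft (resolvent V Ah dt) Ph F G L mu f dt X j.

Let t i : R := i%:R * dt.

Let coords i k w := inner (X i w) (e k).

(* [X i] is [V]-valued only almost surely; this is a version that is [V]-valued
   everywhere. *)
Definition step_state i : Omega -> H := coord_comb e (coords i).

(** The invariant of the induction over the time steps. Measurability at time [t i] is what makes
    the next noise increments independent of the state. *)
Definition good_state i (m0 : R) : Prop :=
  [/\ {ae P, forall w, V (X i w)},
     (forall k, measurable_wrt (Ft (t i)) (coords i k)) &
     (msq P (fun w => `|step_state i w|)%R <= m0%:E)%E].

Lemma step_state_ae i : {ae P, forall w, V (X i w)} ->
  {ae P, forall w, X i w = step_state i w}.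
Proof. by apply: filterS => w; exact: orthonormal_expansion. Qed.

Lemma measurable_step_state i (F' : set (set Omega)) : F' `<=` measurable ->
  (forall k, measurable_wrt F' (coords i k)) ->
  finite_rank (fun c : Omega -> R => measurable_fun setT c) (step_state i).
Proof.
move=> F'm mc; exists n, (coords i), e; split => // k.
exact: (sub_measurable_wrt F'm (mc k)).
Qed.

Let t_ge0 i : 0 <= t i. Proof. by rewrite mulr_ge0// ltW. Qed.

Let tB i : t i.+1 - t i = dt.
Proof. by rewrite /t -natr1 mulrDl mul1r addrAC subrr add0r. Qed.

(** State and series limit are replaced by versions with values in [V], so that the bound on
    [milstein_increment] applies; the resolvent then contributes the factor [(1 + dt lambda)^-2]. *)
Lemma good_state_step m0 : 0 <= m0 -> good_state j m0 ->
  good_state j.+1 (rate * m0).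
Proof.
move=> m00 [VX mx msX].
have [J [S [itJ mS cvgS stepE]]] := stepX.
have mX : finite_rank (fun c : Omega ->
  R => measurable_fun setT c) (step_state j).
  exact: (measurable_step_state (filt_measurable hFt (t_ge0 j)) mx).
have mxf k : measurable_fun setT (coords j k).
  exact: (filtration_measurable_fun hFt (t_ge0 j) (mx k)).
have stateE w : `|step_state j w| ^+ 2 = \sum_k coords j k w ^+ 2.
  exact: norm_orthonormal_sum.
have x2 k : L2 P (coords j k).
  split => //; apply: L1_lty; first exact: measurable_funX.
    by move=> w; exact: sqr_ge0.
  apply: (le_lt_trans _ (ltry m0)); apply: (le_trans _ msX).
  apply: ge0_le_integral => //.
  - by move=> w _; rewrite lee_fin sqr_ge0.
  - by apply/measurable_EFinP; exact: measurable_funX.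
  - by apply/measurable_EFinP; apply: measurable_funX; exact: measurable_norm.
  - move=> w _; rewrite lee_fin stateE (bigD1 k)//= lerDl.
    by apply: sumr_ge0 => i _; exact: sqr_ge0.
have EX : expect P (fun w => `|step_state j w| ^+ 2) <= m0.
  rewrite -lee_fin -expectE//.
  under eq_fun do rewrite stateE.
  by apply: L1_sum => k; case: (x2 k).
pose sigma k w := inner (S w) (e k).
have msigma k : measurable_fun setT (sigma k).
  apply/measurable_wrt_measurableP.
  exact: (measurable_wrt_comp (@continuous_inner _ _ (e k)) mS).
pose S' := coord_comb e sigma.
have S'E w : S' w = Ph (S w) by rewrite (orthogonal_projectionE oe hPh).
have S'fr : finite_rank (fun c : Omega -> R => measurable_fun setT c) S'.
  by exists n, sigma, e.
pose D N := double_sum mu f e G T (coords j) J N.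
have mD N : finite_rank (fun c : Omega -> R => measurable_fun setT c) (D N).
  exact: (measurable_double_sum e G T x2 itJ).
have VD N w : V (D N w).
  rewrite /D /double_sum; elim/big_ind : _ => [|y z|k _].
  - by exists (fun=> 0) => //; rewrite big1// => i _; rewrite scale0r.
  - exact: lin_spanD.
  elim/big_ind : _ => [|y z|k' _].
  - by exists (fun=> 0) => //; rewrite big1// => i _; rewrite scale0r.
  - exact: lin_spanD.
  - by apply: lin_spanZ; exact: VPh.
have aeX := step_state_ae VX.
have mDS N : measurable_fun setT (fun w => `|D N w - S w|).
  exact: measurable_norm_sub.
have cvgD : msq P (fun w => `|D N w - S w|) @[N --> \oo] --> 0%E.
  apply: cvg_trans cvgS; apply: near_eq_cvg; apply: nearW => N.
  rewrite (mean_square_ae (Z := fun w => D N w - S w)) //.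
  by apply: filterS aeX => w ->.
have D_le N w : `|D N w - S' w| <= `|D N w - S w|.
  have -> : D N w - S' w = Ph (D N w - S w).
    rewrite S'E -[in LHS](orthogonal_projection_id oe hPh (VD N w)).
    by rewrite -!(linearB PhL).
  exact: (orthogonal_projection_norm hPh).
have double_sum_cvg (eps : R) : 0 < eps -> \forall N \near \oo,
    (msq P (fun w => `|D N w - S' w|)%R <= eps%:E)%E.
  move=> eps0; have := cvge0_near_lt cvgD eps0.
  apply: filterS => N /ltW; apply: le_trans; apply: le_msq => [||w].
  - apply: measurable_norm; apply: finite_rankD => //.
    rewrite (_ : (fun w => _) = fun w => (-1) *: S' w).
      apply: finite_rank_scale S'fr => c mc; exact: measurable_funM.
    by apply/funext => w; rewrite scaleN1r.
  - exact: mDS.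
  - by rewrite !normr_id.
(* The partial sums [D N] lie in [V], and [S' = Ph S] is the best approximation of [S] from [V];
   hence [|S - S'| <= |S - D N|], which tends to 0 in L2. *)
have aeS : {ae P, forall w, S w = S' w}.
  have mS'S := measurable_norm_sub mS S'fr.
  have : msq P (fun w => `|S' w - S w|) = 0%E.
    apply/eqP; rewrite eq_le msq_ge0 andbT; apply/lee_addgt0Pr => eps eps0.
    rewrite add0e; have [N _ /(_ _ (leqnn N))/ltW] := cvge0_near_lt cvgD eps0.
    apply: le_trans; apply: le_msq => [||w] //.
    rewrite !normr_id distrC [leRHS]distrC S'E.
    exact: (orthogonal_projection_best hPh _ (VD N w)).
  move=> /(msq_eq0 mS'S); apply: filterS => w /eqP.
  by rewrite normr_eq0 subr_eq0 => /eqP.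
pose Y := milstein_increment L e PhL F T (t j) (t j.+1) (coords j) sigma.
have tj : t j < t j.+1 by rewrite -subr_gt0 tB.
have VPhL (y : H) : V (PhL y) by exact: VPh.
have Ph_le (y : H) : `|PhL y| <= `|y| by exact: (orthogonal_projection_norm
  hPh).
have FK (y : H) : `|F y| <= opnorm F * `|y| by exact: opnorm_le.
have TE (y : H) (u : U) : T y u = PhL (G y u) by [].
have GK := opnorm2_le bG.
have Y_bound : (msq P (fun w => `|Y w|)%R <=
    (growth (opnorm F) (opnorm2 G) q (t j) (t j.+1) *
     expect P (fun w => `|step_state j w| ^+ 2))%:E)%E.
  exact: (milstein_increment_bound hFt onb mu_ge0 Qf levyL sqL martL covL oe
    VPhL
    Ph_le FK (opnorm_ge0 F) (opnorm2_ge0 bG) GK TE mu_q (t_ge0 j) tj mx x2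
    msigma itJ double_sum_cvg).
have Y_measurable v : measurable_wrt (Ft (t j.+1)) (fun w => inner (Y w) v).
  exact: (milstein_increment_measurable hFt onb mu_ge0 Qf levyL sqL martL covL
    oe
    VPhL Ph_le FK (opnorm_ge0 F) (opnorm2_ge0 bG) GK TE mu_q (t_ge0 j) tj mx x2
    msigma itJ double_sum_cvg).
have VY w : V (Y w).
  rewrite /Y /milstein_increment; apply: lin_spanD; last by rewrite -/S' S'E.
  apply: lin_spanD; last exact: VPh.
  apply: lin_spanD; last by apply: lin_spanZ; exact: VPh.
  by exists (fun k => coords j k w).
have nextE : {ae P, forall w, X j.+1 w = resolvent V Ah dt (Y w)}.
  apply: filterS3 stepE aeX aeS => w -> Xw Sw.
  by rewrite /Y /milstein_increment tB {1}Xw {1}Xw {1}Xw Sw.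
have sF1 := filt_sigma hFt (t_ge0 j.+1).
have VX1 : {ae P, forall w, V (X j.+1 w)}.
  apply: filterS nextE => w ->.
  exact: (resolvent_stable oe linB VDB hAh hlambda dt0).
(* Through the linearity of the resolvent on [V], the new coordinates are almost surely fixed linear
   combinations of those of [Y]. *)
have mx1 k : measurable_wrt (Ft (t j.+1)) (coords j.+1 k).
  have nullF : P.-negligible `<=` Ft (t j.+1).
    by move=> A /(filt_null hFt); exact: (filt_mono hFt).
  apply: (ae_measurable_wrt sF1 nullF (c' := fun w =>
      \sum_i inner (Y w) (e i) * inner (resolvent V Ah dt (e i)) (e k))).
    apply: (measurable_wrt_sum sF1) => i; apply: (measurable_wrtM sF1) => //.
    exact: measurable_wrt_cst.
  apply: filterS nextE => w Xw; rewrite /coords Xw.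
  have RhE : resolvent V Ah dt (\sum_i inner (Y w) (e i) *: e i) =
      \sum_i inner (Y w) (e i) *: resolvent V Ah dt (e i).
    have Rh_lin := resolvent_linear oe linB VDB hAh hlambda dt0.
    have V0 : V 0 by rewrite -(scale0r (Y w)); exact: lin_spanZ.
    have Rh0 : resolvent V Ah dt 0 = 0.
      have := Rh_lin 1 _ _ V0 V0; rewrite !scale1r addr0 => /eqP.
      by rewrite -subr_eq subrr => /eqP.
    have [_ ->//] : V (\sum_i inner (Y w) (e i) *: e i) /\
      resolvent V Ah dt (\sum_i inner (Y w) (e i) *: e i) =
      \sum_i inner (Y w) (e i) *: resolvent V Ah dt (e i).
    elim/big_ind2 : _ => [//|y y' z z' [Vy Ry] [Vz Rz]|i _].
      split; first exact: lin_spanD.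
      by rewrite -[in LHS](scale1r y') Rh_lin// Ry Rz scale1r.
    split; first exact/lin_spanZ/mem_lin_span.
    rewrite -[_ *: e i]addr0 Rh_lin ?Rh0 ?addr0//; exact: mem_lin_span.
  rewrite {1}(orthonormal_expansion oe (VY w)) RhE inner_suml.
  by apply: eq_bigr => i _; rewrite innerZl.
split => //.
have mX1 := measurable_step_state (filt_measurable hFt (t_ge0 j.+1)) mx1.
have mY : measurable_fun setT (fun w => `|Y w|).
  rewrite (_ : (fun w => _) = fun w => Num.sqrt (\sum_k inner (Y w) (e k) ^+
    2)).
    apply: measurableT_comp.
      by apply: continuous_measurable_fun; exact: sqrt_continuous.
    apply: measurable_sum => k; apply: measurable_funX.
    exact: (filtration_measurable_fun hFt (t_ge0 j.+1) (Y_measurable (e k))).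
  apply/funext => w; rewrite -[LHS]ger0_norm// -sqrtr_sqr.
  by rewrite {1}(orthonormal_expansion oe (VY w)) norm_orthonormal_sum.
apply: (@le_trans _ _ (msq P (fun w => (1 + dt * lambda)^-1 * `|Y w|)%R)).
  apply: ae_ge0_le_integral => //.
  - by apply/measurable_EFinP; apply: measurable_funX; exact: measurable_norm.
  - by move=> w _; rewrite lee_fin sqr_ge0.
  - by apply/measurable_EFinP; apply: measurable_funX; exact: measurable_funM.
  - apply: filterS2 (step_state_ae VX1) nextE => w <- Xw _.
    rewrite lee_fin ler_sqr ?nnegrE ?mulr_ge0 ?invr_ge0 ?(ltW dl0)//.
    rewrite Xw ler_pdivlMl//.
    exact: (resolvent_norm oe linB VDB hAh hlambda dt0 (VY w)).
rewrite msqZ//.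
apply: (@le_trans _ _ (((1 + dt * lambda)^-1 ^+ 2)%:E *
    (growth (opnorm F) (opnorm2 G) q 0 dt * m0)%:E)%E).
  apply: lee_wpmul2l; first by rewrite lee_fin sqr_ge0.
  apply: (le_trans Y_bound); rewrite lee_fin.
  have -> : growth (opnorm F) (opnorm2 G) q (t j) (t j.+1) =
    growth (opnorm F) (opnorm2 G) q 0 dt by rewrite /growth subr0 tB.
  by rewrite ler_wpM2l// growth0_ge0.
by rewrite -EFinM lee_fin /rate exprVn mulrA [X in X * _]mulrC.
Qed.

End step.

Lemma good_state0 X m0 : initial_value P Ft V (X 0%N) ->
  (mean_square P (X 0%N) <= m0%:E)%E -> good_state X 0 m0.
Proof.
move=> [_ mX VX] msX.
have VX0 : {ae P, forall w, V (X 0%N w)} by apply: nearW.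
have mx k : measurable_wrt (Ft (0%:R * dt)) (fun w => inner (X 0%N w) (e k)).
  rewrite mul0r.
  exact: (measurable_wrt_comp (@continuous_inner _ _ (e k)) mX).
split=> //; apply: le_trans msX.
have F0m : Ft (0%:R * dt) `<=` measurable.
  by rewrite mul0r; exact: (filt_measurable hFt).
rewrite -(mean_square_ae _ (step_state_ae VX0))//.
exact/measurable_norm/(measurable_step_state F0m mx).
Qed.

Lemma good_state_iter X m0 :
  (forall j, milstein_step P Ft (resolvent V Ah dt) Ph F G L mu f dt X j) ->
  0 <= m0 -> good_state X 0 m0 -> forall j, good_state X j (rate ^+ j * m0).
Proof.
move=> stepX m00 X0; elim=> [|j]; first by rewrite expr0 mul1r.
rewrite exprS -mulrA; apply: (good_state_step (stepX j)).
by rewrite mulr_ge0// exprn_ge0// divr_ge0// exprn_ge0// ltW.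
Qed.

Lemma galerkin_milstein_stable :
  growth (opnorm F) (opnorm2 G) q 0 dt < (1 + dt * lambda) ^+ 2 ->
  asymptotically_mean_square_stable P Ft V
    [set X | exists X0 : Omega -> H,
       [/\ square_integrable P X0, measurable_wrt (Ft 0) X0 &
          milstein_scheme P Ft (resolvent V Ah dt) Ph F G L mu f dt X0 X]].
Proof.
move=> hcond.
have rate0 : 0 <= rate by rewrite divr_ge0// exprn_ge0// ltW.
have rate1 : rate < 1 by rewrite /rate ltr_pdivrMr ?exprn_gt0// mul1r.
have decay X (m0 : R) : 0 <= m0 ->
    (exists X0 : Omega -> H,
       [/\ square_integrable P X0, measurable_wrt (Ft 0) X0 &
          milstein_scheme P Ft (resolvent V Ah dt) Ph F G L mu f dt X0 X]) ->
    initial_value P Ft V (X 0%N) -> (mean_square P (X 0%N) <= m0%:E)%E ->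
    forall j, (mean_square P (X j) <= (rate ^+ j * m0)%:E)%E.
  move=> m00 [X0 [_ _ [_ stepX]]] iX mX j.
  have [VX mx] := good_state_iter stepX m00 (good_state0 iX mX) j.
  rewrite -(mean_square_ae _ (step_state_ae VX))//.
  apply: measurable_norm.
  apply: (measurable_step_state _ mx); apply: (filt_measurable hFt).
  by rewrite mulr_ge0// ltW.
split=> [eps eps0|].
  (* As [rate < 1], the second moment never exceeds its initial value, so [delta = eps] works. The
     bound is run from the exact initial moment to keep the final inequality strict. *)
  exists eps => // X schX iX mX j.
  have ms_ge0 : (0 <= mean_square P (X 0%N))%E by exact: mean_square_ge0.
  have msE : mean_square P (X 0%N) = (fine (mean_square P (X 0%N)))%:E.
    by rewrite fineK// ge0_fin_numE// (lt_trans mX)// ltry.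
  have m00 : 0 <= fine (mean_square P (X 0%N)) by exact: fine_ge0.
  apply: le_lt_trans mX.
  rewrite [leRHS]msE; apply: (le_trans (decay X _ m00 schX iX _ j)).
    by rewrite -msE.
  by rewrite lee_fin ler_piMl// exprn_ile1// ltW.
(* The decay holds for every finite initial moment; the value 1 is arbitrary. *)
exists 1 => // X schX iX mX.
apply: (@squeeze_cvge _ _ _ _ (cst 0%E) _ (fun j => (rate ^+ j * 1)%:E)).
- apply: nearW => j; rewrite mean_square_ge0/=.
  exact: (decay X 1 ler01 schX iX (ltW mX)).
- exact: cvg_cst.
- apply: cvg_EFin; first by apply: nearW.
  have := @cvg_geometric _ 1 rate; rewrite ger0_norm// => /(_ rate1).
  apply: cvg_trans; apply: near_eq_cvg; apply: nearW => j.
  by rewrite /geometric/= mulrC.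
Qed.

End galerkin_milstein.

Theorem proposition3p8
  (R : realType)
  (* filtered probability space *)
  (d : measure_display) (Omega : measurableType d) (P : probability Omega R)
  (Ft : R -> set (set Omega)) (hFt : usual_filtration P Ft)
  (* Hilbert spaces and the Hilbert tensor product of U with itself *)
  (H U U2 : hilbertType R) (sepH : separable H) (sepU : separable U)
  (tens : {bilinear U -> U -> U2}) (htens : hilbert_tensor_product tens)
  (* -A with domain DA; B = (-A)^(1/2) with domain DB = \dot H^1 *)
  (DA : set H) (A : H -> H)
  (saA : self_adjoint DA (fun v => - A v))
  (pdA : positive_definite DA (fun v => - A v))
  (ciA : has_compact_inverse DA (fun v => - A v))
  (DB : set H) (B : H -> H)
  (hB : operator_sqrt DA (fun v => - A v) DB B)
  (* coefficients *)
  (F : {linear H -> H}) (cF : continuous F)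
  (G : {bilinear H -> U -> H}) (bG : bounded_operator_valued G)
  (* noise *)
  (Q : {linear U -> U}) (cQ : continuous Q)
  (saQ : forall u v, inner (Q u) v = inner u (Q v))
  (posQ : forall u, 0 <= inner (Q u) u)
  (mu : nat -> R) (f : nat -> U) (onb : orthonormal_basis f)
  (mu_ge0 : forall k, 0 <= mu k) (mu_noninc : forall k, mu k.+1 <= mu k)
  (Qf : forall k, Q (f k) = mu k *: f k)
  (tcQ : trace_class f Q)
  (L : R -> Omega -> U) (levyL : levy_process P Ft L)
  (sqL : forall t, 0 <= t -> square_integrable P (L t))
  (martL : martingale P Ft L) (covL : covariance_operator P L Q)
  (* discretization *)
  (Vh : R -> set H)
  (fdV : forall h, 0 < h <= 1 -> finite_dim_subspace (Vh h) /\ Vh h `<=` DB)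
  (h : R) (hh : 0 < h <= 1) (dt : R) (dt_gt0 : 0 < dt)
  (Ph : H -> H) (hPh : orthogonal_projection (Vh h) Ph)
  (Ah : H -> H) (hAh : galerkin_operator (Vh h) B Ah)
  (lambda : R) (hlambda : smallest_eigenvalue (Vh h) (fun v => - Ah v) lambda)
  (hC : uniquely_extends_to_tensor (Vh h) tens
          (fun u1 u2 v => resolvent (Vh h) Ah dt (Ph (G (G v u1) u2))))
  (hcond : (1 + dt * opnorm F) ^+ 2 + dt * trace f Q * opnorm2 G ^+ 2
           + dt ^+ 2 / 2 * trace f Q ^+ 2 * opnorm2 G ^+ 4
           < (1 + dt * lambda) ^+ 2) :
  asymptotically_mean_square_stable P Ft (Vh h)
    [set X | exists X0 : Omega -> H,
       [/\ square_integrable P X0, measurable_wrt (Ft 0) X0 &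
          milstein_scheme P Ft (resolvent (Vh h) Ah dt) Ph F G L mu f dt X0 X]].
Proof.
have [[m [b Vb]] VDB] := fdV h hh.
have [n [e [oe Ve]]] := gram_schmidt b.
have VE : Vh h = lin_span e by rewrite Vb -Ve.
rewrite VE in VDB hPh hAh hlambda *.
(* Linearity of [B] on [DB] is part of the self-adjointness of the square root. *)
have [[linB _ _] _ _] := hB.
apply: (galerkin_milstein_stable hFt cF bG onb mu_ge0 Qf tcQ levyL sqL martL
  covL oe linB VDB hPh hAh dt_gt0 hlambda).
by rewrite /growth subr0.
Qed.
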